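(* Let $K=\mathbb{Q}(\sqrt{-D})\subset\mathbb{C}$ be an imaginary quadratic number field whose discriminant $d_K$ satisfies $|d_K|<70$. Then the projective Hermite constant $\gamma_K^p$ and the associated absolutely projective extreme forms of determinant $1$, modulo the action of $\mathrm{SL}_2(\mathcal{O}_K)$, are given by the following list, where $[a,b,c]$ denotes the hermitian form $\left(\begin{smallmatrix}a&b\\ \bar b&c\end{smallmatrix}\right)$ and $\mathrm{i}=\sqrt{-1}$. $-d_K=3$: $\gamma_K^p=\sqrt{3/2}$; forms $[\frac{\sqrt3}{\sqrt2},\pm\frac{\mathrm{i}}{\sqrt2},\frac{\sqrt3}{\sqrt2}]$. $-d_K=4$: $\gamma_K^p=\sqrt2$; forms $[\sqrt2,\pm\frac{1+\mathrm{i}}{\sqrt2},\sqrt2]$. $-d_K=7$: $\gamma_K^p=\sqrt{7/3}$; forms $[\frac{\sqrt7}{\sqrt3},\pm\frac{2\mathrm{i}}{\sqrt3},\frac{\sqrt7}{\sqrt3}]$. $-d_K=8$: $\gamma_K^p=2$; forms $[2,\pm\frac{\sqrt2+2\mathrm{i}}{\sqrt2},2]$. $-d_K=11$: $\gamma_K^p=\sqrt{11/2}$; forms $[\frac{\sqrt{11}}{\sqrt2},\pm\frac{3\mathrm{i}}{\sqrt2},\frac{\sqrt{11}}{\sqrt2}]$. $-d_K=15$: $\gamma_K^p=\sqrt3$; forms $[\sqrt3,\pm\sqrt5\,\mathrm{i},2\sqrt3]$. $-d_K=19$: $\gamma_K^p=\sqrt{19/2}$; forms $[\frac{\sqrt{19}}{\sqrt2},\pm\frac{6\mathrm{i}}{\sqrt2},\frac{2\sqrt{19}}{\sqrt2}]$.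 $-d_K=20$: $\gamma_K^p=\sqrt5$; forms $[\sqrt5,\pm\sqrt5\,\mathrm{i},3\sqrt5]$. $-d_K=23$: $\gamma_K^p=\sqrt{23/5}$; forms $[\frac{\sqrt{23}}{\sqrt5},\pm\frac{\sqrt8\,\mathrm{i}}{\sqrt5},\frac{\sqrt{23}}{\sqrt5}]$. $-d_K=24$: $\gamma_K^p=2\sqrt3$; forms $[\sqrt{12},\pm\frac{\sqrt6+4\mathrm{i}}{\sqrt2},\sqrt{12}]$. $-d_K=31$: $\gamma_K^p=\sqrt{31/3}$; forms $[\frac{\sqrt{31}}{\sqrt3},\pm\frac{\sqrt8\,\mathrm{i}}{\sqrt5},\frac{4\sqrt{31}}{\sqrt3}]$. $-d_K=35$: $\gamma_K^p=\sqrt7$; forms $[\sqrt7,\pm\frac{10\mathrm{i}}{\sqrt5},3\sqrt7]$. $-d_K=39$: $\gamma_K^p=\sqrt{13}$; forms $[\sqrt{13},\pm\frac{6\mathrm{i}}{\sqrt3},\sqrt{13}]$. $-d_K=40$: $\gamma_K^p=6\sqrt{5/13}$; forms $[\frac{3\sqrt{20}}{\sqrt{13}},-\frac{3\sqrt{10}\pm22\mathrm{i}}{\sqrt{26}},\frac{10\sqrt5}{\sqrt{13}}]$ and $[\frac{3\sqrt{20}}{\sqrt{13}},\pm\frac{\sqrt{10}\pm18\mathrm{i}}{\sqrt{26}},\frac{3\sqrt{20}}{\sqrt{13}}]$. $-d_K=43$: $\gamma_K^p=\sqrt{43/2}$; forms $[\frac{\sqrt{43}}{\sqrt2},\pm\frac{16\mathrm{i}}{\sqrt2},\frac{6\sqrt{43}}{\sqrt2}]$.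 $-d_K=47$: $\gamma_K^p=\sqrt{47/5}$; forms $[\frac{\sqrt{47}}{\sqrt5},\pm\frac{18\mathrm{i}}{\sqrt5},\frac{7\sqrt{47}}{\sqrt5}]$ and $[\frac{2\sqrt{47}}{\sqrt5},\pm\frac{29\mathrm{i}}{\sqrt5},\frac{9\sqrt{47}}{\sqrt5}]$. $-d_K=51$: $\gamma_K^p=\sqrt{51/2}$; forms $[\frac{\sqrt{51}}{\sqrt2},\pm\frac{7\mathrm{i}}{\sqrt2},\frac{\sqrt{51}}{\sqrt2}]$ and $[\frac{\sqrt{51}}{\sqrt2},\pm\frac{10\mathrm{i}}{\sqrt2},\frac{2\sqrt{51}}{\sqrt2}]$. $-d_K=52$: $\gamma_K^p=\sqrt{52/3}$; forms $[\frac{\sqrt{52}}{\sqrt3},\pm\frac{7\mathrm{i}}{\sqrt3},\frac{\sqrt{52}}{\sqrt3}]$ and $[\frac{\sqrt{52}}{\sqrt3},-\frac{\sqrt{13}\pm6\mathrm{i}}{\sqrt3},\frac{\sqrt{52}}{\sqrt3}]$. $-d_K=55$: $\gamma_K^p=4\sqrt{11/19}$; forms $[\frac{4\sqrt{11}}{\sqrt{19}},\pm\frac{35\mathrm{i}}{\sqrt{95}},\frac{6\sqrt{11}}{\sqrt{19}}]$, $[\frac{5\sqrt{11}}{\sqrt{19}},\pm\frac{7\sqrt{11}+5\sqrt{19}\,\mathrm{i}}{2\sqrt{19}},\frac{11\sqrt{11}}{\sqrt{19}}]$ and $[\frac{5\sqrt{11}}{\sqrt{19}},\pm\left(\frac{3\sqrt{11}}{2\sqrt{19}}+\frac{\sqrt{19}\,\mathrm{i}}{\sqrt5}\right),\frac{9\sqrt{11}}{\sqrt{19}}]$.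 $-d_K=56$: $\gamma_K^p=2\sqrt{7/3}$; forms $[\frac{\sqrt{28}}{\sqrt3},-\frac{\sqrt7+6\sqrt2\,\mathrm{i}}{\sqrt3},\frac{79}{\sqrt{84}}]$ and $[\frac{\sqrt{28}}{\sqrt3},-\frac{11\sqrt7+53\sqrt2\,\mathrm{i}}{\sqrt3},\frac{2155\sqrt3}{11\sqrt{28}}]$. $-d_K=59$: $\gamma_K^p=\sqrt{59/2}$; forms $[\frac{\sqrt{59}}{\sqrt2},\pm\frac{23\mathrm{i}}{\sqrt2},\frac{9\sqrt{59}}{\sqrt2}]$ and $[\sqrt{118},-\frac{59+23\sqrt{59}\,\mathrm{i}}{\sqrt{118}},\frac{5\sqrt{59}}{\sqrt2}]$. $-d_K=67$: $\gamma_K^p=\sqrt{67/2}$; forms $[\frac{\sqrt{67}}{\sqrt2},\pm\frac{20\mathrm{i}}{\sqrt2},\frac{6\sqrt{67}}{\sqrt2}]$. $-d_K=68$: $\gamma_K^p=\sqrt{34}$; forms $[\sqrt{34},-\frac{\sqrt{17}+7\mathrm{i}}{\sqrt2},\sqrt{34}]$ and $[9\sqrt{34},-\frac{9\sqrt{17}+95\mathrm{i}}{\sqrt2},17\sqrt{34}]$.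
   Context: $K$ is an imaginary quadratic field regarded as a subfield of $\mathbb{C}$, with ring of integers $\mathcal{O}_K$ and discriminant $d_K$; $D$ is a square-free positive integer. $\mathcal P$ is the set of positive definite binary hermitian forms, identified with positive definite $2\times2$ hermitian matrices; $S(v)$ denotes the value of $S$ at a column vector $v\in\mathbb{C}^2$, that is, $S(v)=v^*Sv$ with $*$ the conjugate transpose. The determinant of a form is the determinant of its matrix. For $v\in\mathcal{O}_K^2\setminus\{0\}$, $\langle v\rangle$ is the ideal of $\mathcal{O}_K$ generated by the coordinates of $v$ and $N_K(\langle v\rangle)$ is its norm. The projective minimum of $S\in\mathcal P$ is $\mu_K^p(S)=\min_{v\in\mathcal{O}_K^2\setminus\{0\}} S(v)/N_K(\langle v\rangle)$, and the projective Hermite constant of $K$ is $\gamma_K^p=\max_{S\in\mathcal P}\mu_K^p(S)/\det(S)^{1/2}$. A form $S\in\mathcal P$ is absolutely projective extreme (with respect to $K$) if the function $S\mapsto\mu_K^p(S)/\det(S)^{1/2}$ on $\mathcal P$ attains its absolute maximum at $S$. The group $\mathrm{SL}_2(\mathcal{O}_K)$ acts on $\mathcal P$ by $g\cdot S=(g^{-1})^*S\,g^{-1}$.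
   Formalization: For -d_K=20, 23, 31, 55 (2nd and 3rd families) and 56 the printed forms do not have determinant 1; their coefficients b and/or c are corrected to give extreme forms of determinant 1. The list is proved to meet every class; listed forms may be equivalent. *)

(* Defs.v *)
From HB Require Import structures.
From mathcomp Require Import all_boot all_order all_algebra.
From mathcomp Require Import all_classical all_reals.
From mathcomp Require Import complex.

Set Implicit Arguments.
Unset Strict Implicit.
Unset Printing Implicit Defensive.

Import Order.TTheory GRing.Theory Num.Theory.

Local Open Scope classical_set_scope.
Local Open Scope ring_scope.
Local Open Scope complex_scope.
Local Open Scope sesquilinear_scope.
Local Open Scope card_scope.

Local Notation "√ x" := (Num.sqrt x%R) (at level 10, x at level 9).

Definition square_free (D : nat) : Prop := forall m : nat, (m ^ 2 %| D)%N -> m = 1%N.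

(* Junk value 0 when the set has no least (resp. greatest) element. *)
Definition minimum (R : realType) (A : set R) : R := xget 0 (A `&` lbound A).
Definition maximum (R : realType) (A : set R) : R := xget 0 (A `&` ubound A).

(* The field Q(sqrt(-D)) as a subset of the complex numbers R[i]. *)
Definition imquad (R : realType) (D : nat) : set R[i] :=
  [set z | exists a b : rat, z = ratr a + ratr b * (0 +i* √ (D%:R))].

Definition OK (R : realType) (D : nat) : set R[i] :=
  imquad D `&` [set z | integralOver (intr : int -> R[i]) z].

Definition integral_basis (R : realType) (D : nat) (w1 w2 : R[i]) : Prop :=
  (forall m n : int, w1 *~ m + w2 *~ n = 0 -> m = 0 /\ n = 0) /\
  OK D = [set z | exists m n : int, z = w1 *~ m + w2 *~ n].

(* Squared determinant of the two complex embeddings (identity and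
   conjugation) on an integral basis. *)
Definition disc (R : realType) (D : nat) : int :=
  xget 0 [set d : int | exists w1 w2 : R[i],
    integral_basis D w1 w2 /\ d%:~R = (w1 * w2^* - w2 * w1^*) ^+ 2].

Definition OKvec (R : realType) (D : nat) : set 'cV[R[i]]_2 :=
  [set v : 'cV[R[i]]_2 | forall i, OK D (v i 0)].

Definition ideal_gen (R : realType) (D : nat) (v : 'cV[R[i]]_2) : set R[i] :=
  [set z | exists a b : R[i],
    [/\ OK D a, OK D b & z = a * v ord0 0 + b * v ord_max 0]].

(* The number of cosets of I in the ring of integers (0 if infinite). *)
Definition ideal_norm (R : realType) (D : nat) (I : set R[i]) : nat :=
  xget 0%N [set n : nat |
    [set [set y | OK D y /\ I (y - x)] | x in OK D] #= `I_n].

(* S(v) = v^* S v, which is real for S hermitian. *)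
Definition hval (R : realType) (S : 'M[R[i]]_2) (v : 'cV[R[i]]_2) : R :=
  complex.Re ((v ^t* *m S *m v) 0 0).

(* The determinant, which is real for S hermitian. *)
Definition hdet (R : realType) (S : 'M[R[i]]_2) : R := complex.Re (\det S).

Definition posdef (R : realType) : set 'M[R[i]]_2 :=
  [set S : 'M[R[i]]_2 | S ^t* = S /\ forall v, v != 0 -> 0 < hval S v].

Definition proj_min (R : realType) (D : nat) (S : 'M[R[i]]_2) : R :=
  minimum [set hval S v / (ideal_norm D (ideal_gen D v))%:R
          | v in [set v | OKvec D v /\ v != 0]].

Definition proj_hermite_fun (R : realType) (D : nat) (S : 'M[R[i]]_2) : R :=
  proj_min D S / √ (hdet S).

Definition proj_hermite (R : realType) (D : nat) : R :=
  maximum [set proj_hermite_fun D S | S in @posdef R].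

Definition abs_proj_extreme (R : realType) (D : nat) (S : 'M[R[i]]_2) : Prop :=
  posdef S /\
  forall T, posdef T -> proj_hermite_fun D T <= proj_hermite_fun D S.

Definition SL2OK (R : realType) (D : nat) : set 'M[R[i]]_2 :=
  [set g : 'M[R[i]]_2 | (forall i j, OK D (g i j)) /\ \det g = 1].

Definition hact (R : realType) (g S : 'M[R[i]]_2) : 'M[R[i]]_2 :=
  (invmx g) ^t* *m S *m invmx g.

(* [a, b, c] *)
Definition hform (R : realType) (a : R) (b : R[i]) (c : R) : 'M[R[i]]_2 :=
  \matrix_(i < 2, j < 2)
    if i == ord0 then (if j == ord0 then a%:C else b)
    else (if j == ord0 then b^* else c%:C).

(* [a, b, c] and [a, -b, c] *)
Definition hform_pm (R : realType) (a : R) (b : R[i]) (c : R)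
  : seq 'M[R[i]]_2 := [:: hform a b c; hform a (- b) c].

(* Entries (- d_K, gamma_K^p, representatives).  For - d_K = 20, 23, 31, 55,
   56 some representatives in the source have determinant different from 1
   (for 56 they are not even positive definite); such an entry is replaced
   here by an absolutely projective extreme form of determinant 1. *)
Definition extreme_table (R : realType) : seq (nat * R * seq 'M[R[i]]_2) :=
  [:: (3%N, √ (3 / 2),
        hform_pm (√ 3 / √ 2) (0 +i* (1 / √ 2)) (√ 3 / √ 2));
      (4%N, √ 2,
        hform_pm (√ 2) ((1 / √ 2) +i* (1 / √ 2)) (√ 2));
      (7%N, √ (7 / 3),
        hform_pm (√ 7 / √ 3) (0 +i* (2 / √ 3)) (√ 7 / √ 3));
      (8%N, 2,
        hform_pm 2 ((√ 2 / √ 2) +i* (2 / √ 2)) 2);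
      (11%N, √ (11 / 2),
        hform_pm (√ 11 / √ 2) (0 +i* (3 / √ 2)) (√ 11 / √ 2));
      (15%N, √ 3,
        hform_pm (√ 3) (0 +i* √ 5) (2 * √ 3));
      (19%N, √ (19 / 2),
        hform_pm (√ 19 / √ 2) (0 +i* (6 / √ 2)) (2 * √ 19 / √ 2));
      (20%N, √ 5,
        (* corrected: b was sqrt 5 * i *)
        hform_pm (√ 5) (√ 5 +i* 3) (3 * √ 5));
      (23%N, √ (23 / 5),
        (* corrected: b was sqrt 8 * i / sqrt 5 *)
        hform_pm (√ 23 / √ 5) ((√ 23 / (2 * √ 5)) +i* (7 / (2 * √ 5)))
          (√ 23 / √ 5));
      (24%N, 2 * √ 3,
        hform_pm (√ 12) ((√ 6 / √ 2) +i* (4 / √ 2)) (√ 12));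
      (31%N, √ (31 / 3),
        (* corrected: b was sqrt 8 * i / sqrt 5 *)
        hform_pm (√ 31 / √ 3) (0 +i* (11 / √ 3)) (4 * √ 31 / √ 3));
      (35%N, √ 7,
        hform_pm (√ 7) (0 +i* (10 / √ 5)) (3 * √ 7));
      (39%N, √ 13,
        hform_pm (√ 13) (0 +i* (6 / √ 3)) (√ 13));
      (40%N, 6 * √ (5 / 13),
        [:: hform (3 * √ 20 / √ 13) (- ((3 * √ 10 / √ 26) +i* (22 / √ 26)))
              (10 * √ 5 / √ 13);
            hform (3 * √ 20 / √ 13) (- ((3 * √ 10 / √ 26) -i* (22 / √ 26)))
              (10 * √ 5 / √ 13)]
        ++ hform_pm (3 * √ 20 / √ 13) ((√ 10 / √ 26) +i* (18 / √ 26))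
             (3 * √ 20 / √ 13)
        ++ hform_pm (3 * √ 20 / √ 13) ((√ 10 / √ 26) -i* (18 / √ 26))
             (3 * √ 20 / √ 13));
      (43%N, √ (43 / 2),
        hform_pm (√ 43 / √ 2) (0 +i* (16 / √ 2)) (6 * √ 43 / √ 2));
      (47%N, √ (47 / 5),
        hform_pm (√ 47 / √ 5) (0 +i* (18 / √ 5)) (7 * √ 47 / √ 5)
        ++ hform_pm (2 * √ 47 / √ 5) (0 +i* (29 / √ 5)) (9 * √ 47 / √ 5));
      (51%N, √ (51 / 2),
        hform_pm (√ 51 / √ 2) (0 +i* (7 / √ 2)) (√ 51 / √ 2)
        ++ hform_pm (√ 51 / √ 2) (0 +i* (10 / √ 2)) (2 * √ 51 / √ 2));
      (52%N, √ (52 / 3),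
        hform_pm (√ 52 / √ 3) (0 +i* (7 / √ 3)) (√ 52 / √ 3)
        ++ [:: hform (√ 52 / √ 3) (- ((√ 13 / √ 3) +i* (6 / √ 3)))
                 (√ 52 / √ 3);
               hform (√ 52 / √ 3) (- ((√ 13 / √ 3) -i* (6 / √ 3)))
                 (√ 52 / √ 3)]);
      (55%N, 4 * √ (11 / 19),
        hform_pm (4 * √ 11 / √ 19) (0 +i* (35 / √ 95)) (6 * √ 11 / √ 19)
        (* corrected: b had imaginary part 5 * sqrt 19 / (2 * sqrt 19) *)
        ++ hform_pm (5 * √ 11 / √ 19)
             ((7 * √ 11 / (2 * √ 19)) +i* (19 * √ 5 / (2 * √ 19)))
             (11 * √ 11 / √ 19)
        (* corrected: b had imaginary part sqrt 19 / sqrt 5 *)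
        ++ hform_pm (5 * √ 11 / √ 19)
             ((3 * √ 11 / (2 * √ 19)) +i* (√ 19 * √ 5 / 2))
             (9 * √ 11 / √ 19));
      (56%N, 2 * √ (7 / 3),
        (* corrected: b had imaginary part - 6 * sqrt 2 / sqrt 3,
           c was 79 / sqrt 84 *)
        [:: hform (√ 28 / √ 3) (- ((√ 7 / √ 3) +i* (3 * √ 2 / √ 3)))
              (√ 28 / √ 3);
        (* corrected: c was 2155 * sqrt 3 / (11 * sqrt 28) *)
            hform (√ 28 / √ 3) (- ((11 * √ 7 / √ 3) +i* (53 * √ 2 / √ 3)))
              (2156 * √ 3 / √ 28)]);
      (59%N, √ (59 / 2),
        hform_pm (√ 59 / √ 2) (0 +i* (23 / √ 2)) (9 * √ 59 / √ 2)
        ++ [:: hform (√ 118) (- ((59 / √ 118) +i* (23 * √ 59 / √ 118)))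
                 (5 * √ 59 / √ 2)]);
      (67%N, √ (67 / 2),
        hform_pm (√ 67 / √ 2) (0 +i* (20 / √ 2)) (6 * √ 67 / √ 2));
      (68%N, √ 34,
        [:: hform (√ 34) (- ((√ 17 / √ 2) +i* (7 / √ 2))) (√ 34);
            hform (9 * √ 34) (- ((9 * √ 17 / √ 2) +i* (95 / √ 2)))
              (17 * √ 34)])].

(* Main.v *)
Require Import Defs.
From Stdlib Require Import ZArith.
From HB Require Import structures.
From mathcomp Require Import all_boot all_order all_algebra.
From mathcomp Require Import ssrZ zify ring lra.
From mathcomp Require Import all_classical all_reals.
From mathcomp Require Import algC algnum.
From mathcomp Require Import complex.

Set Implicit Arguments.
Unset Strict Implicit.
Unset Printing Implicit Defensive.

(* Scale a form so that its projective minimum is 1: then H(v) >= N(v) for all v,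
   with equality at some v0. Reduction of ideals and transitivity of SL_2(O_K) on
   pairs generating a given ideal move v0 to one of finitely many cusps
   (a, b + w), one for each ideal class. There, with y = a w2 - (b + w) w1,
     a H(w) = |w1 - z y|^2 + det(H) |y|^2,
   so H is determined by det H and the point z of C, and if det H <= d := 1 / gamma^2
   then H(w) >= N(w) keeps z out of the disc with centre w1 / y and squared radius
   a N(w) / |y|^2 - d. The translations fixing the cusp bring z into a
   parallelogram, which finitely many of these open discs cover except for finitely
   many points, where H is the image of a listed form. To certify the covering,
   cut the parallelogram into the cells of the power diagram of the discs: by
   convexity it is enough to inspect the vertices of each cell. Conversely, that a
   listed form F satisfies F(v) >= N(v) is, for each ideal class, a finite
   enumeration. *)

Import Order.TTheory GRing.Theory Num.Theory.
Local Open Scope classical_set_scope.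
Local Open Scope ring_scope.

(** One identity yields both the bound and the classification. At the foot of H, the quadratic
    attached to the disc of w equals dd a (H(w) - N(w)) + (dn - dd det H) |y|^2, where dn / dd = 1 /
    gamma^2. If H(w) >= N(w) and det H <= dn / dd, both terms are nonnegative; in a disc where the
    quadratic is at most 0 both vanish, so the determinant is exactly dn / dd and the foot is a zero
    of the quadratic. Only such zeros have to be controlled: strict convexity makes them vertices of
    the clipped cells, and each is matched with a listed form by an explicit matrix.

    The tabulated forms involve square roots, but each is gamma times a form with entries in K.
    Hence forms are normalized to the rational determinant dn / dd instead of 1, points are kept in
    homogeneous coordinates, and certificates are purely integral: they are checked by evaluation
    over [Z] and carried to the reals by a ring morphism.

    No reduction theory for arbitrary forms enters: a form whose quotients have no least value gets
    the default minimum 0, which lies below gamma. *)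

(* A pair (x, y) stands for x + y w, where w^2 = t w - n, and a triple
   ((h1, h2), h3) for the hermitian matrix with rows (h1, h2), (h2^*, h3). *)
Section QuadraticAlgebra.
Variables (A : comNzRingType) (t n : A).
Implicit Types (x y : A * A) (w : (A * A) * (A * A)).

Definition qadd x y := (x.1 + y.1, x.2 + y.2).
Definition qsub x y := (x.1 - y.1, x.2 - y.2).
Definition qscale (c : A) x := (c * x.1, c * x.2).
Definition qmul x y :=
  (x.1 * y.1 - n * (x.2 * y.2), x.1 * y.2 + x.2 * y.1 + t * (x.2 * y.2)).
Definition qconj x := (x.1 + t * x.2, - x.2).
Definition qnorm x := x.1 * x.1 + t * (x.1 * x.2) + n * (x.2 * x.2).
Definition qtr x := 2%:R * x.1 + t * x.2.

Definition herm := (A * (A * A) * A)%type.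
Implicit Type H : herm.

Definition hev H w :=
  H.1.1 * qnorm w.1 + H.2 * qnorm w.2 + qtr (qmul (qmul (qconj w.1) H.1.2) w.2).

Definition hdt H := H.1.1 * H.2 - qnorm H.1.2.

(* 2x2 matrices, as a pair of columns. *)
Definition mat2 := (((A * A) * (A * A)) * ((A * A) * (A * A)))%type.
Implicit Type g : mat2.

Definition mdet g := qsub (qmul g.1.1 g.2.2) (qmul g.2.1 g.1.2).
Definition mapp g w :=
  (qadd (qmul g.1.1 w.1) (qmul g.2.1 w.2), qadd (qmul g.1.2 w.1) (qmul g.2.2 w.2)).
Definition mmul g h := (mapp g h.1, mapp g h.2).
Definition madj g : mat2 :=
  ((g.2.2, qsub (0, 0) g.1.2), (qsub (0,0) g.2.1, g.1.1)).

(** The sesquilinear form of [H], conjugate-linear in [w], with [hev] on the diagonal. *)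
Definition hcross H w w' :=
  qadd (qadd (qscale H.1.1 (qmul (qconj w.1) w'.1)) (qscale H.2 (qmul (qconj w.2) w'.2)))
       (qadd (qmul (qmul (qconj w.1) H.1.2) w'.2) (qmul (qmul (qconj w.2) (qconj H.1.2)) w'.1)).

(** The congruent form $g^* H g$: its entries are the values of [H] on the columns of [g]. *)
Definition hpull H g : herm := (hev H g.1, hcross H g.1 g.2, hev H g.2).

Lemma pair_eq (x y : A * A) : x.1 = y.1 -> x.2 = y.2 -> x = y.
Proof. by case: x y => ? ? [? ?] /= -> ->. Qed.

End QuadraticAlgebra.

Ltac qexp := cbv [hpull hcross hev hdt mdet mapp mmul madj
  qadd qsub qscale qmul qconj qnorm qtr fst snd].
Ltac qring := first [apply: pair_eq | idtac]; qexp; ring.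

Section QuadraticIdentities.
Variables (A : comNzRingType) (t n : A).
Local Notation qmul := (qmul t n).
Local Notation qnorm := (qnorm t n).
Local Notation hev := (hev t n).
Local Notation hdt := (hdt t n).
Local Notation hpull := (hpull t n).
Local Notation mdet := (mdet t n).
Local Notation mapp := (mapp t n).
Local Notation hcross := (hcross t n).
Implicit Types (x y : A * A) (w : (A * A) * (A * A)) (H : herm A) (g : mat2 A).

Lemma qnormM x y : qnorm (qmul x y) = qnorm x * qnorm y.
Proof. qring. Qed.

Lemma hev_hpull H g w : hev (hpull H g) w = hev H (mapp g w).
Proof.
move: H g w => [[h1 [h2 h3]] h4] [[[p1 p2] [q1 q2]] [[r1 r2] [s1 s2]]] [[u1 u2] [v1 v2]].
qexp. ring.
Qed.

Lemma hdt_hpull H g : hdt (hpull H g) = hdt H * qnorm (mdet g).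
Proof.
move: H g => [[h1 [h2 h3]] h4] [[[p1 p2] [q1 q2]] [[r1 r2] [s1 s2]]].
qexp; ring.
Qed.

Lemma hcross_hpull H g w w' : hcross (hpull H g) w w' = hcross H (mapp g w) (mapp g w').
Proof.
move: H g w w' => [[h1 [h2 h3]] h4] [[[p1 p2] [q1 q2]] [[r1 r2] [s1 s2]]] [[u1 u2] [v1 v2]]
 [[a1 a2] [b1 b2]].
apply: pair_eq; qexp; ring.
Qed.
End QuadraticIdentities.

Definition zpt := (Z * Z)%type.

(** * Integral certificates and their verification *)

Section Checker.
Variables t n dn dd : Z.
Local Notation mul := (qmul t n).
Local Notation nm := (qnorm t n).

(* The norm of the ideal I generated by w, as the largest rational integer
   dividing I I^*. *)
Definition cnorm (w : zpt * zpt) : Z :=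
  let p := mul (qconj t w.1) w.2 in
  Z.gcd (Z.gcd (nm w.1) (nm w.2)) (Z.gcd p.1 p.2).

(* Points of C are given by homogeneous coordinates (in the basis 1, w). *)
Definition pt := (Z * Z * Z)%type.
Definition quad := (Z * (Z * Z * Z))%type.

Definition lin (l v : pt) : Z := l.1.1 * v.1.1 + l.1.2 * v.1.2 + l.2 * v.2.
Definition qev (f : quad) (v : pt) : Z :=
  f.1 * nm v.1 + lin f.2 v * v.2.

(* With y = a w2 - (b + w) w1 this is
   dd |y|^2 (|x - w1 / y|^2 - a N(w) / |y|^2 + dn / dd) as a function of x: where
   it is negative, a form H with H(a, b + w) = a, foot x and determinant at most
   dn / dd has H(w) < N(w). *)
Definition dist_quad (a b : Z) (w : zpt * zpt) : quad :=
  let y := qsub (qscale a w.2) (mul (b, 1) w.1) in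
  let m := mul (qconj t w.1) y in
  (dd * nm y, (- (dd * qtr t m), - (dd * qtr t (mul m (0, 1))),
    dd * (nm w.1 - a * cnorm w) + dn * nm y)).

(* Radical axis of two circles, negative on the side of f. *)
Definition bisector (f g : quad) : pt :=
  (g.1 * f.2.1.1 - f.1 * g.2.1.1, g.1 * f.2.1.2 - f.1 * g.2.1.2,
   g.1 * f.2.2 - f.1 * g.2.2).

(** Projectively the identity; dividing out the gcd keeps the integers small under repeated
    clipping. *)
Definition reduce (v : pt) : pt :=
  let g := Z.gcd (Z.gcd v.1.1 v.1.2) v.2 in
  (Z.div v.1.1 g, Z.div v.1.2 g, Z.div v.2 g).

(** The combination [c q - d p] lies on the zero line of [l]. It is used with [c > 0 >= d], so its
    weights are nonnegative and the last coordinate stays positive. *)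
Definition cut (l p q : pt) : pt :=
  let c := lin l p in let d := lin l q in
  reduce (c * q.1.1 - d * p.1.1, c * q.1.2 - d * p.1.2, c * q.2 - d * p.2).

Definition tri := (pt * pt * pt)%type.

(** Cutting off [p] leaves a quadrilateral, which is split along a diagonal through [q]; cutting off
    both [q] and [r], as in [clip2], leaves one triangle at [p]. *)
Definition clip1 (l p q r : pt) : seq tri :=
  let B := cut l p r in [:: (q, r, B); (q, B, cut l p q)].
Definition clip2 (l p q r : pt) : seq tri := [:: (p, cut l q p, cut l r p)].

Definition clip (l : pt) (T : tri) : seq tri :=
  let: (p, q, r) := T in
  match (0 < lin l p), (0 < lin l q), (0 < lin l r) with
  | false, false, false => [:: T]
  | true, false, false => clip1 l p q r
  | false, true, false => clip1 l q r p
  | false, false, true => clip1 l r p q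
  | false, true, true => clip2 l p q r
  | true, false, true => clip2 l q r p
  | true, true, false => clip2 l r p q
  | true, true, true => [::]
  end.

Definition same_pt (u v : pt) : bool :=
  (u.1.1 * v.2 == v.1.1 * u.2) && (u.1.2 * v.2 == v.1.2 * u.2).

(** A vertex on the circle is tolerated only at one of the points [ts], the feet of extreme
    forms. *)
Definition vertex_ok (ts : seq pt) (f : quad) (v : pt) : bool :=
  let x := qev f v in (x < 0) || (x == 0) && has (same_pt v) ts.

Definition tri_ok ts f (T : tri) : bool :=
  [&& vertex_ok ts f T.1.1, vertex_ok ts f T.1.2 & vertex_ok ts f T.2].

(** Further cuts only shrink the triangle, so one whose vertices already pass is accepted at once.
    The disc [f] itself occurs in [fs]: its bisector is zero and cuts nothing. *)
Fixpoint cell_ok ts f (fs : seq quad) (T : tri) : bool :=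
  tri_ok ts f T ||
  if fs is g :: fs' then all (cell_ok ts f fs') (clip (bisector f g) T) else false.

Definition cover_ok ts (fs : seq quad) (Ts : seq tri) : bool :=
  all (fun f => (0 < f.1) && all (cell_ok ts f fs) Ts) fs.

(* The form fherm / fden, with a vector fmin attaining the projective minimum 1. *)
Record form := Form { fden : Z; fherm : herm Z; fmin : zpt * zpt }.
(* The cusp (a, b + w) for a = ca, b = cb. Its stabilizer contains the
   translations of C by ct1 / a and ct2 / a; the discs centred at w1 / y, for w in
   cdiscs, cover the parallelogram they span up to the points of ctight. Such a
   point comes with the index k of a listed form and a matrix g carrying this form
   to the one whose foot is the point. *)
Record cusp := Cusp { ca : Z; cb : Z; ct1 : zpt; ct2 : zpt;
   cdiscs : seq (zpt * zpt); ctight : seq (pt * (nat * mat2 Z)) }.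

Definition form0 := Form 1 (1, (0, 0), 1) ((1, 0), (0, 0)).

(** [B] is the sesquilinear value of [H] on the cusp and [(0, 1)], so the foot of [H / fden F] is
    [- B / am]; the last two conditions compare it with the given point without division. *)
Definition tight_ok (fs : seq form) (c : cusp) (p : pt * (nat * mat2 Z)) : bool :=
  let F := nth form0 fs p.2.1 in
  let H := hpull t n (fherm F) p.2.2 in
  let be := (cb c, 1) in
  let B := qadd (qscale (ca c) H.1.2) (qscale H.2 (qconj t be)) in
  let am := ca c * fden F in
  [&& (p.2.1 < size fs)%N, mdet t n p.2.2 == (1, 0),
     hev t n H ((ca c, 0), be) == am, 0 < p.1.2,
     p.1.1.1 * am == - (p.1.2 * B.1) & p.1.1.2 * am == - (p.1.2 * B.2)].

(** The unipotent matrix that fixes the cusp and moves feet by [- A / a] has entries $A$, $1 \pm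
    A\beta/a$ and $-A\beta^2/a^2$; the congruences make it integral. *)
Definition trans_ok (a : Z) (be A : zpt) : bool :=
  let B := mul A be in let C := mul B be in
  [&& Z.modulo B.1 a == 0, Z.modulo B.2 a == 0, Z.modulo C.1 (a * a) == 0 & Z.modulo C.2 (a * a) == 0].

Definition domain (c : cusp) : seq tri :=
  let: p := (ct1 c, ca c) in let: q := (ct2 c, ca c) in
  let r := (qadd (ct1 c) (ct2 c), ca c) in
  let o := ((0, 0), 1) in [:: (o, p, r); (o, r, q)].

(** The gcd condition is primitivity of the binary quadratic form with coefficients $a$, $2b+t$,
    $|b+w|^2/a$, which makes the ideal of the cusp invertible. With [ct1] real, the coordinates of a
    foot with respect to [ct1], [ct2] solve a triangular system. *)
Definition cusp_ok (fs : seq form) (c : cusp) : bool :=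
  [&& 0 < ca c, Z.modulo (nm (cb c, 1)) (ca c) == 0,
   Z.gcd (Z.gcd (ca c) (2%:R * cb c + t)) (Z.div (nm (cb c, 1)) (ca c)) == 1,
   trans_ok (ca c) (cb c, 1) (ct1 c), trans_ok (ca c) (cb c, 1) (ct2 c),
   0 < (ct1 c).1, (ct1 c).2 == 0, 0 < (ct2 c).2, all (tight_ok fs c) (ctight c),
   cdiscs c != [::] &
   cover_ok [seq p.1 | p <- ctight c] [seq dist_quad (ca c) (cb c) w | w <- cdiscs c]
     (domain c)].

Definition zrange (lo hi : Z) : seq Z :=
  [seq lo + Z.of_nat i | i <- iota 0 (Z.to_nat (hi - lo + 1))].

(** The absolute value of the discriminant of the order generated by [w]. *)
Definition disc4 := 4%:R * n - t * t.

Definition in_ideal (a b : Z) (x : zpt) : bool := Z.modulo (x.1 - b * x.2) a == 0.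

(* The pairs (x, y) that could violate the bound are enumerated using
   p F(x, y) = |p x + s y|^2 + det(F) |y|^2, where p and s are the first row of F. *)
Definition lower_ok (F : form) (a b : Z) : bool :=
  let: (p, s, r) := fherm F in
  let Dt := hdt t n (fherm F) in
  let M := p * (fden F * a) in
  let V := Z.sqrt (Z.div (4%:R * M) (Dt * disc4)) in
  let U := Z.sqrt (Z.div (4%:R * M) Dt) in
  let B2 := Z.sqrt (Z.div (4%:R * M) disc4) in
  let B1 := Z.sqrt (4%:R * M) in
  all (fun y2 => all (fun y1 => let y := (y1, y2) in
    (M <= Dt * nm y) || ~~ in_ideal a b y ||
    let e := mul s y in
    all (fun x2 => all (fun x1 => let x := (x1, x2) in
       [|| (x == (0, 0)) && (y == (0, 0)), ~~ in_ideal a b x | fden F * a <= hev t n (fherm F) (x, y)])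
      (let k := 2%:R * e.1 + t * (p * x2 + e.2) in
       zrange (Z.div (- B1 - k) (2%:R * p)) (Z.div (B1 - k) (2%:R * p))))
     (zrange (Z.div (- B2 - e.2) p) (Z.div (B2 - e.2) p)))
   (zrange (- (U + V)) (U + V)))
   (zrange (- V) V).

Definition form_ok (cs : seq cusp) (F : form) : bool :=
  let: (p, s, r) := fherm F in
  [&& 0 < fden F, 0 < p, dd * hdt t n (fherm F) == dn * (fden F * fden F),
     fmin F != ((0, 0), (0, 0)), hev t n (fherm F) (fmin F) == fden F * cnorm (fmin F) &
     all (fun c => lower_ok F (ca c) (cb c)) cs].

Definition has_cusp (cs : seq cusp) a b := has (fun c => (ca c == a) && (cb c == b)) cs.

(* Reduced means - a < 2 b + t <= a <= c where c = |b + w|^2 / a; when c = a,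
   listing the flipped pair (a, - b - t) instead is enough. *)
Definition classes_ok (cs : seq cusp) : bool :=
  all (fun a => all (fun b =>
     let N := nm (b, 1) in let c := Z.div N a in let k := 2%:R * b + t in
     [|| ~~ (- a < k), ~~ (k <= a), Z.modulo N a != 0, c < a, has_cusp cs a b
      | (c == a) && has_cusp cs a (- b - t)])
    (zrange (- (a + 1)) (a + 1))) (zrange 1 (Z.sqrt (Z.div disc4 3%:R))).

Definition field_ok (fs : seq form) (cs : seq cusp) : bool :=
  [&& 0 <= t, t <= 1, 0 < disc4, 0 < dn, 0 < dd, classes_ok cs, all (form_ok cs) fs & all (cusp_ok fs) cs].
End Checker.

(** * From binary integers to the reals *)

Definition zr (R : pzRingType) : Z -> R := intr \o int_of_Z.
Arguments zr R a : simpl never.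
HB.instance Definition _ (R : pzRingType) :=
  GRing.RMorphism.copy (@zr R) (intr \o int_of_Z).

Section IntegerEmbedding.
Variable R : realDomainType.

Lemma int_of_Z_ge0 (a : Z) : (0 <= int_of_Z a) = (0 <= a).
Proof. by case: a. Qed.

Lemma ler_zr (a b : Z) : (zr R a <= zr R b) = (a <= b).
Proof. by rewrite /zr /= ler_int -subr_ge0 -rmorphB int_of_Z_ge0 subr_ge0. Qed.

Lemma ltr_zr (a b : Z) : (zr R a < zr R b) = (a < b).
Proof. by rewrite !ltNge ler_zr. Qed.

Lemma zr_inj : injective (zr R).
Proof. by move=> a b /eqP; rewrite eq_le !ler_zr -eq_le => /eqP. Qed.

Lemma zr_gt0 (a : Z) : (0 < zr R a) = (0 < a).
Proof. by rewrite -(ltr_zr 0 a) rmorph0. Qed.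

Lemma zr_ge0 (a : Z) : (0 <= zr R a) = (0 <= a).
Proof. by rewrite -(ler_zr 0 a) rmorph0. Qed.

Lemma zr_le0 (a : Z) : (zr R a <= 0) = (a <= 0).
Proof. by rewrite -(ler_zr a 0) rmorph0. Qed.

Lemma zr_eq0 (a : Z) : (zr R a == 0) = (a == 0).
Proof. by rewrite !eq_le zr_ge0 zr_le0. Qed.
End IntegerEmbedding.

Section NormForm.
Variables (R : realFieldType) (t n : Z).
Hypothesis disc_gt0 : 0 < disc4 t n.
Local Notation z := (zr R).
Local Notation nmR := (qnorm (z t) (z n)).
Implicit Type x : R * R.

Lemma qnorm_ge0 x : 0 <= nmR x.
Proof.
have := disc_gt0; rewrite -(zr_gt0 R) /disc4 !(rmorphB, rmorphM, rmorph_nat) => dR.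
have : 0 <= 4%:R * nmR x; last by rewrite pmulr_rge0.
have -> : 4%:R * nmR x
  = (2%:R * x.1 + z t * x.2) ^+ 2 + (4%:R * z n - z t * z t) * x.2 ^+ 2.
  by rewrite /qnorm; ring.
by apply: addr_ge0; [|apply: mulr_ge0]; rewrite ?sqr_ge0 // ltW.
Qed.

Lemma qnorm_eq0 x : nmR x = 0 -> x = (0, 0).
Proof.
have := disc_gt0; rewrite -(zr_gt0 R) /disc4 !(rmorphB, rmorphM, rmorph_nat) => dR x0.
have : (2%:R * x.1 + z t * x.2) ^+ 2 + (4%:R * z n - z t * z t) * x.2 ^+ 2 = 0.
  by have := congr1 ( *%R 4%:R) x0; rewrite mulr0 /qnorm => <-; ring.
have a0 := mulr_ge0 (ltW dR) (sqr_ge0 x.2).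
move/eqP; rewrite (paddr_eq0 (sqr_ge0 _) a0) [X in _ && X]mulf_eq0 (gt_eqF dR) /=.
rewrite !sqrf_eq0 => /andP[+ /eqP x2]; rewrite x2 mulr0 addr0 mulf_eq0 pnatr_eq0 /=.
by move/eqP=> x1; case: x {x0 a0} x1 x2 => ? ? /= -> ->.
Qed.

End NormForm.

(** * Covering by discs *)

Section Clipping.
Variable R : realFieldType.
Local Notation z := (zr R).
Implicit Types (p q : pt) (T : tri) (x : R * R).

Definition linR (l : pt) x : R := z l.1.1 * x.1 + z l.1.2 * x.2 + z l.2.
Definition is_pt p x := z p.2 * x.1 = z p.1.1 /\ z p.2 * x.2 = z p.1.2.

(** The weights multiply homogeneous vertices, so the last equation replaces the usual condition
    that they sum to 1: the barycentric coordinates are the weights times the third coordinates. *)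
Definition in_tri T x := exists c : R * R * R,
  [/\ 0 <= c.1.1, 0 <= c.1.2, 0 <= c.2 &
   [/\ x.1 = c.1.1 * z T.1.1.1.1 + c.1.2 * z T.1.2.1.1 + c.2 * z T.2.1.1,
       x.2 = c.1.1 * z T.1.1.1.2 + c.1.2 * z T.1.2.1.2 + c.2 * z T.2.1.2 &
       1 = c.1.1 * z T.1.1.2 + c.1.2 * z T.1.2.2 + c.2 * z T.2.2]].

Definition pos_tri T := [/\ 0 < T.1.1.2, 0 < T.1.2.2 & 0 < T.2.2].

Lemma in_tri_rot p q r x : in_tri (p, q, r) x -> in_tri (q, r, p) x.
Proof.
move=> [[[a b] c] /= [a0 b0 c0 [e1 e2 e3]]]; exists ((b, c), a); split=> //=.
by split; [rewrite e1|rewrite e2|rewrite [LHS]e3]; ring.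
Qed.

Lemma linR_tri l p q r (c : R * R * R) x :
  x.1 = c.1.1 * z p.1.1 + c.1.2 * z q.1.1 + c.2 * z r.1.1 ->
  x.2 = c.1.1 * z p.1.2 + c.1.2 * z q.1.2 + c.2 * z r.1.2 ->
  1 = c.1.1 * z p.2 + c.1.2 * z q.2 + c.2 * z r.2 ->
  linR l x = c.1.1 * z (lin l p) + c.1.2 * z (lin l q) + c.2 * z (lin l r).
Proof.
move=> e1 e2 /(congr1 ( *%R (z l.2))); rewrite mulr1 /linR e1 e2 => ->; rewrite /lin !(rmorphD, rmorphM) /=.
ring.
Qed.

Lemma reduceP p : 0 < p.2 -> exists2 k : Z, 0 < k &
  [/\ p.1.1 = k * (reduce p).1.1, p.1.2 = k * (reduce p).1.2 & p.2 = k * (reduce p).2].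
Proof.
move=> p2; rewrite /reduce; set g := Z.gcd _ _.
have g2 : Z.divide g p.2 by exact: Z.gcd_divide_r.
have g1 : Z.divide g (Z.gcd p.1.1 p.1.2) by exact: Z.gcd_divide_l.
have g11 : Z.divide g p.1.1 by apply: Z.divide_trans g1 _; exact: Z.gcd_divide_l.
have g12 : Z.divide g p.1.2 by apply: Z.divide_trans g1 _; exact: Z.gcd_divide_r.
have g0 : 0 < g.
  have := Z.gcd_nonneg (Z.gcd p.1.1 p.1.2) p.2; rewrite -/g => ?.
  have : g <> 0 by move=> g0; move: g2; rewrite g0 => -[k]; lia.
  by lia.
exists g; first by lia.
by case: g11 g12 g2 => [a1 ->] [a2 ->] [a3 ->]; rewrite /= !Z.div_mul; try lia; split; rewrite mulrC.
Qed.

Lemma cutP l p q : 0 < p.2 -> 0 < q.2 -> 0 < lin l p -> lin l q <= 0 ->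
  exists2 k : R, 0 < k & [/\ 0 < (cut l p q).2,
   k * z (cut l p q).1.1 = z (lin l p) * z q.1.1 - z (lin l q) * z p.1.1,
   k * z (cut l p q).1.2 = z (lin l p) * z q.1.2 - z (lin l q) * z p.1.2 &
   k * z (cut l p q).2 = z (lin l p) * z q.2 - z (lin l q) * z p.2].
Proof.
move=> p0 q0 lp lq; rewrite /cut; set v := (_, _, _).
have v0 : 0 < v.2 by rewrite /v /=; nia.
have [k k0 [e1 e2 e3]] := reduceP v0.
exists (z k); first by rewrite zr_gt0.
rewrite -!rmorphM -e1 -e2 -e3 -!rmorphB; split=> //.
by move: v0; rewrite e3 pmulr_rgt0.
Qed.

Definition sound_clip l T (s : seq tri) := pos_tri T -> forall x, in_tri T x ->
  linR l x <= 0 -> exists2 T', T' \in s & pos_tri T' /\ in_tri T' x.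

(** The weight on [p] must be absorbed into the cut points: [B] mixes [p] with [r], and [A] mixes
    [p] with [q]. It is charged to [r] first, and to [q] only when [r] is exhausted; this decides
    which of the two triangles contains [x]. *)
Lemma clip1_sound l p q r : 0 < lin l p -> lin l q <= 0 -> lin l r <= 0 ->
  sound_clip l (p, q, r) (clip1 l p q r).
Proof.
move=> lp lq lr [/= p0 q0 r0] x [[[a b] c] /= [a0 b0 c0 [e1 e2 e3]]].
rewrite (@linR_tri l p q r (a, b, c)) //= => le0.
have [k k0 [cq0 q1 q2 q3]] := cutP p0 q0 lp lq.
have [k' k0' [cr0 r1 r2 r3]] := cutP p0 r0 lp lr.
have lpR : 0 < z (lin l p) by rewrite zr_gt0.
have lqR : z (lin l q) <= 0 by rewrite zr_le0.
have lrR : z (lin l r) <= 0 by rewrite zr_le0.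
move: q1 q2 q3 r1 r2 r3 le0 lpR lqR lrR.
set A := cut l p q in cq0 *; set B := cut l p r in cr0 *.
set P := z (lin l p); set Q := z (lin l q); set S := z (lin l r).
move=> q1 q2 q3 r1 r2 r3 le0 P0 Q0 S0.
have Bx u : u * (k' / P) * z B.1.1 = u * (z r.1.1 - S / P * z p.1.1).
  by rewrite -!mulrA [_^-1 * _]mulrC [k' * _]mulrA r1; field; rewrite gt_eqF.
have By u : u * (k' / P) * z B.1.2 = u * (z r.1.2 - S / P * z p.1.2).
  by rewrite -!mulrA [_^-1 * _]mulrC [k' * _]mulrA r2; field; rewrite gt_eqF.
have Bw u : u * (k' / P) * z B.2 = u * (z r.2 - S / P * z p.2).
  by rewrite -!mulrA [_^-1 * _]mulrC [k' * _]mulrA r3; field; rewrite gt_eqF.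
have Ax u : u * (k / P) * z A.1.1 = u * (z q.1.1 - Q / P * z p.1.1).
  by rewrite -!mulrA [_^-1 * _]mulrC [k * _]mulrA q1; field; rewrite gt_eqF.
have Ay u : u * (k / P) * z A.1.2 = u * (z q.1.2 - Q / P * z p.1.2).
  by rewrite -!mulrA [_^-1 * _]mulrC [k * _]mulrA q2; field; rewrite gt_eqF.
have Aw u : u * (k / P) * z A.2 = u * (z q.2 - Q / P * z p.2).
  by rewrite -!mulrA [_^-1 * _]mulrC [k * _]mulrA q3; field; rewrite gt_eqF.
have kP0 : 0 <= k / P by rewrite divr_ge0 ?ltW.
have kP0' : 0 <= k' / P by rewrite divr_ge0 ?ltW.
have [ac|ac] := lerP (a * P) (- S * c).
  exists (q, r, B); first by rewrite !inE eqxx.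
  split; first by split.
  have [S00|S00] := eqVneq S 0.
    have a00 : a = 0.
      apply/eqP; rewrite eq_le a0 andbT -(pmulr_lle0 _ P0).
      by move: ac; rewrite S00 oppr0 mul0r.
    exists ((b, c), 0); split=> //=; split; [rewrite e1|rewrite e2|rewrite [LHS]e3]; rewrite a00; ring.
  have S1 : S < 0 by rewrite lt_neqAle S00.
  (* Weight [u] moved from [r] to the cut point carries [- u S / P] of [p], which is exactly [a]. *)
  pose u := - a * P / S.
  have u0 : 0 <= u by apply: mulr_le0; rewrite ?invr_le0 ?(ltW S1) // mulNr oppr_le0 mulr_ge0 // ltW.
  exists ((b, c - u), u * (k' / P)); split=> //=.
  - by rewrite subr_ge0 /u ler_ndivrMr //; lra.
  - exact: mulr_ge0.
  - by split; [rewrite Bx e1|rewrite By e2|rewrite Bw [LHS]e3]; rewrite /u; field; rewrite S00 gt_eqF.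
exists (q, B, A); first by rewrite !inE eqxx orbT.
split; first by split.
have a1 : 0 < a * P + S * c by rewrite -ltrBlDr sub0r -mulNr.
have [Q00|Q00] := eqVneq Q 0.
  move: le0 a1; rewrite Q00; lra.
have Q1 : Q < 0 by rewrite lt_neqAle Q00.
(* All of [r] goes into [B]; [u] is the weight of [q] that absorbs what is left of [p]. *)
pose u := - (a * P + S * c) / Q.
have u0 : 0 <= u by apply: mulr_le0; rewrite ?invr_le0 ?(ltW Q1) // oppr_le0 ltW.
exists ((b - u, c * (k' / P)), u * (k / P)); split=> //=.
- by rewrite subr_ge0 /u ler_ndivrMr //; lra.
- exact: mulr_ge0.
- exact: mulr_ge0.
- by split; [rewrite Bx Ax e1|rewrite By Ay e2|rewrite Bw Aw [LHS]e3]; rewrite /u; field; rewrite Q00 gt_eqF.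
Qed.
End Clipping.

Section CoveringCheck.
Variables (R : realFieldType) (t n : Z).
Hypothesis disc_gt0 : 0 < disc4 t n.
Local Notation z := (zr R).
Local Notation nmR := (qnorm (z t) (z n)).
Implicit Types (p q : pt) (f g : quad) (T : tri) (x : R * R).

Definition qevR f x : R := z f.1 * nmR x + linR f.2 x.

(** Each of [q] and [r] is replaced by its cut point at the expense of [p]. The weight left on [p],
    multiplied by the negative number [lin l p], is [linR l x], so it is nonnegative. *)
Lemma clip2_sound l p q r : lin l p <= 0 -> 0 < lin l q -> 0 < lin l r ->
  @sound_clip R l (p, q, r) (clip2 l p q r).
Proof.
move=> lp lq lr [/= p0 q0 r0] x [[[a b] c] /= [a0 b0 c0 [e1 e2 e3]]].
rewrite (@linR_tri R l p q r (a, b, c)) //= => le0.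
have [k k0 [cq0 q1 q2 q3]] := cutP R q0 p0 lq lp.
have [k' k0' [cr0 r1 r2 r3]] := cutP R r0 p0 lr lp.
have lpR : z (lin l p) <= 0 by rewrite zr_le0.
have lqR : 0 < z (lin l q) by rewrite zr_gt0.
have lrR : 0 < z (lin l r) by rewrite zr_gt0.
move: q1 q2 q3 r1 r2 r3 le0 lpR lqR lrR.
rewrite /clip2; set A := cut l q p in cq0 *; set B := cut l r p in cr0 *.
set P := z (lin l p); set Q := z (lin l q); set S := z (lin l r).
move=> q1 q2 q3 r1 r2 r3 le0 P0 Q0 S0.
exists (p, A, B); first by rewrite inE.
split; first by split.
have bQ : 0 <= b * Q by rewrite mulr_ge0 // ltW.
have cS : 0 <= c * S by rewrite mulr_ge0 // ltW.
have [P00|P00] := eqVneq P 0.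
  have b00 : b = 0.
    apply/eqP; rewrite eq_le b0 andbT -(pmulr_lle0 _ Q0).
    by move: le0 cS; rewrite P00; lra.
  have c00 : c = 0.
    apply/eqP; rewrite eq_le c0 andbT -(pmulr_lle0 _ S0).
    by move: le0 bQ; rewrite P00; lra.
  exists ((a, 0), 0); split=> //=; split; [rewrite e1|rewrite e2|rewrite [LHS]e3]; rewrite b00 c00; ring.
have P1 : P < 0 by rewrite lt_neqAle P00.
have NP0 : 0 < - P by rewrite oppr_gt0.
have Ax u : u * (k / - P) * z A.1.1 = u * (z q.1.1 - Q / P * z p.1.1).
  by rewrite -!mulrA [_^-1 * _]mulrC [k * _]mulrA q1; field; rewrite ?oppr_eq0 ?P00.
have Ay u : u * (k / - P) * z A.1.2 = u * (z q.1.2 - Q / P * z p.1.2).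
  by rewrite -!mulrA [_^-1 * _]mulrC [k * _]mulrA q2; field; rewrite ?oppr_eq0 ?P00.
have Aw u : u * (k / - P) * z A.2 = u * (z q.2 - Q / P * z p.2).
  by rewrite -!mulrA [_^-1 * _]mulrC [k * _]mulrA q3; field; rewrite ?oppr_eq0 ?P00.
have Bx u : u * (k' / - P) * z B.1.1 = u * (z r.1.1 - S / P * z p.1.1).
  by rewrite -!mulrA [_^-1 * _]mulrC [k' * _]mulrA r1; field; rewrite ?oppr_eq0 ?P00.
have By u : u * (k' / - P) * z B.1.2 = u * (z r.1.2 - S / P * z p.1.2).
  by rewrite -!mulrA [_^-1 * _]mulrC [k' * _]mulrA r2; field; rewrite ?oppr_eq0 ?P00.
have Bw u : u * (k' / - P) * z B.2 = u * (z r.2 - S / P * z p.2).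
  by rewrite -!mulrA [_^-1 * _]mulrC [k' * _]mulrA r3; field; rewrite ?oppr_eq0 ?P00.
exists ((a + b * (Q / P) + c * (S / P), b * (k / - P)), c * (k' / - P)); split=> /=.
- rewrite -(nmulr_lle0 _ P1).
  suff -> : (a + b * (Q / P) + c * (S / P)) * P = a * P + b * Q + c * S by [].
  by field.
- by rewrite mulr_ge0 // divr_ge0 // ltW.
- by rewrite mulr_ge0 // divr_ge0 // ltW.
- by split; [rewrite Ax Bx e1|rewrite Ay By e2|rewrite Aw Bw [LHS]e3]; ring.
Qed.

Lemma sound_clip_rot l p q r s :
  @sound_clip R l (q, r, p) s -> @sound_clip R l (p, q, r) s.
Proof.
move=> H [/= p0 q0 r0] x Tx; apply: H; first by split.
exact: in_tri_rot Tx.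
Qed.

Lemma clip_sound l T : @sound_clip R l T (clip l T).
Proof.
case: T => [[p q] r]; rewrite /clip.
case: ltP => lp; case: ltP => lq; case: ltP => lr.
- move=> _ x [[[a b] c] /= [a0 b0 c0 [e1 e2 e3]]].
  rewrite (@linR_tri R l p q r (a, b, c)) //= => le0.
  have P0 : 0 < z (lin l p) by rewrite zr_gt0.
  have Q0 : 0 < z (lin l q) by rewrite zr_gt0.
  have S0 : 0 < z (lin l r) by rewrite zr_gt0.
  have aP : 0 <= a * z (lin l p) by rewrite mulr_ge0 // ltW.
  have bQ : 0 <= b * z (lin l q) by rewrite mulr_ge0 // ltW.
  have cS : 0 <= c * z (lin l r) by rewrite mulr_ge0 // ltW.
  have a00 : a = 0.
    by apply/eqP; rewrite eq_le a0 andbT -(pmulr_lle0 _ P0); lra.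
  have b00 : b = 0.
    by apply/eqP; rewrite eq_le b0 andbT -(pmulr_lle0 _ Q0); lra.
  have c00 : c = 0.
    by apply/eqP; rewrite eq_le c0 andbT -(pmulr_lle0 _ S0); lra.
  by move/eqP: e3; rewrite a00 b00 c00 !mul0r !addr0 oner_eq0.
- by do 2!apply: sound_clip_rot; exact: clip2_sound.
- by apply: sound_clip_rot; exact: clip2_sound.
- exact: clip1_sound.
- exact: clip2_sound.
- by apply: sound_clip_rot; exact: clip1_sound.
- by do 2!apply: sound_clip_rot; exact: clip1_sound.
- by move=> T0 x Tx _; exists (p, q, r); rewrite ?inE.
Qed.

(* Strict convexity of f: on a triangle whose vertices satisfy f <= 0, equality
   can only occur at a vertex. *)
Lemma qev_convex f (x p q r : R * R) (a b c : R) :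
  a + b + c = 1 -> x.1 = a * p.1 + b * q.1 + c * r.1 ->
  x.2 = a * p.2 + b * q.2 + c * r.2 ->
  qevR f x = a * qevR f p + b * qevR f q + c * qevR f r
    - z f.1 * (a * b * nmR (qsub p q) + b * c * nmR (qsub q r) + c * a * nmR (qsub r p)).
Proof.
move=> abc x1 x2; have -> : c = 1 - a - b by rewrite -abc; ring.
rewrite /qevR /linR /qnorm /qsub x1 x2 /=.
have -> : c = 1 - a - b by rewrite -abc; ring.
ring.
Qed.

Definition to_R (p : pt) : R * R := (z p.1.1 / z p.2, z p.1.2 / z p.2).

Lemma qev_to_R f p : 0 < p.2 -> z (qev t n f p) = (z p.2) ^+ 2 * qevR f (to_R p).
Proof.
rewrite -(zr_gt0 R) => p0.
rewrite /qev /qevR /linR /lin /qnorm /to_R !(rmorphD, rmorphM) /=; field.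
by rewrite gt_eqF.
Qed.

Lemma vertex_okP ts f p : 0 < p.2 -> vertex_ok t n ts f p ->
  (forall v, v \in ts -> 0 < v.2) ->
  qevR f (to_R p) <= 0 /\
  (qevR f (to_R p) = 0 -> exists2 v, v \in ts & is_pt v (to_R p)).
Proof.
move=> p0 + ts0; have p0R : 0 < z p.2 by rewrite zr_gt0.
have p2 : 0 < z p.2 ^+ 2 by rewrite exprn_gt0.
case/orP => [f0|/andP[/eqP f0 /hasP[v vts /andP[/eqP h1 /eqP h2]]]].
  have : z (qev t n f p) < 0 by rewrite -(rmorph0 z) ltr_zr.
  rewrite qev_to_R // pmulr_rlt0 // => f1; split; first exact: ltW.
  by move=> f2; rewrite f2 ltxx in f1.
have : z (qev t n f p) = 0 by rewrite f0 rmorph0.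
rewrite qev_to_R // => /eqP; rewrite mulf_eq0 gt_eqF //= => /eqP ->.
split=> // _; exists v => //.
have v0R : 0 < z v.2 by rewrite zr_gt0 ts0.
split; rewrite /to_R /=.
  by rewrite mulrA -rmorphM [v.2 * _]mulrC h1 rmorphM mulfK // gt_eqF.
by rewrite mulrA -rmorphM [v.2 * _]mulrC h2 rmorphM mulfK // gt_eqF.
Qed.

Definition covers (ts : seq pt) f x :=
  qevR f x <= 0 /\ (qevR f x = 0 -> exists2 v, v \in ts & is_pt v x).

Lemma tri_ok_sound ts f T x : (forall v, v \in ts -> 0 < v.2) -> 0 < f.1 ->
  pos_tri T -> in_tri T x -> tri_ok t n ts f T -> covers ts f x.
Proof.
case: T => [[p q] r] ts0 f0 [/= p0 q0 r0] [[[a b] c] /= [a0 b0 c0 [e1 e2 e3]]].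
case/and3P => /= /vertex_okP-/(_ p0 ts0)[fp tp] /vertex_okP-/(_ q0 ts0)[fq tq]
  /vertex_okP-/(_ r0 ts0)[fr tr].
have p0R : 0 < z p.2 by rewrite zr_gt0.
have q0R : 0 < z q.2 by rewrite zr_gt0.
have r0R : 0 < z r.2 by rewrite zr_gt0.
have f0R : 0 < z f.1 by rewrite zr_gt0.
pose a' := a * z p.2; pose b' := b * z q.2; pose c' := c * z r.2.
have a1 : 0 <= a' by rewrite mulr_ge0 // ltW.
have b1 : 0 <= b' by rewrite mulr_ge0 // ltW.
have c1 : 0 <= c' by rewrite mulr_ge0 // ltW.
have x1 : x.1 = a' * (to_R p).1 + b' * (to_R q).1 + c' * (to_R r).1.
  by rewrite e1 /a' /b' /c' /to_R /=; field; rewrite !gt_eqF.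
have x2 : x.2 = a' * (to_R p).2 + b' * (to_R q).2 + c' * (to_R r).2.
  by rewrite e2 /a' /b' /c' /to_R /=; field; rewrite !gt_eqF.
have abc : a' + b' + c' = 1 by rewrite [RHS]e3.
have := qev_convex f abc x1 x2.
set nab := nmR _; set nbc := nmR _; set nca := nmR _.
have nab0 : 0 <= nab by exact: qnorm_ge0.
have nbc0 : 0 <= nbc by exact: qnorm_ge0.
have nca0 : 0 <= nca by exact: qnorm_ge0.
have n1 : 0 <= a' * b' * nab by rewrite mulr_ge0 // mulr_ge0.
have n2 : 0 <= b' * c' * nbc by rewrite mulr_ge0 // mulr_ge0.
have n3 : 0 <= c' * a' * nca by rewrite mulr_ge0 // mulr_ge0.
have g1 : a' * qevR f (to_R p) <= 0 by apply: mulr_ge0_le0.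
have g2 : b' * qevR f (to_R q) <= 0 by apply: mulr_ge0_le0.
have g3 : c' * qevR f (to_R r) <= 0 by apply: mulr_ge0_le0.
have g4 : 0 <= z f.1 * (a' * b' * nab + b' * c' * nbc + c' * a' * nca).
  by rewrite mulr_ge0 ?(ltW f0R) // !addr_ge0.
move=> fx; split=> [|x0]; first by lra.
have f4 : z f.1 * (a' * b' * nab + b' * c' * nbc + c' * a' * nca) = 0 by lra.
have f5 : a' * b' * nab + b' * c' * nbc + c' * a' * nca = 0.
  by move/eqP: f4; rewrite mulf_eq0 gt_eqF //= => /eqP.
have n4 : a' * b' * nab = 0 by lra.
have n5 : b' * c' * nbc = 0 by lra.
have n6 : c' * a' * nca = 0 by lra.
have sub0 (u v : R * R) : nmR (qsub u v) = 0 -> u = v.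
  move/(qnorm_eq0 disc_gt0); rewrite /qsub => -[/eqP + /eqP].
  by rewrite !subr_eq0; case: u v => ? ? [? ?] /= /eqP -> /eqP ->.
have eq0 (u v w : R) : 0 < u -> u * v * w = 0 -> v = 0 \/ w = 0.
  move=> u0 /eqP; rewrite !mulf_eq0 (gt_eqF u0) /= => /orP[]/eqP; by [left|right].
have xE (v : R * R) : x.1 = v.1 -> x.2 = v.2 -> x = v.
  by case: x v {e1 e2 x1 x2 fx x0} => ? ? [? ?] /= -> ->.
(* If [p] carries weight, any other vertex carrying weight coincides with it, since the
   corresponding product with the squared distance vanishes; so [x] is [p]. *)
have [a2|a2] := eqVneq a' 0; last first.
  have a3 : 0 < a' by rewrite lt_def a2.
  suff -> : x = to_R p.
    apply: tp; apply: (mulfI a2); rewrite mulr0; lra.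
  have hb : b' * (to_R q).1 = b' * (to_R p).1 /\ b' * (to_R q).2 = b' * (to_R p).2.
    by case: (eq0 _ _ _ a3 n4) => [->|/sub0 ->]; rewrite ?mul0r.
  have hc : c' * (to_R r).1 = c' * (to_R p).1 /\ c' * (to_R r).2 = c' * (to_R p).2.
    move: n6; rewrite [c' * a']mulrC => /(eq0 _ _ _ a3)[->|/sub0 ->]; by rewrite ?mul0r.
  case: hb hc => hb1 hb2 [hc1 hc2].
  apply: xE; rewrite ?x1 ?x2 ?hb1 ?hb2 ?hc1 ?hc2 -!mulrDl abc mul1r //.
have [b2|b2] := eqVneq b' 0; last first.
  have b3 : 0 < b' by rewrite lt_def b2.
  suff -> : x = to_R q.
    apply: tq; apply: (mulfI b2); rewrite mulr0; lra.
  have hc : c' * (to_R r).1 = c' * (to_R q).1 /\ c' * (to_R r).2 = c' * (to_R q).2.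
    by case: (eq0 _ _ _ b3 n5) => [->|/sub0 ->]; rewrite ?mul0r.
  case: hc => hc1 hc2; move: abc; rewrite a2 add0r => abc.
  by apply: xE; rewrite ?x1 ?x2 ?hc1 ?hc2 a2 mul0r add0r -!mulrDl abc mul1r.
have c3 : c' = 1 by move: abc; rewrite a2 b2 !add0r.
have -> : x = to_R r by apply: xE; rewrite ?x1 ?x2 a2 b2 c3 !mul0r !add0r mul1r.
by apply: tr; move: fx; rewrite f5 mulr0 a2 b2 c3 !mul0r !add0r mul1r subr0; lra.
Qed.

Lemma bisectorE f g x :
  linR (bisector f g) x = z g.1 * qevR f x - z f.1 * qevR g x.
Proof.
rewrite /linR /bisector /= !(rmorphB, rmorphM) /= /qevR /linR; ring.
Qed.

Lemma cell_ok_sound ts f fs x T : (forall v, v \in ts -> 0 < v.2) -> 0 < f.1 ->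
  (forall g, g \in fs -> linR (bisector f g) x <= 0) ->
  pos_tri T -> in_tri T x -> cell_ok t n ts f fs T -> covers ts f x.
Proof.
move=> ts0 f0; elim: fs T => [|g fs IH] T fsx T0 Tx /=.
  by rewrite orbF; exact: tri_ok_sound.
case/orP => [|/allP ok]; first exact: tri_ok_sound.
have /(clip_sound T0 Tx)[T' T'in [T'0 T'x]] := fsx g (mem_head _ _).
apply: (IH T') => // [h hfs|]; last exact: ok.
by apply: fsx; rewrite inE hfs orbT.
Qed.

(* The cell of the disc minimizing the power of x lies on the right side of all
   bisectors. *)
Lemma cover_sound ts fs Ts T x : (forall v, v \in ts -> 0 < v.2) -> fs != [::] ->
  (forall T, T \in Ts -> pos_tri T) -> cover_ok t n ts fs Ts ->
  T \in Ts -> in_tri T x -> exists2 f, f \in fs & 0 < f.1 /\ covers ts f x.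
Proof.
move=> ts0 fs0 Ts0 /allP ok TTs Tx.
have fpos f : f \in fs -> 0 < z f.1 by move=> /ok/andP[f0 _]; rewrite zr_gt0.
have [f ffs fmin] : exists2 f, f \in fs &
    forall g, g \in fs -> qevR f x / z f.1 <= qevR g x / z g.1.
  elim: fs fs0 {ok fpos} => // g fs IH _.
  have [->|/IH[f ffs fmin]] := eqVneq fs [::].
    by exists g; rewrite ?mem_head // => h; rewrite inE => /eqP ->.
  have [le|/ltW le] := lerP (qevR g x / z g.1) (qevR f x / z f.1).
    exists g; rewrite ?mem_head // => h; rewrite inE => /predU1P[-> //|/fmin].
    exact: le_trans.
  exists f; rewrite ?inE ?ffs ?orbT // => h; rewrite inE => /predU1P[-> //|/fmin //].
have /andP[f0 /allP/(_ _ TTs) cell] := ok _ ffs.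
exists f => //; split=> //; apply: (cell_ok_sound ts0 f0 _ (Ts0 _ TTs) Tx cell) => g gfs.
rewrite bisectorE subr_le0 [leLHS]mulrC [leRHS]mulrC.
have f1 := fpos _ ffs; have g1 := fpos _ gfs.
by have := fmin _ gfs; rewrite ler_pdivrMr // mulrAC ler_pdivlMr.
Qed.
End CoveringCheck.

(** * Ideal classes and cusps *)

Lemma Zsubgroup_generator (S : Z -> Prop) :
  (forall x y : Z, S x -> S y -> S (x - y)) -> (forall k x : Z, S x -> S (k * x)) ->
  (exists2 x : Z, x != 0 & S x) ->
  exists g : Z, [/\ 0 < g, S g & forall x : Z, S x -> Z.divide g x].
Proof.
move=> SB SM [x x0 Sx].
have ex : exists k, `[< S (Z.of_nat k) /\ (0 < k)%N >].
  exists (Z.to_nat (x * x)); apply/asboolP; split; last by nia.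
  rewrite Z2Nat.id; last by nia.
  exact: SM.
case: (ex_minnP ex) => g /asboolP[Sg g0] gmin.
exists (Z.of_nat g); split=> //; first by lia.
move=> y Sy; apply/Z.mod_divide; first by lia.
have g1 : 0 < Z.of_nat g by lia.
have [r0 r1] := Z.mod_pos_bound y (Z.of_nat g) ltac:(lia).
have Sr : S (Z.modulo y (Z.of_nat g)).
  have -> : Z.modulo y (Z.of_nat g) = y - Z.div y (Z.of_nat g) * Z.of_nat g.
    by have := Z.div_mod y (Z.of_nat g) ltac:(lia); lia.
  by apply: SB => //; exact: SM.
case: (Z.eq_dec (Z.modulo y (Z.of_nat g)) Z0) => // r2.
have : `[< S (Z.of_nat (Z.to_nat (Z.modulo y (Z.of_nat g)))) /\
    (0 < Z.to_nat (Z.modulo y (Z.of_nat g)))%N >].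
  by apply/asboolP; rewrite Z2Nat.id //; split=> //; lia.
move/gmin; lia.
Qed.

Lemma ZdivideP (a b : Z) : Z.divide a b -> exists c : Z, b = c * a.
Proof. by []. Qed.

Section Ideals.
Variables t n : Z.
Hypothesis disc_gt0 : 0 < disc4 t n.
Local Notation mul := (qmul t n).
Local Notation nm := (qnorm t n).
Local Notation conj := (qconj t).
Implicit Types (x y z : zpt) (v w : zpt * zpt).

Definition in_ideal_gen v z := exists x y, z = qadd (mul x v.1) (mul y v.2).
Definition lattice (a b : Z) z := exists s u : Z, z = (a * s + b * u, u).
Definition qdvd (k : Z) x := Z.divide k x.1 /\ Z.divide k x.2.
Definition vscale x w : zpt * zpt := (mul x w.1, mul x w.2).

Lemma qnormZ_gt0 x : x != (0, 0) -> 0 < nm x.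
Proof.
move=> x0; have e : 4%:R * nm x = (2%:R * x.1 + t * x.2) ^+ 2 + disc4 t n * x.2 ^+ 2.
  by rewrite /qnorm /disc4; ring.
suff : 0 < 4%:R * nm x by rewrite pmulr_rgt0.
rewrite e; have [x2|x2] := eqVneq x.2 0.
  rewrite x2 mulr0 addr0 expr0n mulr0 addr0 exprn_even_gt0 //= mulf_eq0 /=.
  by apply: contraNneq x0 => x1; rewrite (surjective_pairing x) x1 x2.
by rewrite ltr_wpDl ?sqr_ge0 // pmulr_rgt0 // exprn_even_gt0.
Qed.

Lemma qmul_neq0 x y : x != (0, 0) -> y != (0, 0) -> mul x y != (0, 0).
Proof.
move=> /qnormZ_gt0 x0 /qnormZ_gt0 y0; apply/eqP => xy.
have : nm (mul x y) = nm x * nm y by rewrite qnormM.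
have := mulr_gt0 x0 y0 => h0 h1; move: h0; rewrite -h1 xy /qnorm /=.
by rewrite !mulr0 !addr0 ltxx.
Qed.

Lemma qdvdD k x y : qdvd k x -> qdvd k y -> qdvd k (qadd x y).
Proof. by move=> [? ?] [? ?]; split; apply: Z.divide_add_r. Qed.

Lemma qdvdMl k x y : qdvd k x -> qdvd k (mul y x).
Proof.
move=> [[p p1] [q q1]]; split; rewrite /qmul /= p1 q1.
  by exists (y.1 * p - n * (y.2 * q)); ring.
by exists (y.1 * q + y.2 * p + t * (y.2 * q)); ring.
Qed.

Lemma qdvd_conj k x : qdvd k x -> qdvd k (conj x).
Proof.
move=> [[p p1] [q q1]]; split; rewrite /qconj /= ?p1 ?q1.
  by exists (p + t * q); ring.
by exists (- q); ring.
Qed.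

Lemma qdvd_scale k m x : Z.divide k m -> qdvd k (qscale m x).
Proof. by move=> [p ->]; split; rewrite /qscale /=; [exists (p * x.1)|exists (p * x.2)]; ring. Qed.

Lemma cnorm_dvd w : [/\ Z.divide (cnorm t n w) (nm w.1),
  Z.divide (cnorm t n w) (nm w.2) & qdvd (cnorm t n w) (mul (conj w.1) w.2)].
Proof.
rewrite /cnorm; set P := mul _ _; set g1 := Z.gcd (nm _) _; set g2 := Z.gcd P.1 _.
have h1 : Z.divide (Z.gcd g1 g2) g1 by exact: Z.gcd_divide_l.
have h2 : Z.divide (Z.gcd g1 g2) g2 by exact: Z.gcd_divide_r.
split; first 1 last.
- by apply: Z.divide_trans h1 _; exact: Z.gcd_divide_r.
- by split; apply: Z.divide_trans h2 _; [exact: Z.gcd_divide_l|exact: Z.gcd_divide_r].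
- by apply: Z.divide_trans h1 _; exact: Z.gcd_divide_l.
Qed.

Lemma dvd_cnorm k w : Z.divide k (nm w.1) -> Z.divide k (nm w.2) ->
  qdvd k (mul (conj w.1) w.2) -> Z.divide k (cnorm t n w).
Proof. by move=> h1 h2 [h3 h4]; do !apply: Z.gcd_greatest. Qed.

Lemma cnorm_ge0 w : 0 <= cnorm t n w.
Proof.
have := Z.gcd_nonneg (Z.gcd (nm w.1) (nm w.2))
  (Z.gcd (mul (conj w.1) w.2).1 (mul (conj w.1) w.2).2).
by rewrite /cnorm; lia.
Qed.

Lemma cnorm_gt0 w : w != ((0, 0), (0, 0)) -> 0 < cnorm t n w.
Proof.
move=> w0; have [h1 h2 _] := cnorm_dvd w; have c0 := cnorm_ge0 w.
have : cnorm t n w <> 0.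
  move=> e; rewrite e in h1 h2; case: h1 h2 => [k k1] [l l1].
  have w1 : w.1 = (0, 0) by apply/eqP/negP => /negP/qnormZ_gt0; lia.
  have w2 : w.2 = (0, 0) by apply/eqP/negP => /negP/qnormZ_gt0; lia.
  by move: w0; rewrite (surjective_pairing w) w1 w2 eqxx.
lia.
Qed.

(** The product of the ideal with its conjugate is generated by $N(w_1)$, $N(w_2)$, $\bar w_1 w_2$
    and the conjugate of the latter, all divisible by [cnorm]. *)
Lemma ideal_gen_dvd w x y : in_ideal_gen w x -> in_ideal_gen w y ->
  qdvd (cnorm t n w) (mul (conj x) y).
Proof.
move=> [p [q ->]] [r [s ->]]; have [h1 h2 h3] := cnorm_dvd w.
have -> : mul (conj (qadd (mul p w.1) (mul q w.2))) (qadd (mul r w.1) (mul s w.2))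
  = qadd (qadd (qscale (nm w.1) (mul (conj p) r)) (qscale (nm w.2) (mul (conj q) s)))
         (qadd (mul (mul (conj p) s) (mul (conj w.1) w.2))
               (mul (mul (conj q) r) (conj (mul (conj w.1) w.2)))) by qring.
apply: qdvdD; apply: qdvdD; [exact: qdvd_scale|exact: qdvd_scale|exact: qdvdMl|].
by apply: qdvdMl; exact: qdvd_conj.
Qed.

Lemma ideal_gen_norm_dvd w x : in_ideal_gen w x -> Z.divide (cnorm t n w) (nm x).
Proof.
move=> wx; have [] := ideal_gen_dvd wx wx.
suff -> : nm x = (mul (conj x) x).1 by [].
by qexp; ring.
Qed.

Lemma in_ideal_gen_mapp g w x : in_ideal_gen (mapp t n g w) x -> in_ideal_gen w x.
Proof.
move=> [p [q ->]]; exists (qadd (mul p g.1.1) (mul q g.1.2)), (qadd (mul p g.2.1) (mul q g.2.2)).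
by qring.
Qed.

Lemma in_ideal_gen1 w : in_ideal_gen w w.1.
Proof. by exists (1, 0), (0, 0); qring. Qed.

Lemma in_ideal_gen2 w : in_ideal_gen w w.2.
Proof. by exists (0, 0), (1, 0); qring. Qed.

Lemma ideal_gen_cnorm_dvd w w' : in_ideal_gen w w'.1 -> in_ideal_gen w w'.2 ->
  Z.divide (cnorm t n w) (cnorm t n w').
Proof.
move=> h1 h2; apply: dvd_cnorm; [exact: ideal_gen_norm_dvd|exact: ideal_gen_norm_dvd|].
exact: ideal_gen_dvd.
Qed.

Lemma cnorm_mapp_dvd g w : Z.divide (cnorm t n w) (cnorm t n (mapp t n g w)).
Proof.
by apply: ideal_gen_cnorm_dvd; apply: (@in_ideal_gen_mapp g);
   [exact: in_ideal_gen1|exact: in_ideal_gen2].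
Qed.

Lemma mapp_adj g w : mdet t n g = (1, 0) -> mapp t n (madj g) (mapp t n g w) = w.
Proof.
move=> g1; have : mapp t n (madj g) (mapp t n g w) = vscale (mdet t n g) w.
  by case: w => w1 w2; rewrite /vscale; congr pair; qring.
by rewrite g1 => ->; case: w => w1 w2; rewrite /vscale /=; congr pair; qring.
Qed.

Lemma cnorm_mapp g w : mdet t n g = (1, 0) -> cnorm t n (mapp t n g w) = cnorm t n w.
Proof.
move=> g1; apply: Z.divide_antisym_nonneg; try by have := cnorm_ge0; move=> h; apply/Z.leb_le/h.
  by rewrite -{2}(mapp_adj w g1); exact: cnorm_mapp_dvd.
exact: cnorm_mapp_dvd.
Qed.

Lemma cnorm_scale x w : cnorm t n (vscale x w) = nm x * cnorm t n w.
Proof.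
have e : mul (conj (vscale x w).1) (vscale x w).2 = qscale (nm x) (mul (conj w.1) w.2).
  by rewrite /vscale; qring.
have e1 : nm (vscale x w).1 = nm x * nm w.1 by exact: qnormM.
have e2 : nm (vscale x w).2 = nm x * nm w.2 by exact: qnormM.
have x0 : Z.le 0 (nm x).
  have [->|/qnormZ_gt0] := eqVneq x (0, 0); last by lia.
  by rewrite /qnorm /= !mulr0 !addr0; lia.
rewrite /cnorm e e1 e2; cbv zeta; rewrite [(qscale _ _).1]/(_ * _) [(qscale _ _).2]/(_ * _).
by rewrite !(Z.gcd_mul_mono_l_nonneg _ _ (nm x)).
Qed.

(** Multiplying [b + w] by [w] stays in the lattice because [a] divides $|b+w|^2$. *)
Lemma lattice_mul a b x z : Z.divide a (nm (b, 1)) -> lattice a b z -> lattice a b (mul x z).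
Proof.
case/ZdivideP=> c; rewrite /qnorm /= => hc [s [u ->]].
exists (x.1 * s - c * x.2 * u - b * x.2 * s), (x.1 * u + x.2 * (a * s + (b + t) * u)).
apply: pair_eq; rewrite /qmul /=; last by ring.
have -> : n = c * a - b * b - t * b by rewrite -hc; ring.
ring.
Qed.

Lemma latticeD a b x y : lattice a b x -> lattice a b y -> lattice a b (qadd x y).
Proof.
by move=> [s [u ->]] [s' [u' ->]]; exists (s + s'), (u + u'); qring.
Qed.

Lemma lattice_conj_mul a b x y : Z.divide a (nm (b, 1)) -> lattice a b x -> lattice a b y ->
  exists z, mul (conj x) y = qscale a z.
Proof.
case/ZdivideP=> c; rewrite /qnorm /= => hc [s [u ->]] [s' [u' ->]].
exists (a * s * s' + b * s * u' + (b + t) * s' * u + c * u * u', s * u' - u * s').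
apply: pair_eq; rewrite /qmul /qconj /qscale /=; last by ring.
have -> : n = c * a - b * b - t * b by rewrite -hc; ring.
ring.
Qed.

(** Here [r] generates the second coordinates of the ideal, [p] its rational integers, and [q + r w]
    is an element. Multiplication by [w] shows that [r] divides [p = a r] and [q = b r]; multiplying
    [q + r w] by the conjugate of [b + w] gives the integer $r|b+w|^2$ of the ideal, so [a] divides
    $|b+w|^2$. *)
Lemma ideal_hermite_normal_form v : v != ((0, 0), (0, 0)) -> exists r a b : Z,
  [/\ 0 < r, 0 < a, Z.divide a (nm (b, 1)) &
   forall z, in_ideal_gen v z <-> exists2 z', lattice a b z' & z = qscale r z'].
Proof.
move=> v0; pose I := in_ideal_gen v.
have IB x y : I x -> I y -> I (qsub x y).
  move=> [p [q ->]] [p' [q' ->]]; exists (qsub p p'), (qsub q q'); by qring.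
have IM x y : I y -> I (mul x y).
  by move=> [p [q ->]]; exists (mul x p), (mul x q); qring.
have IZ k x : I x -> I (qscale k x).
  move=> Ix; have -> : qscale k x = mul (k, 0) x by qring.
  exact: IM.
have [z0 z00 Iz0] : exists2 z0 : zpt, z0 != (0, 0) & I z0.
  have [v1|v1] := eqVneq v.1 (0, 0); last by exists v.1 => //; exact: in_ideal_gen1.
  exists v.2; last exact: in_ideal_gen2.
  by apply: contraNneq v0 => v2; rewrite (surjective_pairing v) v1 v2.
have [r [r0 [q Iqr] rdvd]] : exists r : Z, [/\ 0 < r, exists q, I (q, r) &
    forall x : Z, (exists q, I (q, x)) -> Z.divide r x].
  apply: Zsubgroup_generator.
  - by move=> x y [p Ip] [q Iq]; exists (p - q); exact: (IB _ _ Ip Iq).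
  - by move=> k x [p Ip]; exists (k * p); exact: (IZ k _ Ip).
  have [z2|z2] := eqVneq z0.2 0; last by exists z0.2 => //; exists z0.1; rewrite -surjective_pairing.
  exists z0.1; last first.
    exists 0; have -> : (0, z0.1) = mul (0, 1) z0 by apply: pair_eq; rewrite /qmul /= z2; ring.
    exact: IM.
  by apply: contraNneq z00 => z1; rewrite (surjective_pairing z0) z1 z2.
have [p [p0 Ip pdvd]] : exists p : Z, [/\ 0 < p, I (p, 0) & forall x : Z, I (x, 0) -> Z.divide p x].
  apply: (@Zsubgroup_generator (fun x : Z => I (x, 0))).
  - by move=> x y Ix Iy; have := IB _ _ Ix Iy; rewrite /qsub /= subr0.
  - by move=> k x Ix; have := IZ k _ Ix; rewrite /qscale /= mulr0.
  exists (nm z0); first by rewrite gt_eqF // qnormZ_gt0.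
  have -> : (nm z0, 0) = mul (conj z0) z0 by qring.
  exact: IM.
have [a pa] : Z.divide r p.
  apply: rdvd; exists 0; have -> : (0, p) = mul (0, 1) (p, 0) by qring.
  exact: IM.
have [b qb] : Z.divide r q.
  have : Z.divide r (q + t * r).
    apply: rdvd; exists (- n * r); have -> : (- n * r, q + t * r) = mul (0, 1) (q, r) by qring.
    exact: IM.
  by move=> [k hk]; exists (k - t); lia.
exists r, a, b; split=> //; first by nia.
  have : Z.divide p (r * nm (b, 1)).
    apply: pdvd; have -> : (r * nm (b, 1), 0) = mul (conj (b, 1)) (q, r).
      by rewrite qb; qring.
    exact: IM.
  by rewrite pa => -[k hk]; exists k; nia.
move=> z; split=> [Iz|[_ [s [u ->]] ->]].
  have [u hu] : Z.divide r z.2 by apply: rdvd; exists z.1; rewrite -surjective_pairing.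
  have [s hs] : Z.divide p (z.1 - u * q).
    apply: pdvd; have -> : (z.1 - u * q, 0) = qsub z (qscale u (q, r)).
      by apply: pair_eq; rewrite /qsub /qscale /= ?hu; ring.
    by apply: IB => //; exact: IZ.
  exists (a * s + b * u, u); first by exists s, u.
  apply: pair_eq; rewrite /qscale /=; last by rewrite hu; ring.
  have -> : z.1 = u * q + s * p by lia.
  by rewrite pa qb; ring.
have -> : qscale r (a * s + b * u, u) = qsub (qscale s (p, 0)) (qscale (- u) (q, r)).
  by apply: pair_eq; rewrite /qsub /qscale /= ?pa ?qb; ring.
by apply: IB; exact: IZ.
Qed.

(** In one direction, $ra$ times $r(b+w)$ has second coordinate $r^2 a$. In the other, the products
    $\bar x y$ of lattice elements are divisible by [a]. *)
Lemma cnorm_hermite_normal_form v r a b : 0 < r -> 0 < a -> Z.divide a (nm (b, 1)) ->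
  (forall z, in_ideal_gen v z <-> exists2 z', lattice a b z' & z = qscale r z') ->
  cnorm t n v = r * r * a.
Proof.
move=> r0 a0 ab h; apply: Z.divide_antisym_nonneg.
- by have := cnorm_ge0 v; lia.
- by nia.
- have Ia : in_ideal_gen v (qscale r (a, 0)).
    by apply/h; exists (a, 0) => //; exists 1, 0; rewrite mulr0 addr0 mulr1.
  have Ib : in_ideal_gen v (qscale r (b, 1)).
    by apply/h; exists (b, 1) => //; exists 0, 1; rewrite mulr0 add0r mulr1.
  have [_] := ideal_gen_dvd Ia Ib.
  by have -> : (mul (conj (qscale r (a, 0))) (qscale r (b, 1))).2 = r * r * a by qexp; ring.
- have /h[x1 Lx1 e1] := in_ideal_gen1 v; have /h[x2 Lx2 e2] := in_ideal_gen2 v.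
  have rr k x : nm (qscale k x) = k * k * nm x by qexp; ring.
  have aa x : lattice a b x -> Z.divide a (nm x).
    move=> Lx; have [z hz] := lattice_conj_mul ab Lx Lx.
    have -> : nm x = (mul (conj x) x).1 by qexp; ring.
    by rewrite hz; exists z.1; rewrite /qscale /= mulrC.
  apply: dvd_cnorm; rewrite ?e1 ?e2 ?rr; [apply: Z.mul_divide_mono_l; exact: aa..|].
  have [z hz] := lattice_conj_mul ab Lx1 Lx2.
  have -> : mul (conj (qscale r x1)) (qscale r x2) = qscale (r * r) (mul (conj x1) x2) by qring.
  rewrite hz; have -> : qscale (r * r) (qscale a z) = qscale (r * r * a) z by qring.
  by apply: qdvd_scale; exact: Z.divide_refl.
Qed.
End Ideals.

Lemma mem_zrange (x lo hi : Z) : lo <= x -> x <= hi -> x \in zrange lo hi.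
Proof.
move=> lx xh; apply/mapP; exists (Z.to_nat (x - lo)); last by rewrite Z2Nat.id; lia.
by rewrite mem_iota; lia.
Qed.

Lemma Z_le_sqrt (x m : Z) : x * x <= m -> x <= Z.sqrt m /\ - Z.sqrt m <= x.
Proof.
move=> xm; have m0 : 0 <= m by nia.
have [h1 h2] : Z.le (Z.sqrt m * Z.sqrt m) m /\ Z.lt m ((Z.sqrt m + 1) * (Z.sqrt m + 1)).
  have := Z.sqrt_spec m ltac:(lia); rewrite /Z.succ; lia.
have := Z.sqrt_nonneg m; split; nia.
Qed.

(** * Reduction of ideals and transitivity on generating pairs *)

Section Classes.
Variables t n : Z.
Hypothesis t_ge0 : 0 <= t.
Hypothesis t_le1 : t <= 1.
Hypothesis disc_gt0 : 0 < disc4 t n.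
Local Notation mul := (qmul t n).
Local Notation nm := (qnorm t n).
Local Notation conj := (qconj t).
Implicit Types (x y z : zpt) (v w : zpt * zpt).

(** The relation $\mu I = \nu I'$; two multipliers are needed because only integral elements are
    represented. *)
Definition similar (a b a' b' : Z) := exists mu nu : zpt,
  [/\ mu != (0, 0), nu != (0, 0),
      forall p, lattice a b p -> exists2 p', lattice a' b' p' & mul mu p = mul nu p' &
      forall p', lattice a' b' p' -> exists2 p, lattice a b p & mul mu p = mul nu p'].

Lemma similar_trans a b a' b' a'' b'' :
  similar a b a' b' -> similar a' b' a'' b'' -> similar a b a'' b''.
Proof.
move=> [m [k [m0 k0 h1 h2]]] [m' [k' [m0' k0' h1' h2']]].
exists (mul m' m), (mul k k'); split; try exact: qmul_neq0.
  move=> p /h1[p' /h1'[p'' Lp'' e'] e]; exists p'' => //.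
  have -> : mul (mul m' m) p = mul m' (mul m p) by qring.
  rewrite e; have -> : mul m' (mul k p') = mul k (mul m' p') by qring.
  by rewrite e'; qring.
move=> p'' /h2'[p' /h2[p Lp e] e']; exists p => //.
have -> : mul (mul m' m) p = mul m' (mul m p) by qring.
rewrite e; have -> : mul m' (mul k p') = mul k (mul m' p') by qring.
by rewrite e'; qring.
Qed.

Lemma similar_shift a b (k : Z) : similar a b a (b + a * k).
Proof.
exists (1, 0), (1, 0); split=> // _ [s [u ->]].
  exists (a * s + b * u, u) => //; exists (s - k * u), u; congr pair; ring.
exists (a * s + (b + a * k) * u, u) => //; exists (s + k * u), u; congr pair; ring.
Qed.

(* c (Z a + Z (b + w)) = (b + w) (Z c + Z (- b - t + w)) when a c = |b + w|^2. *)
Lemma similar_flip (a b c : Z) : 0 < c -> nm (b, 1) = a * c -> similar a b c (- b - t).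
Proof.
rewrite {1}/qnorm /= => c0 h; exists (c, 0), (b, 1).
have hn : n = a * c - b * b - t * b by rewrite -h; ring.
split.
- by apply/eqP => -[c1]; rewrite c1 ltxx in c0.
- by apply/eqP.
- move=> _ [s [u ->]]; exists (c * u + (- b - t) * (- s), - s); first by exists u, (- s).
  by apply: pair_eq; rewrite /qmul /= ?hn; ring.
- move=> _ [u [s ->]]; exists (a * (- s) + b * u, u); first by exists (- s), u.
  by apply: pair_eq; rewrite /qmul /= ?hn; ring.
Qed.

(** Gauss reduction, by induction on a bound for [a]. A shift brings $2b+t$ into the interval from
    $-a$ to $a$. If then $c < a$, the flip replaces [a] by [c]; otherwise $a^2 \le ac$ and $4ac =
    (2b+t)^2 + |d_K| \le a^2 + |d_K|$ bound [a], and the pair is among those searched by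
    [classes_ok]. *)
Lemma classes_ok_similar cs a b : classes_ok t n cs -> 0 < a -> Z.divide a (nm (b, 1)) ->
  exists2 c, List.In c cs & similar a b (ca c) (cb c).
Proof.
move=> /allP ok; elim: {a}(Z.to_nat a) {-2}a b (leqnn (Z.to_nat a)) => [|m IH] a b am a0.
  by lia.
case/ZdivideP=> c1 hc1.
(* The offset [a - 1] turns the remainder range from 0 to [2 a - 1] into [- a < 2 b' + t <= a]. *)
pose x := 2%:R * b + t + a - 1; pose j := - Z.div x (2%:R * a).
pose b' := b + a * j.
have [hx0 hx1] := Z.mod_pos_bound x (2%:R * a) ltac:(lia).
have hx := Z.div_mod x (2%:R * a) ltac:(lia).
have k1 : - a < 2%:R * b' + t by rewrite /b' /j; rewrite {1}/x in hx; lia.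
have k2 : 2%:R * b' + t <= a by rewrite /b' /j; rewrite {1}/x in hx; lia.
have sb : similar a b a b' by exact: similar_shift.
have nb0 : 0 < nm (b', 1) by apply: qnormZ_gt0 => //; apply/eqP.
have [c hc] : exists c : Z, nm (b', 1) = a * c.
  exists (c1 + 2%:R * b * j + a * j * j + t * j).
  have -> : nm (b', 1) = nm (b, 1) + a * (2%:R * b * j + a * j * j + t * j).
    by rewrite /b' /qnorm /=; ring.
  by rewrite hc1; ring.
have c0 : 0 < c by rewrite hc pmulr_rgt0 in nb0.
have flip := similar_flip c0 hc.
have nmflip : nm (- b' - t, 1) = nm (b', 1) by rewrite /qnorm /=; ring.
have [ca1|ac] := ltP c a.
  have [||d dcs dsim] := IH c (- b' - t) _ c0; first by lia.
    by exists a; rewrite nmflip hc.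
  by exists d => //; apply: similar_trans sb _; apply: similar_trans flip _.
have a3 : 3%:R * (a * a) <= disc4 t n.
  have : 4%:R * nm (b', 1) = (2%:R * b' + t) * (2%:R * b' + t) + disc4 t n.
    by rewrite /qnorm /disc4 /=; ring.
  have : (2%:R * b' + t) * (2%:R * b' + t) <= a * a by nia.
  have : a * a <= a * c by nia.
  by rewrite hc; lia.
have amem : a \in zrange 1 (Z.sqrt (Z.div (disc4 t n) 3%:R)).
  apply: mem_zrange; first by lia.
  have [] // := @Z_le_sqrt a (Z.div (disc4 t n) 3%:R).
  by have := Z.div_le_lower_bound (disc4 t n) 3%:R (a * a) ltac:(lia) ltac:(lia); lia.
have bmem : b' \in zrange (- (a + 1)) (a + 1) by apply: mem_zrange; lia.
have divE : Z.div (nm (b', 1)) a = c by rewrite hc mulrC; apply: Z.div_mul; lia.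
have modE : Z.modulo (nm (b', 1)) a = 0 by rewrite hc mulrC; apply: Z.mod_mul; lia.
have hasP aa bb : has_cusp cs aa bb -> exists2 d, List.In d cs & ca d = aa /\ cb d = bb.
  rewrite /has_cusp; elim: (cs) => //= d ds IHd /orP[/andP[/eqP h1 /eqP h2]|/IHd[e e1 e2]].
    by exists d; [left|].
  by exists e; [right|].
have := ok _ amem; move/allP=> /(_ _ bmem); cbv beta zeta; rewrite divE modE k1 k2 eqxx [c < a]ltNge ac /=.
case/orP=> [/hasP[d dcs [da db]]|/andP[/eqP ca1 /hasP[d dcs [da db]]]]; exists d => //; rewrite da db //.
by apply: similar_trans sb _; rewrite -[X in similar _ _ X]ca1.
Qed.

Lemma ideal_gen_lattice a b x : Z.divide a (nm (b, 1)) ->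
  in_ideal_gen t n ((a, 0), (b, 1)) x <-> lattice a b x.
Proof.
move=> ab; split=> [[p [q ->]]|[s [u ->]]].
  by apply: latticeD; apply: lattice_mul => //; [exists 1, 0|exists 0, 1];
     rewrite ?mulr0 ?mulr1 ?addr0 ?add0r.
exists (s, 0), (u, 0); qring.
Qed.

(* Two pairs generating the ideal Za + Z(b + w) are complemented to matrices
   M, M' of determinant 1 whose second columns have entries in the inverse
   ideal; then M' M^-1 has integral entries. *)
Lemma lattice_transitive (a b : Z) w : 0 < a -> Z.divide a (nm (b, 1)) ->
  Z.gcd (Z.gcd a (2%:R * b + t)) (Z.div (nm (b, 1)) a) = 1 ->
  lattice a b w.1 -> lattice a b w.2 ->
  in_ideal_gen t n w (a, 0) -> in_ideal_gen t n w (b, 1) ->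
  exists2 g, mdet t n g = (1, 0) & mapp t n g ((a, 0), (b, 1)) = w.
Proof.
move=> a0 ab g1 Lw1 Lw2 [p11 [p12 ea]] [p21 [p22 eb]].
pose be : zpt := (b, 1); set c := Z.div _ a in g1.
have hc : nm be = a * c.
  by case/ZdivideP: (ab) => k hk; rewrite /c hk [RHS]mulrC; congr (_ * _); apply: esym; apply: Z.div_mul; lia.
have [p [q [r pqr]]] : exists p q r : Z, p * a + q * (2%:R * b + t) + r * c = 1.
  have [k [l e1]] := Z.gcd_bezout _ _ _ g1.
  have [k' [l' e2]] := Z.gcd_bezout a (2%:R * b + t) _ erefl.
  have e1' : k * Z.gcd a (2%:R * b + t) + l * c = 1 by [].
  have e2' : k' * a + l' * (2%:R * b + t) = Z.gcd a (2%:R * b + t) by [].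
  by exists (k * k'), (k * l'), l; apply: etrans e1'; rewrite -e2'; ring.
(* The Bezout relation multiplied by [a] becomes $a\bar x_0 + \beta\bar y_0 = a$, so the column
   $(-\bar y_0, \bar x_0)/a$ completes the cusp to determinant 1. Below, [X] and [Y] play the same
   role for [w]. *)
pose x0 := qadd (p * a, 0) (qscale q be); pose y0 := qadd (q * a, 0) (qscale r be).
have Lx0 : lattice a b x0.
  by exists p, q; apply: pair_eq; rewrite /x0 /be /qadd /qscale /=; ring.
have Ly0 : lattice a b y0.
  by exists q, r; apply: pair_eq; rewrite /y0 /be /qadd /qscale /=; ring.
have H0 : qadd (mul (a, 0) (conj x0)) (mul be (conj y0)) = (a, 0).
  have -> : qadd (mul (a, 0) (conj x0)) (mul be (conj y0))
      = (p * (a * a) + q * a * (2%:R * b + t) + r * nm be, 0).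
    by rewrite /x0 /y0 /be; qring.
  by rewrite hc; congr pair; rewrite -[RHS]mulr1 -[X in _ = _ * X]pqr; ring.
pose X := qadd (mul (conj p11) x0) (mul (conj p21) y0).
pose Y := qadd (mul (conj p12) x0) (mul (conj p22) y0).
have LX : lattice a b X by apply: latticeD; apply: lattice_mul.
have LY : lattice a b Y by apply: latticeD; apply: lattice_mul.
have H1 : qadd (mul w.1 (conj X)) (mul w.2 (conj Y)) = (a, 0).
  have -> : qadd (mul w.1 (conj X)) (mul w.2 (conj Y)) =
      qadd (mul (qadd (mul p11 w.1) (mul p12 w.2)) (conj x0))
           (mul (qadd (mul p21 w.1) (mul p22 w.2)) (conj y0)).
    by rewrite /X /Y; move: x0 y0 {X Y LX LY H0 Lx0 Ly0} => x0 y0; qring.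
  by rewrite -ea -eb.
have Lbe : lattice a b be by exists 0, 1; rewrite mulr0 add0r mulr1.
have [z1 e1] := lattice_conj_mul ab Lx0 Lw1.
have [z2 e2] := lattice_conj_mul ab Lx0 Lw2.
have [z3 e3] := lattice_conj_mul ab LY Lbe.
have [z4 e4] := lattice_conj_mul ab LX Lbe.
have [z5 e5] := lattice_conj_mul ab Ly0 Lw1.
have [z6 e6] := lattice_conj_mul ab Ly0 Lw2.
have scaleI x y : qscale a x = qscale a y -> x = y.
  have a00 : a != 0 by rewrite gt_eqF.
  case: x y => x1 x2 [y1 y2]; rewrite /qscale /= => -[/(mulfI a00) -> /(mulfI a00) -> //].
(* The entries of $M' M^{-1}$; each [z1], ..., [z6] is a product of one lattice element with the
   conjugate of another, divided by [a]. *)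
pose g : mat2 Z := ((qadd z1 z3, qsub z2 z4), (qsub z5 (conj Y), qadd z6 (conj X))).
have g11 : qscale a (qadd z1 z3) = qadd (mul (conj x0) w.1) (mul (conj Y) be).
  by rewrite e1 e3; qring.
have g21 : qscale a (qsub z2 z4) = qsub (mul (conj x0) w.2) (mul (conj X) be).
  by rewrite e2 e4; qring.
have g12 : qscale a (qsub z5 (conj Y)) = qsub (mul (conj y0) w.1) (qscale a (conj Y)).
  by rewrite e5; qring.
have g22 : qscale a (qadd z6 (conj X)) = qadd (mul (conj y0) w.2) (qscale a (conj X)).
  by rewrite e6; qring.
exists g.
  apply: (scaleI _ _); apply: (scaleI _ _).
  have -> : qscale a (qscale a (mdet t n g)) =
     qsub (mul (qscale a g.1.1) (qscale a g.2.2)) (mul (qscale a g.2.1) (qscale a g.1.2)).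
    by move: g => g; qring.
  rewrite [g.1.1]/(qadd z1 z3) [g.2.2]/(qadd z6 (conj X)) [g.2.1]/(qsub z5 (conj Y))
    [g.1.2]/(qsub z2 z4) g11 g12 g21 g22.
  have -> : qsub (mul (qadd (mul (conj x0) w.1) (mul (conj Y) be))
                      (qadd (mul (conj y0) w.2) (qscale a (conj X))))
                 (mul (qsub (mul (conj y0) w.1) (qscale a (conj Y)))
                      (qsub (mul (conj x0) w.2) (mul (conj X) be)))
    = mul (qadd (mul w.1 (conj X)) (mul w.2 (conj Y)))
          (qadd (mul (a, 0) (conj x0)) (mul be (conj y0))).
    by move: (conj x0) (conj y0) (conj X) (conj Y) w.1 w.2 (be) => A B C D E F G; qring.
  by rewrite H0 H1; qring.
rewrite /mapp /= [RHS](surjective_pairing w); move: w.1 w.2 g11 g12 g21 g22 => w1 w2 g11 g12 g21 g22.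
congr pair; apply: (scaleI _ _).
  have -> : qscale a (qadd (mul (qadd z1 z3) (a, 0)) (mul (qsub z5 (conj Y)) (b, 1)))
     = qadd (mul (qscale a (qadd z1 z3)) (a, 0)) (mul (qscale a (qsub z5 (conj Y))) be).
    by rewrite /be; qring.
  rewrite g11 g12.
  have -> : qadd (mul (qadd (mul (conj x0) w1) (mul (conj Y) be)) (a, 0))
      (mul (qsub (mul (conj y0) w1) (qscale a (conj Y))) be)
    = mul w1 (qadd (mul (a, 0) (conj x0)) (mul be (conj y0))).
    by move: (conj x0) (conj y0) (conj Y) (be) => A B C D; qring.
  by rewrite H0; qring.
have -> : qscale a (qadd (mul (qsub z2 z4) (a, 0)) (mul (qadd z6 (conj X)) (b, 1)))
   = qadd (mul (qscale a (qsub z2 z4)) (a, 0)) (mul (qscale a (qadd z6 (conj X))) be).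
  by rewrite /be; qring.
rewrite g21 g22.
have -> : qadd (mul (qsub (mul (conj x0) w2) (mul (conj X) be)) (a, 0))
    (mul (qadd (mul (conj y0) w2) (qscale a (conj X))) be)
  = mul w2 (qadd (mul (a, 0) (conj x0)) (mul be (conj y0))).
  by move: (conj x0) (conj y0) (conj X) (be) => A B C D; qring.
by rewrite H0; qring.
Qed.

(** Up to the scalars [mu] and [nu] a vector may be replaced by a pair generating a representative
    of its ideal class. This suffices because ideal norms and values of hermitian forms both scale
    by the norm of the scalar. *)
Lemma classes_ok_vector cs v : classes_ok t n cs -> v != ((0, 0), (0, 0)) ->
  exists2 c, List.In c cs & exists mu nu w,
  [/\ mu != (0, 0), nu != (0, 0), vscale t n mu v = vscale t n nu w,
      lattice (ca c) (cb c) w.1 /\ lattice (ca c) (cb c) w.2 &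
      forall x, lattice (ca c) (cb c) x -> in_ideal_gen t n w x].
Proof.
move=> ok v0; have [r [a [b [r0 a0 ab hI]]]] := ideal_hermite_normal_form disc_gt0 v0.
have [c ccs [mu [nu [m0 n0 h1 h2]]]] := classes_ok_similar ok a0 ab.
exists c => //.
have rn0 : mul (r, 0) nu != (0, 0).
  by apply: qmul_neq0 => //; apply/eqP => -[r00]; rewrite r00 ltxx in r0.
have /hI[x1 /h1[w1 Lw1 f1] e1] := in_ideal_gen1 t n v.
have /hI[x2 /h1[w2 Lw2 f2] e2] := in_ideal_gen2 t n v.
exists mu, (mul (r, 0) nu), (w1, w2); split=> //.
  rewrite /vscale e1 e2 /=.
  have sE x : mul mu (qscale r x) = qscale r (mul mu x) by qring.
  by rewrite !sE f1 f2; congr pair; qring.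
move=> x /h2[p Lp e].
have [y1 [y2 ep]] : in_ideal_gen t n v (qscale r p) by apply/hI; exists p.
exists y1, y2.
have mulI u z z' : u != (0, 0) -> mul u z = mul u z' -> z = z'.
  move=> u0 uz; have : mul u (qsub z z') = (0, 0).
    have -> : mul u (qsub z z') = qsub (mul u z) (mul u z') by qring.
    by rewrite uz /qsub !subrr.
  have [zz|zz] := eqVneq (qsub z z') (0, 0).
    move: zz; rewrite /qsub => -[/eqP + /eqP]; rewrite !subr_eq0 => /eqP h3 /eqP h4 _.
    exact: pair_eq.
  by move/eqP; rewrite (negPf (qmul_neq0 disc_gt0 u0 zz)).
apply: (mulI (mul (r, 0) nu)) => //.
have -> : mul (mul (r, 0) nu) x = qscale r (mul nu x) by qring.
rewrite -e /=.
have -> : qscale r (mul mu p) = mul mu (qscale r p) by qring.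
rewrite ep /= e1 e2.
have -> : mul mu (qadd (mul y1 (qscale r x1)) (mul y2 (qscale r x2)))
  = qscale r (qadd (mul y1 (mul mu x1)) (mul y2 (mul mu x2))) by qring.
by rewrite f1 f2; qring.
Qed.
End Classes.

(** * Lower bounds for the listed forms *)

Lemma hev_scale (A : comNzRingType) (t' n' : A) (H : herm A) (x : A * A) (w : (A * A) * (A * A)) :
  hev t' n' H (qmul t' n' x w.1, qmul t' n' x w.2) = qnorm t' n' x * hev t' n' H w.
Proof. by qexp; ring. Qed.

Section FormsBelow.
Variables t n : Z.
Hypothesis disc_gt0 : 0 < disc4 t n.
Hypothesis t_ge0 : 0 <= t.
Hypothesis t_le1 : t <= 1.
Local Notation mul := (qmul t n).
Local Notation nm := (qnorm t n).
Local Notation conj := (qconj t).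
Implicit Types (x y z : zpt) (v w : zpt * zpt).

Lemma in_ideal_lattice a b x : a != 0 -> lattice a b x -> in_ideal a b x.
Proof.
move=> a0 [s [u ->]]; rewrite /in_ideal; apply/eqP.
transitivity (Z.modulo (s * a) a); last by apply: Z.mod_mul; lia.
by congr Z.modulo; cbv [fst snd]; ring.
Qed.

Lemma qnorm_bounds (c m : Z) x : 0 < c -> c * nm x < m ->
  (disc4 t n * c) * (x.2 * x.2) <= 4%:R * m /\
  c * ((2%:R * x.1 + t * x.2) * (2%:R * x.1 + t * x.2)) <= 4%:R * m.
Proof.
move=> c0 cm; have e : 4%:R * nm x =
   (2%:R * x.1 + t * x.2) ^+ 2 + disc4 t n * x.2 ^+ 2 by rewrite /qnorm /disc4; ring.
have h1 : 0 <= c * (2%:R * x.1 + t * x.2) ^+ 2 by rewrite mulr_ge0 ?sqr_ge0 // ltW.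
have h2 : 0 <= c * (disc4 t n * x.2 ^+ 2) by rewrite mulr_ge0 ?(ltW c0) // mulr_ge0 ?(ltW disc_gt0) ?sqr_ge0.
have h3 : 4%:R * (c * nm x) < 4%:R * m by rewrite ltr_pM2l.
have e2 : 4%:R * (c * nm x) = c * (2%:R * x.1 + t * x.2) ^+ 2 + c * (disc4 t n * x.2 ^+ 2).
  by rewrite mulrCA e mulrDr.
split; rewrite -?expr2; first by rewrite -mulrA mulrCA; lra.
by lra.
Qed.

Lemma Z_abs_le_sqrt_div (c m k : Z) : 0 < c -> c * (k * k) <= m ->
  k <= Z.sqrt (Z.div m c) /\ - Z.sqrt (Z.div m c) <= k.
Proof.
move=> c0 ck; apply: Z_le_sqrt.
by have := Z.div_le_lower_bound m c (k * k) ltac:(lia) ltac:(lia); lia.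
Qed.

Lemma mem_zrange_div (c lo hi k x : Z) : 0 < c -> lo <= c * x + k -> c * x + k <= hi ->
  x \in zrange (Z.div (lo - k) c) (Z.div (hi - k) c).
Proof.
move=> c0 h1 h2; apply: mem_zrange.
  by have := Z.div_le_upper_bound (lo - k) c x ltac:(lia) ltac:(lia); lia.
by have := Z.div_le_lower_bound (hi - k) c x ltac:(lia) ltac:(lia); lia.
Qed.

Lemma lower_okP F (a b : Z) x y : 0 < a -> 0 < fden F -> 0 < (fherm F).1.1 ->
  0 < hdt t n (fherm F) -> lower_ok t n F a b ->
  lattice a b x -> lattice a b y -> (x, y) != ((0, 0), (0, 0)) ->
  fden F * a <= hev t n (fherm F) (x, y).
Proof.
rewrite /lower_ok; case: F => m [[p s] r] /= w0 a0 m0 p0 Dt0.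
cbv zeta; set Dt := hdt _ _ _ in Dt0 *; set M := p * (m * a).
move=> /allP ok Lx Ly xy0.
rewrite leNgt; apply/negP => hlt.
have hM : p * hev t n (p, s, r) (x, y) < M by rewrite ltr_pM2l.
have e : p * hev t n (p, s, r) (x, y) = nm (qadd (qscale p x) (mul s y)) + Dt * nm y.
  by rewrite /Dt; qexp; ring.
have nm0 u : 0 <= nm u.
  by have [->|/(qnormZ_gt0 disc_gt0)/ltW//] := eqVneq u (0, 0); rewrite /qnorm /= !mulr0 !addr0.
have h1 : Dt * nm y < M by have := nm0 (qadd (qscale p x) (mul s y)); lra.
have h2 : 1 * nm (qadd (qscale p x) (mul s y)) < M.
  by have := mulr_ge0 (ltW Dt0) (nm0 y); lra.
have [y2 y1] := qnorm_bounds Dt0 h1.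
have [z2 z1] := qnorm_bounds ltr01 h2.
rewrite mulr1 in z2; rewrite mul1r in z1.
have dD : 0 < Dt * disc4 t n by rewrite mulr_gt0.
rewrite [disc4 t n * Dt]mulrC in y2.
have [y2u y2l] := Z_abs_le_sqrt_div dD y2.
have [y1u y1l] := Z_abs_le_sqrt_div Dt0 y1.
have [z2u z2l] := Z_abs_le_sqrt_div disc_gt0 z2.
have [z1u z1l] := Z_le_sqrt z1.
move: ok y2u y2l y1u y1l z2u z2l z1u z1l.
set V := Z.sqrt (Z.div _ (Dt * _)); set U := Z.sqrt (Z.div _ Dt).
set B2 := Z.sqrt (Z.div _ (disc4 _ _)); set B1 := Z.sqrt (4%:R * M).
move=> ok y2u y2l y1u y1l z2u z2l z1u z1l.
have /ok/allP : y.2 \in zrange (- V) V by exact: mem_zrange.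
(* From $|2y_1 + ty_2| \le U$, $|y_2| \le V$ and $0 \le t \le 1$. *)
have y1m : y.1 \in zrange (- (U + V)) (U + V) by apply: mem_zrange; nia.
move=> /(_ _ y1m); rewrite -surjective_pairing leNgt h1 /=.
rewrite in_ideal_lattice ?gt_eqF //=.
have x2m : x.2 \in zrange (Z.div (- B2 - (mul s y).2) p) (Z.div (B2 - (mul s y).2) p).
  by apply: mem_zrange_div.
move=> /allP/(_ _ x2m)/allP.
have x1m : x.1 \in zrange
   (Z.div (- B1 - (2%:R * (mul s y).1 + t * (p * x.2 + (mul s y).2))) (2%:R * p))
   (Z.div (B1 - (2%:R * (mul s y).1 + t * (p * x.2 + (mul s y).2))) (2%:R * p)).
  have eq1 : 2%:R * p * x.1 + (2%:R * (mul s y).1 + t * (p * x.2 + (mul s y).2))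
     = 2%:R * (qadd (qscale p x) (mul s y)).1 + t * (qadd (qscale p x) (mul s y)).2.
    by rewrite /qadd /qscale /=; ring.
  by apply: mem_zrange_div; rewrite ?eq1 ?mulr_gt0.
move=> /(_ _ x1m); rewrite -surjective_pairing in_ideal_lattice ?gt_eqF //= leNgt hlt /= orbF.
by move: xy0; rewrite xpair_eqE => /negPf ->.
Qed.

(** Both sides scale alike, so [w] is replaced by a pair in the lattice of its class. The norm of
    that pair is at most [ca c], and [lower_ok] has tested the bound with [ca c]. *)
Lemma form_lower_bound cs F w : classes_ok t n cs -> 0 < fden F -> 0 < (fherm F).1.1 ->
  0 < hdt t n (fherm F) ->
  (forall c, List.In c cs -> [/\ 0 < ca c, Z.divide (ca c) (nm (cb c, 1)) &
     lower_ok t n F (ca c) (cb c)]) ->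
  w != ((0, 0), (0, 0)) -> fden F * cnorm t n w <= hev t n (fherm F) w.
Proof.
move=> cok m0 p0 D0 csok w0.
have [c ccs [mu [nu [u [m00 n00 e [Lu1 Lu2] gen]]]]] :=
  classes_ok_vector t_ge0 t_le1 disc_gt0 cok w0.
have [a0 ab low] := csok c ccs.
have hm : 0 < nm mu by exact: qnormZ_gt0.
have hn : 0 < nm nu by exact: qnormZ_gt0.
have u0 : (u.1, u.2) != ((0, 0), (0, 0)).
  rewrite -surjective_pairing; apply/eqP => u0.
  have := cnorm_gt0 disc_gt0 w0; have := cnorm_scale disc_gt0 mu w; rewrite e u0.
  have -> : vscale t n nu (0, 0, (0, 0)) = (0, 0, (0, 0)).
    by rewrite /vscale; congr pair; qring.
  have -> : cnorm t n (0, 0, (0, 0)) = 0.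
    have nm00 : nm (0, 0) = 0 by qexp; ring.
    have m00' : mul (conj (0, 0)) (0, 0) = (0, 0) by qring.
    by rewrite /cnorm; cbv beta iota zeta delta [fst snd]; rewrite nm00 m00'.
  by move/esym/eqP; rewrite mulf_eq0 gt_eqF //= => /eqP ->; rewrite ltxx.
have low1 := lower_okP a0 m0 p0 D0 low Lu1 Lu2 u0.
have ca1 : cnorm t n u <= ca c.
  have Ia : in_ideal_gen t n u (ca c, 0).
    by apply: gen; exists 1, 0; rewrite mulr1 mulr0 addr0.
  have Ib : in_ideal_gen t n u (cb c, 1).
    by apply: gen; exists 0, 1; rewrite mulr1 mulr0 add0r.
  have [_] := ideal_gen_dvd Ia Ib.
  have -> : (mul (conj (ca c, 0)) (cb c, 1)).2 = ca c by qexp; ring.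
  by move=> /Z.divide_pos_le h; have := h ltac:(lia); lia.
rewrite -(ler_pM2l hm) -hev_scale.
rewrite -[(_, _)]/(vscale t n mu w) mulrCA -(cnorm_scale disc_gt0 mu w) e.
rewrite (cnorm_scale disc_gt0) hev_scale mulrCA (ler_pM2l hn).
apply: le_trans (_ : fden F * ca c <= _); first by rewrite ler_pM2l.
by rewrite (surjective_pairing u).
Qed.
End FormsBelow.

(** * Forms near a cusp *)

Section Chart.
Variables (R : fieldType) (t n a b : R).
Hypothesis a_neq0 : a != 0.
Local Notation mul := (qmul t n).
Local Notation nm := (qnorm t n).
Local Notation conj := (qconj t).
Local Notation vc := (((a, 0), (b, 1)) : (R * R) * (R * R)).
Local Notation e2 := (((0, 0), (1, 0)) : (R * R) * (R * R)).
Implicit Types (H : herm R) (w : (R * R) * (R * R)).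

(** The Gram determinant of two vectors: the defect in the Cauchy-Schwarz inequality is the
    determinant of the form times the norm of the exterior product. *)
Lemma hev_hev H u w : hev t n H u * hev t n H w =
  nm (hcross t n H u w) + hdt t n H * nm (qsub (mul u.1 w.2) (mul u.2 w.1)).
Proof.
by move: H u w => [[h1 [h2 h3]] h4] [[u1 u2] [v1 v2]] [[w1 w2] [x1 x2]]; qexp; ring.
Qed.

Lemma hcross_addr H u (w w' : (R * R) * (R * R)) :
  hcross t n H u (qadd w.1 w'.1, qadd w.2 w'.2) = qadd (hcross t n H u w) (hcross t n H u w').
Proof.
move: H u w w' => [[h1 [h2 h3]] h4] [[u1 u2] [v1 v2]] [[w1 w2] [x1 x2]] [[y1 y2] [z1 z2]]; qring.
Qed.

Lemma hcross_scaler H u (x : R * R) w :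
  hcross t n H u (mul x w.1, mul x w.2) = mul x (hcross t n H u w).
Proof.
move: H u x w => [[h1 [h2 h3]] h4] [[u1 u2] [v1 v2]] [x1 x2] [[w1 w2] [y1 y2]]; qring.
Qed.

Lemma hcross_diag H u : hcross t n H u u = (hev t n H u, 0).
Proof.
by move: H u => [[h1 [h2 h3]] h4] [[u1 u2] [v1 v2]]; qring.
Qed.

(* The point of C below the form H, when the cusp vc is at infinity. *)
Definition foot H := qscale (- a^-1) (hcross t n H vc e2).

Lemma hcross_vc H w : hev t n H vc = a ->
  hcross t n H vc w = qsub w.1 (mul (foot H) (qsub (qscale a w.2) (mul (b, 1) w.1))).
Proof.
(* Expansion of a vector in the basis formed by the cusp and [e2]. *)
move=> Ha; have e : forall u : (R * R) * (R * R), u =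
    (qadd (mul (qscale a^-1 u.1) vc.1) (mul (qscale a^-1 (qsub (qscale a u.2) (mul (b, 1) u.1))) e2.1),
     qadd (mul (qscale a^-1 u.1) vc.2) (mul (qscale a^-1 (qsub (qscale a u.2) (mul (b, 1) u.1))) e2.2)).
  by move=> [[w1 w2] [x1 x2]]; congr pair; apply: pair_eq; qexp; field.
rewrite {1}(e w) (hcross_addr H vc (_, _) (_, _)) !hcross_scaler hcross_diag Ha /foot.
by apply: pair_eq; move: (hcross t n H vc e2) (qsub (qscale a w.2) _) => Z y; qexp; field.
Qed.

Lemma hev_chart H w : hev t n H vc = a ->
  a * hev t n H w =
  nm (qsub w.1 (mul (foot H) (qsub (qscale a w.2) (mul (b, 1) w.1))))
  + hdt t n H * nm (qsub (qscale a w.2) (mul (b, 1) w.1)).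
Proof.
move=> Ha; rewrite -{1}Ha hev_hev hcross_vc //.
by have -> : mul vc.1 w.2 = qscale a w.2 by qring.
Qed.

Lemma chart_unique H H' : hev t n H vc = a -> hev t n H' vc = a ->
  hdt t n H = hdt t n H' -> foot H = foot H' -> H = H'.
Proof.
move=> Ha Ha' dH fH; have hE w : hev t n H w = hev t n H' w.
  by apply: (mulfI a_neq0); rewrite !hev_chart // fH dH.
have ev1 K : hev t n K ((1, 0), (0, 0)) = K.1.1 by qexp; ring.
have ev2 K : hev t n K e2 = K.2 by qexp; ring.
have E1 : H.1.1 = H'.1.1 by rewrite -!ev1.
have E2 : H.2 = H'.2 by rewrite -!ev2.
have cE K : hcross t n K vc e2 = qadd (qscale a K.1.2) (qscale K.2 (conj (b, 1))) by qring.
have : hcross t n H vc e2 = hcross t n H' vc e2.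
  have c0 : - a^-1 != 0 by rewrite oppr_eq0 invr_eq0.
  by move: fH; rewrite /foot /qscale => -[/(mulfI c0) h1 /(mulfI c0) h2]; exact: pair_eq.
rewrite !cE E2; case: H H' E1 E2 {Ha Ha' dH fH hE} => [[h1 [h2 h3]] h4] [[k1 [k2 k3]] k4] /= -> ->.
by rewrite /qadd /qscale /= => -[/addIr/(mulfI a_neq0) -> /addIr/(mulfI a_neq0) ->].
Qed.

(** The matrix fixes the cusp and adds [A / a] times the cusp to [e2]. As [H] takes the value [a] at
    the cusp, the pairing of the cusp with [e2] grows by [A]. *)
Lemma foot_translate H (A B C : R * R) : hev t n H vc = a ->
  qscale a B = mul A (b, 1) -> qscale a C = mul B (b, 1) ->
  let g := ((qsub (1, 0) B, qsub (0, 0) C), (A, qadd (1, 0) B)) in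
  [/\ hev t n (hpull t n H g) vc = a &
      foot (hpull t n H g) = qsub (foot H) (qscale a^-1 A)].
Proof.
move=> Ha eB eC g.
have gvc : mapp t n g vc = vc.
  rewrite /mapp /g; congr pair.
    have -> : qadd (mul (qsub (1, 0) B) (a, 0)) (mul A (b, 1))
      = qadd (a, 0) (qsub (mul A (b, 1)) (qscale a B)) by qring.
    by rewrite eB; qring.
  have -> : qadd (mul (qsub (0, 0) C) (a, 0)) (mul (qadd (1, 0) B) (b, 1))
    = qadd (b, 1) (qsub (mul B (b, 1)) (qscale a C)) by qring.
  by rewrite eC; qring.
split; first by rewrite hev_hpull gvc.
rewrite /foot hcross_hpull gvc.
have -> : mapp t n g e2 = (qadd e2.1 (mul (qscale a^-1 A) vc.1), qadd e2.2 (mul (qscale a^-1 A) vc.2)).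
  rewrite /mapp /g; congr pair; first by apply: pair_eq; qexp; field.
  have -> : mul (qscale a^-1 A) (b, 1) = qscale a^-1 (mul A (b, 1)) by qring.
  by rewrite -eB; apply: pair_eq; qexp; field.
rewrite (hcross_addr H vc e2 (_, _)) hcross_scaler hcross_diag Ha.
by apply: pair_eq; move: (hcross t n H vc e2) => Z; qexp; field.
Qed.
End Chart.

Section MatrixProduct.
Variables (A : comNzRingType) (t n : A).
Implicit Types (g h : mat2 A) (H : herm A).

Lemma hpull_mmul H g h : hpull t n (hpull t n H g) h = hpull t n H (mmul t n g h).
Proof. by rewrite {1 3}/hpull !hev_hpull hcross_hpull. Qed.

Lemma hpull_adj H g : mdet t n g = (1, 0) -> hpull t n (hpull t n H g) (madj g) = H.
Proof.
move=> g1; rewrite hpull_mmul.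
have -> : mmul t n g (madj g) = ((mdet t n g, (0, 0)), ((0, 0), mdet t n g)).
  case: g {g1} => [[[p1 p2] [q1 q2]] [[r1 r2] [s1 s2]]].
  by rewrite /mmul; congr pair; congr pair; qring.
rewrite g1; case: H => [[h1 [h2 h3]] h4].
by rewrite /hpull; congr pair; [congr pair; [qexp; ring|qring]|qexp; ring].
Qed.

Lemma mdet_mmul g h : mdet t n (mmul t n g h) = qmul t n (mdet t n g) (mdet t n h).
Proof.
by case: g h => [[[p1 p2] [q1 q2]] [[r1 r2] [s1 s2]]] [[[a1 a2] [b1 b2]] [[c1 c2] [d1 d2]]]; qring.
Qed.

Lemma mdet_adj g : mdet t n (madj g) = mdet t n g.
Proof. by case: g => [[[p1 p2] [q1 q2]] [[r1 r2] [s1 s2]]]; qring. Qed.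
End MatrixProduct.

Lemma all_In (T : Type) (p : T -> bool) (s : seq T) x : all p s -> List.In x s -> p x.
Proof. by elim: s => //= y s IH /andP[py /IH ps] [<-|/ps]. Qed.

Section RealForms.
Variables (R : realType) (t n dn dd : Z).
Local Notation z := (zr R).
Implicit Types (x y : zpt) (w : zpt * zpt) (g : mat2 Z) (F : form).

Definition zq x : R * R := (z x.1, z x.2).
Definition zv w : (R * R) * (R * R) := (zq w.1, zq w.2).
Definition zm g : mat2 R := (zv g.1, zv g.2).
Definition zh (H : herm Z) : herm R := (z H.1.1, zq H.1.2, z H.2).
Definition formR F : herm R :=
  let m := (z (fden F))^-1 in
  (m * z (fherm F).1.1, qscale m (zq (fherm F).1.2), m * z (fherm F).2).

Local Notation tR := (z t).
Local Notation nR := (z n).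

Ltac zexp := rewrite /zq /zv /zm /zh; qexp; rewrite ?(rmorphD, rmorphB, rmorphN, rmorphM, rmorph1, rmorph0, rmorph_nat).

Lemma zq_mul x y : zq (qmul t n x y) = qmul tR nR (zq x) (zq y).
Proof. by apply: pair_eq; zexp. Qed.
Lemma zq_add x y : zq (qadd x y) = qadd (zq x) (zq y).
Proof. by apply: pair_eq; zexp. Qed.
Lemma zq_sub x y : zq (qsub x y) = qsub (zq x) (zq y).
Proof. by apply: pair_eq; zexp. Qed.
Lemma zq_scale (c : Z) x : zq (qscale c x) = qscale (z c) (zq x).
Proof. by apply: pair_eq; zexp. Qed.
Lemma zq_conj x : zq (qconj t x) = qconj tR (zq x).
Proof. by apply: pair_eq; zexp. Qed.
Lemma z_norm x : z (qnorm t n x) = qnorm tR nR (zq x).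
Proof. by zexp. Qed.
Lemma z_tr x : z (qtr t x) = qtr tR (zq x).
Proof. by zexp. Qed.
Lemma z_hev H w : z (hev t n H w) = hev tR nR (zh H) (zv w).
Proof. by zexp. Qed.
Lemma zv_mapp g w : zv (mapp t n g w) = mapp tR nR (zm g) (zv w).
Proof. by rewrite /mapp /zv /= !zq_add !zq_mul. Qed.
Lemma zq_mdet g : zq (mdet t n g) = mdet tR nR (zm g).
Proof. by rewrite /mdet zq_sub !zq_mul. Qed.
Lemma zm_mmul g h : zm (mmul t n g h) = mmul tR nR (zm g) (zm h).
Proof. by rewrite /zm /mmul !zv_mapp. Qed.
Lemma zm_adj g : zm (madj g) = madj (zm g).
Proof. by rewrite /zm /zv /madj /= !zq_sub /zq /= rmorph0. Qed.
Lemma zq10 : zq (1, 0) = (1, 0).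
Proof. by rewrite /zq /= rmorph1 rmorph0. Qed.

Lemma hev_formR F (w : (R * R) * (R * R)) : hev tR nR (formR F) w = (z (fden F))^-1 * hev tR nR (zh (fherm F)) w.
Proof. by rewrite /formR /zh; qexp; ring. Qed.

Lemma hdt_formR F : hdt tR nR (formR F) = (z (fden F))^-1 ^+ 2 * z (hdt t n (fherm F)).
Proof. by rewrite /formR /hdt; zexp; rewrite /=; ring. Qed.
End RealForms.

(** * From an arbitrary real form to a listed one *)

Section Descent.
Variables (R : realType) (t n dn dd : Z) (fs : seq form) (cs : seq cusp).
Hypothesis ok : field_ok t n dn dd fs cs.
Local Notation z := (zr R).
Local Notation tR := (z t).
Local Notation nR := (z n).
Local Notation zvR := (zv R).
Local Notation zqR := (zq R).
Local Notation zmR := (zm R).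
Local Notation zhR := (zh R).
Local Notation formRR := (formR R).
Local Notation vcR a b := ((z a, 0), (z b, 1)).
Implicit Types (x y : zpt) (w v : zpt * zpt) (g : mat2 Z) (F : form) (H : herm R).

Lemma field_okP : [/\ 0 <= t, t <= 1, 0 < disc4 t n & [/\ 0 < dn, 0 < dd, classes_ok t n cs,
   all (form_ok t n dn dd cs) fs & all (cusp_ok t n dn dd fs) cs]].
Proof.
move: ok; rewrite /field_ok => /andP[h1 /andP[h2 /andP[h3 /andP[h4 /andP[h5 /and3P[h6 h7 h8]]]]]].
by [].
Qed.

Let t_ge0 : 0 <= t. Proof. by case: field_okP. Qed.
Let t_le1 : t <= 1. Proof. by case: field_okP. Qed.
Let disc_gt0 : 0 < disc4 t n. Proof. by case: field_okP. Qed.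
Let dn_gt0 : 0 < dn. Proof. by case: field_okP => _ _ _ []. Qed.
Let dd_gt0 : 0 < dd. Proof. by case: field_okP => _ _ _ []. Qed.

Lemma cusp_okP c : List.In c cs -> cusp_ok t n dn dd fs c.
Proof. by case: field_okP => _ _ _ [_ _ _ _ h]; exact: all_In. Qed.

Lemma cusp_dvd c : List.In c cs -> 0 < ca c /\ Z.divide (ca c) (qnorm t n (cb c, 1)).
Proof.
move=> /cusp_okP; rewrite /cusp_ok => /andP[a0 /andP[/eqP h _]]; split=> //.
by apply/Z.mod_divide => //; lia.
Qed.

Lemma form_okP F : List.In F fs ->
  [/\ 0 < fden F, 0 < (fherm F).1.1, dd * hdt t n (fherm F) = dn * (fden F * fden F),
     fmin F != ((0, 0), (0, 0)) & hev t n (fherm F) (fmin F) = fden F * cnorm t n (fmin F)].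
Proof.
move=> inF; have : form_ok t n dn dd cs F by case: field_okP => _ _ _ [_ _ _ h _]; exact: all_In h inF.
rewrite /form_ok; case: (fherm F) => [[p s] r].
by case/and5P => h1 h2 /eqP h3 h4 /andP[/eqP h5 _].
Qed.

Lemma form_lower F c : List.In F fs -> List.In c cs -> lower_ok t n F (ca c) (cb c).
Proof.
move=> inF inc; have : form_ok t n dn dd cs F by case: field_okP => _ _ _ [_ _ _ h _]; exact: all_In h inF.
rewrite /form_ok; case: (fherm F) => [[p s] r].
by case/and5P => _ _ _ _ /andP[_ h]; exact: (all_In h inc).
Qed.

Lemma form_hdt_gt0 F : List.In F fs -> 0 < hdt t n (fherm F).
Proof.
case/form_okP => m0 _ e _ _; rewrite -(pmulr_rgt0 _ dd_gt0) e.
by rewrite !mulr_gt0.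
Qed.

Lemma formR_ge F w : List.In F fs -> w != ((0, 0), (0, 0)) ->
  z (cnorm t n w) <= hev tR nR (formRR F) (zvR w).
Proof.
move=> inF w0; have [m0 p0 _ _ _] := form_okP inF.
have m0R : 0 < z (fden F) by rewrite zr_gt0.
rewrite hev_formR mulrC ler_pdivlMr // mulrC -rmorphM -z_hev ler_zr.
apply: (form_lower_bound disc_gt0 t_ge0 t_le1 (cs := cs)) w0 => //.
- by case: field_okP => _ _ _ [].
- exact: form_hdt_gt0.
- by move=> c inc; have [? ?] := cusp_dvd inc; split=> //; exact: form_lower.
Qed.

Lemma formR_min F : List.In F fs -> hev tR nR (formRR F) (zvR (fmin F)) = z (cnorm t n (fmin F)).
Proof.
move=> inF; have [m0 _ _ _ e] := form_okP inF.
rewrite hev_formR -z_hev e rmorphM mulKf // gt_eqF // zr_gt0 //.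
Qed.

Lemma formR_hdt F : List.In F fs -> z dd * hdt tR nR (formRR F) = z dn.
Proof.
move=> inF; have [m0 _ e _ _] := form_okP inF.
rewrite hdt_formR mulrCA -rmorphM e !rmorphM; field.
by rewrite gt_eqF // zr_gt0.
Qed.

Lemma formR_gt0 F : List.In F fs -> 0 < (formRR F).1.1.
Proof.
by move=> inF; have [m0 p0 _ _ _] := form_okP inF; rewrite mulr_gt0 ?invr_gt0 ?zr_gt0.
Qed.

(** The cross term of $|w_1 - xy|^2$ is minus the trace of $\bar w_1 y x$; its values at $x = 1$ and
    $x = w$ are the two linear coefficients. *)
Lemma qev_dist_quad a b w (x : R * R) : qevR t n (dist_quad t n dn dd a b w) x =
  let y := zqR (qsub (qscale a w.2) (qmul t n (b, 1) w.1)) in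
  z dd * (qnorm tR nR (qsub (zqR w.1) (qmul tR nR x y)) - z a * z (cnorm t n w))
   + z dn * qnorm tR nR y.
Proof.
rewrite /dist_quad; cbv zeta; set y0 := qsub (qscale a w.2) _; set y := zqR y0.
set m := qmul t n (qconj t w.1) y0.
have e1 : z (dd * qnorm t n y0) = z dd * qnorm tR nR y by rewrite -z_norm -rmorphM.
have e2 u : z (- (dd * qtr t u)) = - (z dd * qtr tR (zqR u)) by rewrite -z_tr -rmorphM -rmorphN.
have e3 : z (dd * (qnorm t n w.1 - a * cnorm t n w) + dn * qnorm t n y0)
   = z dd * (qnorm tR nR (zqR w.1) - z a * z (cnorm t n w)) + z dn * qnorm tR nR y.
  by rewrite -!z_norm -!rmorphM -rmorphB -rmorphM -rmorphD.
have e4 : zqR (0, 1) = (0, 1) by rewrite /zq /= rmorph1 rmorph0.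
rewrite /qevR /linR.
transitivity (z (dd * qnorm t n y0) * qnorm tR nR x + (z (- (dd * qtr t m)) * x.1
   + z (- (dd * qtr t (qmul t n m (0, 1)))) * x.2
   + z (dd * (qnorm t n w.1 - a * cnorm t n w) + dn * qnorm t n y0))); first by [].
rewrite e1 !e2 e3 !zq_mul zq_conj e4 -/y.
move: (zqR w.1) (y) (z (cnorm t n w)) => [W1 W2] [Y1 Y2] N.
move: x (zr R t) (zr R n) (zr R dd) (zr R dn) (zr R a) => [x1 x2] T M d1 d2 A {e1 e2 e3 e4}.
by qexp; ring.
Qed.

Definition above_norm H := forall w, w != ((0, 0), (0, 0)) -> z (cnorm t n w) <= hev tR nR H (zvR w).

Lemma mapp_neq0 g w : mdet t n g = (1, 0) -> w != ((0, 0), (0, 0)) ->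
  mapp t n g w != ((0, 0), (0, 0)).
Proof.
move=> g1; apply: contraNneq => e; rewrite -(mapp_adj w g1) e.
by rewrite /mapp; apply/eqP; congr pair; qring.
Qed.

Lemma above_norm_hpull H g : mdet t n g = (1, 0) -> above_norm H -> above_norm (hpull tR nR H (zmR g)).
Proof.
move=> g1 Hg w w0; rewrite hev_hpull -zv_mapp -(cnorm_mapp disc_gt0 w g1).
by apply: Hg; exact: mapp_neq0.
Qed.

Lemma hdt_hpull1 H g : mdet t n g = (1, 0) -> hdt tR nR (hpull tR nR H (zmR g)) = hdt tR nR H.
Proof.
move=> g1; rewrite hdt_hpull -zq_mdet g1 zq10.
by rewrite /qnorm /= !mulr0 !addr0 !mulr1.
Qed.

Lemma cnorm_cusp c : List.In c cs -> cnorm t n ((ca c, 0), (cb c, 1)) = ca c.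
Proof.
move=> inc; have [a0 ab] := cusp_dvd inc.
rewrite (@cnorm_hermite_normal_form t n disc_gt0 _ 1 (ca c) (cb c)) ?mul1r // => x.
split=> [/(ideal_gen_lattice _ ab) Lx|[x' Lx ->]]; first by exists x => //; qring.
by apply/ideal_gen_lattice => //; have -> : qscale 1 x' = x' by qring.
Qed.

(** Equality of value and ideal norm survives scalar multiples; it therefore passes from [v0] to a
    pair generating the ideal of a cusp, and [lattice_transitive] carries the cusp to this pair. *)
Lemma move_to_cusp H v0 : v0 != ((0, 0), (0, 0)) ->
  hev tR nR H (zvR v0) = z (cnorm t n v0) ->
  exists2 c, List.In c cs & exists2 g, mdet t n g = (1, 0) &
    hev tR nR (hpull tR nR H (zmR g)) (vcR (ca c) (cb c)) = z (ca c).
Proof.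
move=> v00 Hv0; have cok : classes_ok t n cs by case: field_okP => _ _ _ [].
have [c inc [mu [nu [w [m0 n0 e [Lw1 Lw2] gen]]]]] :=
  classes_ok_vector t_ge0 t_le1 disc_gt0 cok v00.
exists c => //; have [a0 ab] := cusp_dvd inc.
have [g g1 gw] : exists2 g, mdet t n g = (1, 0) & mapp t n g ((ca c, 0), (cb c, 1)) = w.
  apply: lattice_transitive => //.
  - have := cusp_okP inc; rewrite /cusp_ok.
    by case/andP=> _ /andP[_ /andP[/eqP]].
  - by apply: gen; exists 1, 0; rewrite mulr1 mulr0 addr0.
  - by apply: gen; exists 0, 1; rewrite mulr1 mulr0 add0r.
exists g => //.
have -> : vcR (ca c) (cb c) = zvR ((ca c, 0), (cb c, 1)).
  by rewrite /zv /zq /= rmorph0 rmorph1.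
rewrite hev_hpull -zv_mapp gw -(cnorm_cusp inc) -(cnorm_mapp disc_gt0 _ g1) gw.
have mu0 : z (qnorm t n mu) != 0 by rewrite gt_eqF // zr_gt0 qnormZ_gt0.
have nu0 : z (qnorm t n nu) != 0 by rewrite gt_eqF // zr_gt0 qnormZ_gt0.
apply: (mulfI nu0).
have sc x u : z (qnorm t n x) * hev tR nR H (zvR u) = hev tR nR H (zvR (vscale t n x u)).
  by rewrite z_norm -hev_scale /vscale /zv /= !zq_mul.
rewrite sc -e -sc Hv0 -!rmorphM -!(cnorm_scale disc_gt0) e //.
Qed.

Lemma trans_okP a be x : 0 < a -> trans_ok t n a be x ->
  exists B C, qscale a B = qmul t n x be /\ qscale a C = qmul t n B be.
Proof.
move=> a0; rewrite /trans_ok; cbv zeta.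
set y := qmul _ _ x be; set u := qmul _ _ y be.
case/and4P => /eqP h1 /eqP h2 /eqP h3 /eqP h4.
have [B1 e1] := (Z.mod_divide y.1 a ltac:(lia)).1 h1.
have [B2 e2] := (Z.mod_divide y.2 a ltac:(lia)).1 h2.
have [C1 e3] := (Z.mod_divide u.1 (a * a) ltac:(nia)).1 h3.
have [C2 e4] := (Z.mod_divide u.2 (a * a) ltac:(nia)).1 h4.
have eB : qscale a (B1, B2) = y by apply: pair_eq; rewrite ?e1 ?e2 /qscale /= mulrC.
exists (B1, B2), (C1, C2); split=> //.
have eC : qscale a (qscale a (C1, C2)) = qscale a (qmul t n (B1, B2) be).
  have -> : qscale a (qmul t n (B1, B2) be) = qmul t n (qscale a (B1, B2)) be by qring.
  rewrite eB -/u; apply: pair_eq; rewrite ?e3 ?e4 /qscale /= mulrA.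
    by rewrite mulrC.
  by rewrite mulrC.
have a00 : a != 0 by rewrite gt_eqF.
by move: eC => [/(mulfI a00) h5 /(mulfI a00) h6]; exact: pair_eq.
Qed.

Lemma domain_in_tri c (u v : R) : 0 < ca c -> 0 <= u <= 1 -> 0 <= v <= 1 ->
  exists2 T, T \in domain c & in_tri T
    (qscale (z (ca c))^-1 (qadd (qscale u (zqR (ct1 c))) (qscale v (zqR (ct2 c))))).
Proof.
move=> a0 /andP[u0 u1] /andP[v0 v1]; have a0R : 0 < z (ca c) by rewrite zr_gt0.
have a00 : z (ca c) != 0 by rewrite gt_eqF.
rewrite /domain; have [uv|uv] := lerP v u.
  eexists; first exact: mem_head.
  exists ((1 - u, (u - v) / z (ca c)), v / z (ca c)); split=> /=.
  - by rewrite subr_ge0.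
  - by rewrite divr_ge0 ?subr_ge0 // ltW.
  - by rewrite divr_ge0 // ltW.
  - by split; rewrite ?(rmorph0, rmorph1, rmorphD) /qscale /qadd /zq /=; field.
eexists; first by rewrite inE; apply/orP; right; exact: mem_head.
exists ((1 - v, u / z (ca c)), (v - u) / z (ca c)); split=> /=.
- by rewrite subr_ge0.
- by rewrite divr_ge0 // ltW.
- by rewrite divr_ge0 ?subr_ge0 // ltW.
- by split; rewrite ?(rmorph0, rmorph1, rmorphD) /qscale /qadd /zq /=; field.
Qed.

Lemma fractional_part (s : R) : exists k : Z, 0 <= s - z k <= 1.
Proof.
exists (Z_of_int (Num.floor s)).
have -> : z (Z_of_int (Num.floor s)) = (Num.floor s)%:~R by rewrite /zr /= Z_of_intK.
by have /andP[] := floor_itv s; rewrite intrD => *; apply/andP; split; lra.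
Qed.

Lemma foot_to_domain H c : List.In c cs -> hev tR nR H (vcR (ca c) (cb c)) = z (ca c) ->
  exists2 g, mdet t n g = (1, 0) &
    hev tR nR (hpull tR nR H (zmR g)) (vcR (ca c) (cb c)) = z (ca c) /\
    exists2 T, T \in domain c & in_tri T
      (foot tR nR (z (ca c)) (z (cb c)) (hpull tR nR H (zmR g))).
Proof.
move=> inc Ha; have [a0 ab] := cusp_dvd inc.
have a0R : z (ca c) != 0 by rewrite gt_eqF // zr_gt0.
have a00 : ca c != 0 by rewrite gt_eqF.
have := cusp_okP inc; rewrite /cusp_ok.
case/andP=> _ /andP[_ /andP[_ /and5P[tr1 tr2 t11 t12 /andP[t22 _]]]].
have [B1 [C1 [eB1 eC1]]] := trans_okP a0 tr1.
have [B2 [C2 [eB2 eC2]]] := trans_okP a0 tr2.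
set T1 := ct1 c in tr1 t11 t12 eB1 *; set T2 := ct2 c in tr2 t22 eB2 *.
have [phi phiE] : exists phi, phi = foot tR nR (z (ca c)) (z (cb c)) H by eexists.
have t11R : z T1.1 != 0 by rewrite gt_eqF // zr_gt0.
have t22R : z T2.2 != 0 by rewrite gt_eqF // zr_gt0.
(* The coordinates [s], [r] of [a phi] with respect to [T1], [T2], solved from the second component
   since [T1] is real; the translation removes their integral parts [i], [j]. *)
pose r := z (ca c) * phi.2 / z T2.2.
pose s := (z (ca c) * phi.1 - r * z T2.1) / z T1.1.
have [i i01] := fractional_part s; have [j j01] := fractional_part r.
pose A := qadd (qscale i T1) (qscale j T2).
pose B := qadd (qscale i B1) (qscale j B2).
pose C := qadd (qscale i C1) (qscale j C2).
have eB : qscale (ca c) B = qmul t n A (cb c, 1).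
  have -> : qscale (ca c) B = qadd (qscale i (qscale (ca c) B1)) (qscale j (qscale (ca c) B2)).
    by rewrite /B; qring.
  by rewrite eB1 eB2 /A; qring.
have eC : qscale (ca c) C = qmul t n B (cb c, 1).
  have -> : qscale (ca c) C = qadd (qscale i (qscale (ca c) C1)) (qscale j (qscale (ca c) C2)).
    by rewrite /C; qring.
  by rewrite eC1 eC2 /B; qring.
pose g : mat2 Z := ((qsub (1, 0) B, qsub (0, 0) C), (A, qadd (1, 0) B)).
have g1 : mdet t n g = (1, 0).
  have scaleI x y : qscale (ca c) x = qscale (ca c) y -> x = y.
    by case: x y => x1 x2 [y1 y2]; rewrite /qscale /= => -[/(mulfI a00) -> /(mulfI a00) ->].
  apply: (scaleI _ _).
  (* Both products in the bracket equal [A B (b + w)], hence cancel. *)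
  have -> : qscale (ca c) (mdet t n g) = qadd (ca c, 0)
      (qsub (qmul t n A (qscale (ca c) C)) (qmul t n (qscale (ca c) B) B)).
    by rewrite /g; qring.
  by rewrite eC eB; qring.
exists g => //.
have zmE : zmR g = ((qsub (1, 0) (zqR B), qsub (0, 0) (zqR C)), (zqR A, qadd (1, 0) (zqR B))).
  by rewrite /zm /zv /g /= !zq_sub zq_add zq10 [zqR (0, 0)]/zq /= rmorph0.
have zbe : zqR (cb c, 1) = (z (cb c), 1) by rewrite /zq /= rmorph1.
have eBR : qscale (z (ca c)) (zqR B) = qmul tR nR (zqR A) (z (cb c), 1).
  by rewrite -zq_scale eB zq_mul zbe.
have eCR : qscale (z (ca c)) (zqR C) = qmul tR nR (zqR B) (z (cb c), 1).
  by rewrite -zq_scale eC zq_mul zbe.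
have [Ha' fE] := foot_translate (b := z (cb c)) a0R Ha eBR eCR.
rewrite zmE; split; first exact: Ha'.
rewrite {}fE -phiE.
have -> : qsub phi (qscale (z (ca c))^-1 (zqR A)) =
   qscale (z (ca c))^-1 (qadd (qscale (s - z i) (zqR T1)) (qscale (r - z j) (zqR T2))).
  have T12 : z T1.2 = 0 by rewrite (eqP t12) rmorph0.
  rewrite /A zq_add !zq_scale; apply: pair_eq; rewrite /qsub /qadd /qscale /zq /= /s /r ?T12; field; rewrite ?t11R ?t22R ?a0R //.
exact: domain_in_tri.
Qed.

Lemma det_ge_or_listed H : above_norm H ->
  (exists2 v0, v0 != ((0, 0), (0, 0)) & hev tR nR H (zvR v0) = z (cnorm t n v0)) ->
  z dd * hdt tR nR H <= z dn ->
  z dd * hdt tR nR H = z dn /\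
  exists F g, [/\ List.In F fs, mdet t n g = (1, 0) & H = hpull tR nR (formRR F) (zmR g)].
Proof.
move=> Hg [v0 v00 Hv0] Hd.
have [c inc [g1 dg1 Ha1]] := move_to_cusp v00 Hv0.
have [g2 dg2 [Ha [T Tc Tin]]] := foot_to_domain inc Ha1.
set H1 := hpull tR nR H (zmR g1) in Ha1 Ha Tin *.
set H2 := hpull tR nR H1 (zmR g2) in Ha Tin *.
have good2 : above_norm H2 by do 2!apply: above_norm_hpull => //.
have d2 : hdt tR nR H2 = hdt tR nR H by rewrite !hdt_hpull1.
have [a0 ab] := cusp_dvd inc.
have a0R : 0 < z (ca c) by rewrite zr_gt0.
have := cusp_okP inc; rewrite /cusp_ok.
case/andP=> _ /andP[_ /andP[_ /and5P[tr1 tr2 t11 t12 /and4P[t22 tok dn0 cov]]]].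
have [phi phiE] : exists phi, phi = foot tR nR (z (ca c)) (z (cb c)) H2 by eexists.
rewrite -phiE in Tin.
have ts0 (v : pt) : v \in [seq p.1 | p <- ctight c] -> 0 < v.2.
  move/mapP=> [p pc ->]; move/allP: tok => /(_ _ pc); rewrite /tight_ok.
  by case/and5P=> _ _ _ ? _.
have fs0 : [seq dist_quad t n dn dd (ca c) (cb c) w | w <- cdiscs c] != [::].
  by case: (cdiscs c) dn0.
have Ts0 T' : T' \in domain c -> pos_tri T'.
  by rewrite !inE => /orP[]/eqP ->.
have [f fin [f0 [fle feq]]] := cover_sound disc_gt0 ts0 fs0 Ts0 cov Tc Tin.
case/mapP: fin => w wc ef; rewrite ef in f0 fle feq.
pose y := qsub (qscale (ca c) w.2) (qmul t n (cb c, 1) w.1).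
have y0 : 0 < qnorm t n y.
  by move: f0; rewrite /dist_quad /= pmulr_rgt0.
have y0R : 0 < z (qnorm t n y) by rewrite zr_gt0.
have w0 : w != ((0, 0), (0, 0)).
  apply: contraTneq y0 => e; rewrite /y e.
  have -> : qsub (qscale (ca c) (0, 0)) (qmul t n (cb c, 1) (0, 0)) = (0, 0) by qring.
  by rewrite /qnorm /= !mulr0 !addr0 ltxx.
have Hw := good2 _ w0.
have := hev_chart (lt0r_neq0 a0R) (zvR w) Ha.
rewrite -phiE d2 => chart.
move: fle feq; rewrite qev_dist_quad; cbv zeta; rewrite -/y -z_norm.
have yE : zqR y = qsub (qscale (z (ca c)) (zvR w).2) (qmul tR nR (z (cb c), 1) (zvR w).1).
  by rewrite /y zq_sub zq_scale zq_mul [zqR (cb c, 1)]/zq /= rmorph1.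
rewrite -yE in chart; rewrite -z_norm in chart *.
have -> : qnorm tR nR (qsub (zqR w.1) (qmul tR nR phi (zqR y)))
  = z (ca c) * hev tR nR H2 (zvR w) - hdt tR nR H * z (qnorm t n y).
  by rewrite chart addrK.
have dd0R : 0 < z dd by rewrite zr_gt0.
set h := hev _ _ H2 _ in Hw *; set N := z (cnorm t n w) in Hw *.
set q := z (qnorm t n y) in y0R *; set d := hdt _ _ H in Hd *.
(* The excess of the value over the norm plus the defect of the determinant, both nonnegative. *)
have -> : z dd * (z (ca c) * h - d * q - z (ca c) * N) + z dn * q =
  z dd * (z (ca c) * (h - N)) + (z dn - z dd * d) * q by ring.
have h1 : 0 <= z dd * (z (ca c) * (h - N)).
  by rewrite mulr_ge0 ?(ltW dd0R) // mulr_ge0 ?(ltW a0R) // subr_ge0.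
have h2 : 0 <= (z dn - z dd * d) * q by rewrite mulr_ge0 ?(ltW y0R) // subr_ge0.
move=> fle feq.
have h3 : (z dn - z dd * d) * q = 0 by lra.
have dE : z dd * d = z dn.
  by move/eqP: h3; rewrite mulf_eq0 (gt_eqF y0R) orbF subr_eq0 => /eqP.
split=> //.
have [] := feq; first by lra.
move=> v /mapP[[v' [k gk]] kc ->] /= [v1 v2].
move/allP: tok => /(_ _ kc); rewrite /tight_ok /=.
case/and5P=> kfs /eqP dgk /eqP hgk vp0 /andP[/eqP e1 /eqP e2].
have inF : List.In (nth form0 fs k) fs.
  by elim: (fs) k kfs {kc e1 e2 hgk} => // F fs' IH [|k] /= ?; [left|right; apply: IH].
set F := nth form0 fs k in hgk e1 e2 inF *.
have [m0 _ _ _ _] := form_okP inF.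
have m0R : z (fden F) != 0 by rewrite gt_eqF // zr_gt0.
have vcE : vcR (ca c) (cb c) = zvR ((ca c, 0), (cb c, 1)).
  by rewrite /zv /zq /= rmorph0 rmorph1.
have HK : hev tR nR (hpull tR nR (formRR F) (zmR gk)) (vcR (ca c) (cb c)) = z (ca c).
  rewrite vcE hev_hpull -zv_mapp hev_formR -z_hev -hev_hpull hgk rmorphM mulrC mulfK //.
have a00R : z (ca c) != 0 by rewrite gt_eqF.
have dK : hdt tR nR H2 = hdt tR nR (hpull tR nR (formRR F) (zmR gk)).
  rewrite d2 hdt_hpull1 //; apply: (mulfI (lt0r_neq0 dd0R)).
  by rewrite formR_hdt.
have vp0R : z v'.2 != 0 by rewrite gt_eqF // zr_gt0.
have fK : phi = foot tR nR (z (ca c)) (z (cb c)) (hpull tR nR (formRR F) (zmR gk)).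
  set P := hpull t n (fherm F) gk in e1 e2.
  have PE : hpull tR nR (formRR F) (zmR gk) =
      ((z (fden F))^-1 * z P.1.1, qscale (z (fden F))^-1 (zqR P.1.2), (z (fden F))^-1 * z P.2).
    have hpz : zhR P = hpull tR nR (zhR (fherm F)) (zmR gk).
      have crossz u v3 : zqR (hcross t n (fherm F) u v3) = hcross tR nR (zhR (fherm F)) (zvR u) (zvR v3).
        by rewrite /hcross !zq_add !zq_scale !zq_mul !zq_conj.
      by rewrite /P /zh /hpull /= !z_hev crossz.
    have -> : hpull tR nR (formRR F) (zmR gk) = ((z (fden F))^-1 * (zhR P).1.1,
       qscale (z (fden F))^-1 (zhR P).1.2, (z (fden F))^-1 * (zhR P).2).
      rewrite hpz /hpull /= !hev_formR; congr pair; congr pair.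
      have -> : formRR F = ((z (fden F))^-1 * (zhR (fherm F)).1.1,
        qscale (z (fden F))^-1 (zhR (fherm F)).1.2, (z (fden F))^-1 * (zhR (fherm F)).2) by [].
      move: (zhR (fherm F)) (zmR gk) => [[? [? ?]] ?] [[[? ?] [? ?]] [[? ?] [? ?]]].
      by qring.
    by [].
  have cE K : hcross tR nR K (vcR (ca c) (cb c)) ((0, 0), (1, 0))
     = qadd (qscale (z (ca c)) K.1.2) (qscale K.2 (qconj tR (z (cb c), 1))).
    by qring.
  pose B := qadd (qscale (ca c) P.1.2) (qscale P.2 (qconj t (cb c, 1))).
  have BE : zqR B = qadd (qscale (z (ca c)) (zqR P.1.2))
      (qscale (z P.2) (qconj tR (z (cb c), 1))).
    by rewrite zq_add !zq_scale zq_conj [zqR (cb c, 1)]/zq /= rmorph1.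
  have e1R : z v'.1.1 * (z (ca c) * z (fden F)) = - (z v'.2 * (zqR B).1).
    by rewrite -[(zqR B).1]/(z B.1) -!rmorphM -rmorphN; congr zr; exact: e1.
  have e2R : z v'.1.2 * (z (ca c) * z (fden F)) = - (z v'.2 * (zqR B).2).
    by rewrite -[(zqR B).2]/(z B.2) -!rmorphM -rmorphN; congr zr; exact: e2.
  rewrite /foot cE PE.
  have am0 : z (ca c) * z (fden F) != 0 by rewrite mulf_neq0.
  apply: pair_eq; apply: (mulfI vp0R); [rewrite v1|rewrite v2]; apply: (mulIf am0);
    [rewrite e1R|rewrite e2R]; rewrite BE /qadd /qscale /=; field; rewrite a00R m0R //.
have E : H2 = hpull tR nR (formRR F) (zmR gk).
  by apply: (chart_unique a00R Ha HK dK); rewrite -phiE.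
(* After [gk], undo the translation [g2] into the parallelogram and the move [g1] to the cusp. *)
exists F, (mmul t n (mmul t n gk (madj g2)) (madj g1)); split=> //.
  by rewrite !mdet_mmul !mdet_adj dgk dg1 dg2; qring.
rewrite !zm_mmul !zm_adj -!hpull_mmul -E hpull_adj; last by rewrite -zq_mdet dg2 zq10.
by rewrite hpull_adj // -zq_mdet dg1 zq10.
Qed.
End Descent.

Local Open Scope complex_scope.

(** * Complex hermitian forms and the ring of integers *)

Section MatrixEntries.
Variable R : realType.

Lemma ord2P (P : 'I_2 -> Prop) : P ord0 -> P (lift ord0 ord0) -> forall i, P i.
Proof.
move=> P0 P1 i; case: (unliftP ord0 i) => [j ->|-> //].
by rewrite (ord1 j).
Qed.

Definition cvec (u v : R[i]) : 'cV[R[i]]_2 := \col_i (if i == ord0 then u else v).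
Definition mx22 (p q r s : R[i]) : 'M[R[i]]_2 :=
  \matrix_(i, j) (if i == ord0 then (if j == ord0 then p else q)
                  else (if j == ord0 then r else s)).

Lemma conjE (c : R[i]) : Num.conj c = c^*%C. Proof. by []. Qed.

Lemma mx22_form (p q r s p' q' r' s' : R[i]) a b c :
  (mx22 p q r s)^t*%sesqui *m hform a b c *m mx22 p' q' r' s' =
  mx22 (a%:C * (p^*%C * p') + c%:C * (r^*%C * r') + (p^*%C * b * r' + r^*%C * b^*%C * p'))
       (a%:C * (p^*%C * q') + c%:C * (r^*%C * s') + (p^*%C * b * s' + r^*%C * b^*%C * q'))
       (a%:C * (q^*%C * p') + c%:C * (s^*%C * r') + (q^*%C * b * r' + s^*%C * b^*%C * p'))
       (a%:C * (q^*%C * q') + c%:C * (s^*%C * s') + (q^*%C * b * s' + s^*%C * b^*%C * q')).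
Proof.
rewrite /mx22 /hform; apply/matrixP => i j.
rewrite !mxE !big_ord_recl !big_ord0 !mxE !big_ord_recl !big_ord0 !mxE !conjE !addr0.
have e : (lift ord0 (ord0 : 'I_1) == ord0) = false by [].
by elim/ord2P: i; elim/ord2P: j; rewrite ?e eqxx ?e; ring.
Qed.

Lemma hform_herm (a : R) (b : R[i]) (c : R) : (hform a b c)^t*%sesqui = hform a b c.
Proof.
apply/matrixP => i j; rewrite !mxE conjE.
by case: b => b1 b2; elim/ord2P: i; elim/ord2P: j => //=; rewrite ?oppr0 ?opprK.
Qed.

Lemma det22 (A : 'M[R[i]]_2) (l := lift ord0 (ord0 : 'I_1)) :
  \det A = A ord0 ord0 * A l l - A ord0 l * A l ord0.
Proof.
rewrite (expand_det_row _ ord0) !big_ord_recl big_ord0 /cofactor !det_mx11 !mxE addr0.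
have -> : lift l (0 : 'I_1) = ord0 by apply: val_inj.
by rewrite /= expr0 expr1 mul1r mulN1r mulrN.
Qed.

Lemma hval_cvec u v a b c : hval (hform a b c) (cvec u v) =
  complex.Re (a%:C * (u^*%C * u) + c%:C * (v^*%C * v) + (u^*%C * b * v + v^*%C * b^*%C * u)).
Proof.
rewrite /hval /hform /cvec; congr complex.Re.
rewrite !mxE !big_ord_recl !big_ord0 !mxE !big_ord_recl !big_ord0 !mxE !conjE !addr0.
have e : (lift ord0 (ord0 : 'I_1) == ord0) = false by [].
by rewrite ?e eqxx ?e; ring.
Qed.
End MatrixEntries.

Section Iota.
Variables (R : realType) (t n : Z).
Hypothesis disc_gt0 : 0 < disc4 t n.
Local Notation z := (zr R).
Local Notation tR := (z t).
Local Notation nR := (z n).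
Implicit Types (x y : R * R).

(** The imaginary part of [w], taken as the root of $X^2 - tX + n$ in the upper half-plane; its real
    part is $t/2$. *)
Definition im_omega : R := Num.sqrt (z (disc4 t n)) / 2%:R.
Definition iota_C x : R[i] := (x.1 + x.2 * tR / 2%:R) +i* (x.2 * im_omega).

Lemma im_omega_gt0 : 0 < im_omega.
Proof. by rewrite divr_gt0 ?sqrtr_gt0 ?zr_gt0. Qed.

Lemma im_omega_sqr : im_omega * im_omega = nR - tR * tR / 4%:R.
Proof.
have h : Num.sqrt (z (disc4 t n)) ^+ 2 = 4%:R * nR - tR * tR.
  by rewrite sqr_sqrtr ?zr_ge0 ?ltW // /disc4 rmorphB !rmorphM rmorph_nat.
have -> : im_omega * im_omega = Num.sqrt (z (disc4 t n)) ^+ 2 / 4%:R.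
  by rewrite /im_omega; field.
by rewrite h; field.
Qed.

Lemma complex_eq (u v : R[i]) : complex.Re u = complex.Re v -> complex.Im u = complex.Im v -> u = v.
Proof. by case: u v => a b [c d] /= -> ->. Qed.

Lemma iotaD x y : iota_C (qadd x y) = iota_C x + iota_C y.
Proof. by apply: complex_eq => /=; ring. Qed.

Lemma iotaB x y : iota_C (qsub x y) = iota_C x - iota_C y.
Proof. by apply: complex_eq => /=; ring. Qed.

Lemma iotaM x y : iota_C (qmul tR nR x y) = iota_C x * iota_C y.
Proof.
apply: complex_eq => /=; last by field.
have -> : (x.1 + x.2 * tR / 2%:R) * (y.1 + y.2 * tR / 2%:R) - x.2 * im_omega * (y.2 * im_omega)
  = (x.1 + x.2 * tR / 2%:R) * (y.1 + y.2 * tR / 2%:R) - x.2 * y.2 * (im_omega * im_omega) by ring.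
by rewrite im_omega_sqr; field.
Qed.

Lemma iota_conj x : (iota_C x)^*%C = iota_C (qconj tR x).
Proof. by apply: complex_eq => /=; field. Qed.

Lemma iota_inj : injective iota_C.
Proof.
move=> [x1 x2] [y1 y2]; rewrite /iota_C /= => -[h1 h2].
have e2 : x2 = y2 by apply: (mulIf (lt0r_neq0 im_omega_gt0)).
by move: h1; rewrite e2 => /addIr ->.
Qed.

Lemma iota_surj (c : R[i]) : exists x, c = iota_C x.
Proof.
have h := lt0r_neq0 im_omega_gt0.
case: c => a b; exists (a - b / im_omega * tR / 2%:R, b / im_omega).
by apply: complex_eq => /=; rewrite ?divfK // subrK.
Qed.

Lemma iota_real (c : R) : iota_C (c, 0) = c%:C.
Proof. by apply: complex_eq; rewrite /= ?mul0r ?addr0. Qed.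

Lemma Re_iota x : complex.Re (iota_C x) = qtr tR x / 2%:R.
Proof. by rewrite /qtr /=; field. Qed.

Definition vec (w : (R * R) * (R * R)) : 'cV[R[i]]_2 := cvec (iota_C w.1) (iota_C w.2).
Definition herm_mx (H : herm R) : 'M[R[i]]_2 := hform H.1.1 (iota_C H.1.2) H.2.

Lemma hval_vec H w : hval (herm_mx H) (vec w) = hev tR nR H w.
Proof.
rewrite /herm_mx /vec hval_cvec !iota_conj -!iota_real -!iotaM -!iotaD Re_iota.
move: H w => [[h1 [h2 h3]] h4] [[w1 w2] [u1 u2]].
by qexp; field.
Qed.

Lemma hdet_herm_mx H : hdet (herm_mx H) = hdt tR nR H.
Proof.
rewrite /hdet det22 /herm_mx /hform !mxE.
have e : (lift ord0 (ord0 : 'I_1) == ord0) = false by [].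
rewrite ?e eqxx ?e -!iota_real iota_conj -!iotaM -iotaB Re_iota.
by move: H => [[h1 [h2 h3]] h4]; qexp; field.
Qed.

Definition iota_mx (g : mat2 R) : 'M[R[i]]_2 :=
  mx22 (iota_C g.1.1) (iota_C g.2.1) (iota_C g.1.2) (iota_C g.2.2).

Lemma iota_mx_pull H g : (iota_mx g)^t*%sesqui *m herm_mx H *m iota_mx g = herm_mx (hpull tR nR H g).
Proof.
rewrite /iota_mx mx22_form !iota_conj -!iota_real -!iotaM -!iotaD.
move: H g => [[h1 [h2 h3]] h4] [[[p1 p2] [q1 q2]] [[r1 r2] [s1 s2]]].
apply/matrixP => i j; rewrite /herm_mx /hform /mx22 !mxE -!iota_real iota_conj.
have e : (lift ord0 (ord0 : 'I_1) == ord0) = false by [].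
elim/ord2P: i; elim/ord2P: j; rewrite ?e ?eqxx ?e; cbv match beta;
  congr iota_C; qring.
Qed.

Lemma det_iota_mx g : \det (iota_mx g) = iota_C (mdet tR nR g).
Proof.
have e : (lift ord0 (ord0 : 'I_1) == ord0) = false by [].
rewrite /iota_mx /mx22 det22 !mxE ?e eqxx ?e -!iotaM -iotaB; congr iota_C.
Qed.

Lemma herm_mx_surj (S : 'M[R[i]]_2) : (S^t*%sesqui = S) -> exists H, S = herm_mx H.
Proof.
move=> hS; have [x ex] := iota_surj (S ord0 (lift ord0 ord0)).
have h00 := congr1 (fun M : 'M[R[i]]_2 => M ord0 ord0) hS.
have h11 := congr1 (fun M : 'M[R[i]]_2 => M (lift ord0 ord0) (lift ord0 ord0)) hS.
have h10 := congr1 (fun M : 'M[R[i]]_2 => M (lift ord0 ord0) ord0) hS.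
rewrite !mxE !conjE in h00 h11 h10.
have real (c : R[i]) : c^*%C = c -> c = (complex.Re c)%:C.
  case: c => a b [] h; apply: complex_eq => //=.
  by move/eqP: h; rewrite -subr_eq0 -opprD oppr_eq0 -mulr2n mulrn_eq0 /= => /eqP.
exists ((complex.Re (S ord0 ord0), x), complex.Re (S (lift ord0 ord0) (lift ord0 ord0))).
apply/matrixP => i j; rewrite !mxE; elim/ord2P: i; elim/ord2P: j => /=.
- exact: real.
- exact: ex.
- by rewrite -h10 ex.
- exact: real.
Qed.

Lemma vec_surj (v : 'cV[R[i]]_2) : exists w, v = vec w.
Proof.
have [x ex] := iota_surj (v ord0 0); have [y ey] := iota_surj (v (lift ord0 ord0) 0).
exists (x, y); apply/matrixP => i j; rewrite (ord1 j) !mxE.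
by elim/ord2P: i.
Qed.

Lemma vec_eq0 w : (vec w == 0) = (w == ((0, 0), (0, 0))).
Proof.
have i0 : iota_C (0, 0) = 0 by rewrite iota_real.
apply/eqP/eqP => [/matrixP h|->].
  have := h ord0 0; have := h (lift ord0 ord0) 0; rewrite !mxE /= -i0.
  by move=> /iota_inj h2 /iota_inj h1; rewrite (surjective_pairing w) h1 h2.
by apply/matrixP => i j; rewrite !mxE /= i0; case: ifP.
Qed.

Lemma herm_mx_posdef H : 0 < H.1.1 -> 0 < hdt tR nR H -> posdef (herm_mx H).
Proof.
move=> h0 d0; split; first exact: hform_herm.
move=> v; have [w ->] := vec_surj v; rewrite vec_eq0 hval_vec => w0.
have e : H.1.1 * hev tR nR H w =
  qnorm tR nR (qadd (qscale H.1.1 w.1) (qmul tR nR H.1.2 w.2)) + hdt tR nR H * qnorm tR nR w.2.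
  by move: H w {h0 d0 w0} => [[h1 [h2 h3]] h4] [[w1 w2] [u1 u2]]; qexp; ring.
suff : 0 < H.1.1 * hev tR nR H w by rewrite pmulr_rgt0.
have nn x := @qnorm_ge0 R t n disc_gt0 x.
rewrite e lt_def addr_ge0 ?nn ?mulr_ge0 ?nn ?(ltW d0) // andbT.
apply: contra w0; rewrite paddr_eq0 ?nn ?mulr_ge0 ?nn ?(ltW d0) // mulf_eq0 (gt_eqF d0) /=.
case/andP=> /eqP e1 /eqP/(qnorm_eq0 disc_gt0) w2; move: e1; rewrite w2.
have -> : qadd (qscale H.1.1 w.1) (qmul tR nR H.1.2 (0, 0)) = qscale H.1.1 w.1 by qring.
move/(qnorm_eq0 disc_gt0); rewrite /qscale => -[/eqP + /eqP].
rewrite !mulf_eq0 (gt_eqF h0) /= => /eqP h3 /eqP h4.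
by rewrite (surjective_pairing w) (surjective_pairing w.1) h3 h4 w2.
Qed.

Lemma posdef_herm_mx H : posdef (herm_mx H) -> 0 < hdt tR nR H.
Proof.
case=> _ pd; have pos w : w != ((0, 0), (0, 0)) -> 0 < hev tR nR H w.
  by move=> w0; rewrite -hval_vec; apply: pd; rewrite vec_eq0.
have h1 : 0 < H.1.1.
  have -> : H.1.1 = hev tR nR H ((1, 0), (0, 0)) by qexp; ring.
  by apply: pos; rewrite !xpair_eqE oner_eq0.
(* The form $[a, b, c]$ takes the value $a(ac - |b|^2)$ at $(-b, a)$. *)
pose w : (R * R) * (R * R) := (qscale (-1) H.1.2, (H.1.1, 0)).
have := pos w; have -> : hev tR nR H w = H.1.1 * hdt tR nR H.
  by rewrite /w; move: H {pos pd h1 w} => [[a [b c]] d]; qexp; ring.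
by rewrite pmulr_rgt0 //; apply; rewrite /w !xpair_eqE (gt_eqF h1) /= andbF.
Qed.
End Iota.

(** * The ring of integers and its discriminant *)

Section RingOfIntegers.
Variables (R : realType) (D : nat).
Hypothesis D_gt0 : (0 < D)%N.
Hypothesis D_sf : square_free D.
Local Notation z := (zr R).

(** Trace, and below norm, of the generator $w$ of the ring of integers: $(1+\sqrt{-D})/2$ if $D
    \equiv 3$ modulo 4, and $\sqrt{-D}$ otherwise. *)
Definition tD : Z := if (D %% 4 == 3)%N then 1 else 0.
Definition nD : Z := if (D %% 4 == 3)%N then Z.of_nat (D.+1 %/ 4) else Z.of_nat D.

Lemma disc4D : disc4 tD nD = if (D %% 4 == 3)%N then Z.of_nat D else 4%:R * Z.of_nat D.
Proof.
rewrite /disc4 /tD /nD; case: ifP => h; last by lia.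
by have := divn_eq D 4; lia.
Qed.

Lemma disc4D_gt0 : 0 < disc4 tD nD.
Proof. by rewrite disc4D; case: ifP; lia. Qed.

Local Notation iota := (@iota_C R tD nD).
Local Notation iotaZ x := (iota (zq R x)).
Local Notation integral c := (integralOver (intr : int -> R[i]) c).

Lemma zr_int (k : int) : z (Z_of_int k) = k%:~R.
Proof. by rewrite /zr /= Z_of_intK. Qed.

Lemma zr_nat (k : nat) : z (Z.of_nat k) = k%:R.
Proof. exact: (zr_int k). Qed.

Lemma sqrt_D : Num.sqrt (D%:R : R) = (if (D %% 4 == 3)%N then 2%:R else 1) * im_omega R tD nD.
Proof.
rewrite /im_omega disc4D; case: ifP => _.
  by rewrite zr_nat; field.
have -> : z (4%:R * Z.of_nat D) = 4%:R * D%:R.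
  by rewrite rmorphM rmorph_nat; congr (_ * _); exact: zr_nat.
rewrite sqrtrM ?ler0n //.
have -> : Num.sqrt (4%:R : R) = 2%:R.
  have -> : (4%:R : R) = 2%:R ^+ 2 by rewrite -natrX.
  by rewrite sqrtr_sqr ger0_norm ?ler0n.
by field.
Qed.

(** The monic integral polynomial of [q] can be read over [algC], where a rational algebraic integer
    is a rational integer. *)
Lemma ratr_int_C (q : rat) : integral (ratr q : R[i]) -> exists k : int, q = k%:~R.
Proof.
case=> p pm rp.
have ratr_intr (F : numFieldType) : map_poly (intr : int -> F) p = map_poly (ratr : rat -> F) (map_poly intr p).
  by rewrite -map_poly_comp; apply: eq_map_poly => i /=; rewrite ratr_int.
have rq : root (map_poly intr p : {poly rat}) q.
  by move: rp; rewrite ratr_intr fmorph_root.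
have rC : root (map_poly intr p : {poly algC}) (ratr q) by rewrite ratr_intr fmorph_root.
have A : (ratr q : algC) \in Aint.
  apply: root_monic_Aint rC _ _; first by rewrite monic_map.
  by apply/polyOverP => i; rewrite coef_map /=; exact: intr_int.
have /intrP[k hk] := Cint_rat_Aint (Crat_rat q) A.
exists k; apply: (fmorph_inj (ratr : {rmorphism rat -> algC})).
by rewrite /= hk ratr_int.
Qed.

Lemma integral_conj (c : R[i]) : integral c -> integral (c^*%C).
Proof.
case=> p pm rp; exists p => //.
have <- : map_poly (conjc : R[i] -> R[i]) (map_poly intr p) = map_poly intr p.
  by rewrite -map_poly_comp; apply: eq_map_poly => i /=; rewrite rmorph_int.
by rewrite fmorph_root.
Qed.

Lemma iotaZ_integral (x : zpt) : integral (iotaZ x).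
Proof.
have intZ (k : Z) : integral (iota (z k, 0)).
  by rewrite iota_real /zr /= rmorph_int; exact: integral_id.
have om : integral (iota (0, 1)).
  exists ('X^2 - (int_of_Z tD)%:P * 'X + (int_of_Z nD)%:P).
    apply/monicP; rewrite -addrA lead_coefDl ?lead_coefXn // size_polyXn.
    apply: leq_ltn_trans (size_polyD _ _) _; rewrite gtn_max size_polyN.
    rewrite (leq_ltn_trans (size_polyC_leq1 _)) // andbT.
    rewrite mul_polyC; apply: leq_ltn_trans (size_scale_leq _ _) _.
    by rewrite size_polyX.
  rewrite rmorphD rmorphB !rmorphM /= !map_polyX !map_polyC /=.
  rewrite /root !hornerE.
  have e (k : Z) : (int_of_Z k)%:~R = iota (z k, 0) :> R[i] by rewrite iota_real /zr /= rmorph_int.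
  rewrite !e -!iotaM ?disc4D_gt0 // -iotaB -iotaD.
  have -> : (0 : R[i]) = iota (0, 0) by rewrite iota_real.
  by apply/eqP; congr iota_C; qring.
have -> : iotaZ x = iota (z x.1, 0) + iota (z x.2, 0) * iota (0, 1).
  by rewrite -iotaM ?disc4D_gt0 // -iotaD; congr iota_C; rewrite /zq; qring.
by apply: integral_add => //; apply: integral_mul.
Qed.

Lemma OK_iotaZ (x : zpt) : OK D (iotaZ x).
Proof.
split; last exact: iotaZ_integral.
pose e : rat := if (D %% 4 == 3)%N then 1 / 2%:R else 1.
exists ((int_of_Z x.1)%:~R + (int_of_Z x.2)%:~R * (int_of_Z tD)%:~R / 2%:R), ((int_of_Z x.2)%:~R * e).
have ratrC (q : rat) : (ratr q : R[i]) = (ratr q)%:C.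
  exact/esym/(fmorph_eq_rat (real_complex R \o (ratr : rat -> R))).
rewrite !ratrC sqrt_D; apply: complex_eq => /=.
  rewrite rmorphD !rmorphM fmorphV /= !ratr_int ratr_nat /zr /=.
  by field.
have er : ratr e * (if (D %% 4 == 3)%N then 2%:R else 1) = 1 :> R.
  rewrite /e; case: ifP => _; last by rewrite rmorph1 mulr1.
  by rewrite rmorphM fmorphV /= ratr_nat rmorph1; field.
rewrite rmorphM /= ratr_int /zr /= -[LHS]mulr1 -[X in _ * X = _]er.
by move: (ratr e) (if _ then _ else _) => E F; ring.
Qed.

(** In lowest terms the square of the denominator is prime to that of the numerator, so it divides
    [D]. *)
Lemma square_free_rat (b : rat) (m : int) : D%:R * b ^+ 2 = m%:~R -> exists l : int, b = l%:~R.
Proof.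
move=> h; suff d1 : denq b = 1 by exists (numq b); rewrite -[LHS]divq_num_den d1 divr1.
have db0 : ((denq b)%:~R : rat) != 0 by rewrite intr_eq0 denq_neq0.
have h2 : (D%:Z * numq b ^+ 2 = m * denq b ^+ 2)%R.
  apply: (@intr_inj rat); rewrite !rmorphM /= -h.
  have e : b * (denq b)%:~R = (numq b)%:~R by rewrite -{1}(divq_num_den b) divfK.
  by rewrite -e; ring.
have h3 : (`|denq b| ^ 2 %| D)%N.
  have co : coprime (`|denq b| ^ 2) (`|numq b| ^ 2).
    by rewrite coprime_pexpl // coprime_pexpr // coprime_sym coprime_num_den.
  rewrite -(Gauss_dvdl _ co).
  have -> : (D * `|numq b| ^ 2 = `|m| * `|denq b| ^ 2)%N.
    by have /(congr1 absz) := h2; rewrite !abszM /= -!mulnn.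
  exact: dvdn_mull.
have := D_sf h3; have := denq_gt0 b; case: (denq b) => // k _ /= ->.
by [].
Qed.

(** Squares modulo 4: for $D \equiv 1, 2$ both [k] and [l] are even, for $D \equiv 3$ they have the
    same parity, and $D \equiv 0$ is excluded by square-freeness. *)
Lemma half_integer_coords (k l m : Z) : k * k + Z.of_nat D * (l * l) = 4%:R * m ->
  exists x : zpt, 2%:R * x.1 + x.2 * tD = k /\
    x.2 * (if (D %% 4 == 3)%N then 1 else 2%:R) = l.
Proof.
rewrite /tD => h; have Dq := divn_eq D 4; set q := (D %/ 4)%N in Dq.
have r4 := ltn_pmod D (isT : (0 < 4)%N).
have r0 : (D %% 4)%N != 0%N.
  apply/eqP => r0; have : (2 ^ 2 %| D)%N by rewrite Dq r0 addn0 dvdn_mull.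
  by move/D_sf.
set r := (D %% 4)%N in Dq r4 r0 *.
have DZ : Z.of_nat D = 4%:R * Z.of_nat q + Z.of_nat r by lia.
have parity (u : Z) : exists v e : Z, u = 2%:R * v + e /\ (e = 0 \/ e = 1).
  exists (Z.div u 2%:R), (Z.modulo u 2%:R); have := Z.div_mod u 2%:R ltac:(lia).
  by have := Z.mod_pos_bound u 2%:R ltac:(lia); lia.
have [k' [e [kE e01]]] := parity k; have [l' [f [lE f01]]] := parity l.
have [X mod4] : exists X : Z, e * e + Z.of_nat r * (f * f) = 4%:R * X.
  exists (m - (k' * k' + k' * e + Z.of_nat q * (l * l) + Z.of_nat r * (l' * l' + l' * f))).
  by rewrite mulrBr -h DZ kE lE; ring.
have [r1|r3] : ((r == 1)%N || (r == 2)%N) \/ r = 3%N by lia.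
  have -> : (r == 3)%N = false by lia.
  have rE : Z.of_nat r = 1 \/ Z.of_nat r = 2%:R by lia.
  have [e0 f0] : e = 0 /\ f = 0.
    by case: e01 f01 rE => e0 [] f0 [] W; move: mod4; rewrite e0 f0 W; lia.
  by exists (k', l'); rewrite /= mulr0 addr0 kE lE e0 f0 !addr0; split=> //; ring.
rewrite r3 eqxx; have ef : e = f.
  by move: mod4; rewrite r3; case: e01 f01 => e0 [] f0; rewrite e0 f0; lia.
exists (k' - l', l); rewrite /= mulr1 kE lE ef; split=> //; ring.
Qed.

(** The trace $2a$ and the norm $a^2 + Db^2$ are rational and integral, hence integers. Then
    $D(2b)^2$ is an integer, and so is $2b$ because $D$ is square-free. *)
Lemma OK_coords (c : R[i]) : OK D c -> exists x : zpt, c = iotaZ x.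
Proof.
case=> -[a [b ce]] cint.
have ratrC (q : rat) : (ratr q : R[i]) = (ratr q)%:C.
  exact/esym/(fmorph_eq_rat (real_complex R \o (ratr : rat -> R))).
have ratr2 (q : rat) : ratr (2%:R * q) = 2%:R * ratr q :> R.
  by rewrite -[2%:R in RHS](ratr_nat R 2) -rmorphM.
have ccint := integral_conj cint.
have Rec : complex.Re c = ratr a by rewrite ce !ratrC /=; ring.
have Imc : complex.Im c = ratr b * Num.sqrt D%:R by rewrite ce !ratrC /=; ring.
have sqrtD2 : Num.sqrt (D%:R : R) * Num.sqrt D%:R = D%:R.
  by rewrite -expr2 sqr_sqrtr ?ler0n.
have [k hk] : exists k : int, 2%:R * a = k%:~R.
  apply: ratr_int_C; have -> : ratr (2%:R * a) = c + c^*%C.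
    rewrite ratrC ratr2 -Rec; apply: complex_eq; case: (c) => ? ? /=; ring.
  exact: integral_add.
have [m hm] : exists m : int, a ^+ 2 + D%:R * b ^+ 2 = m%:~R.
  apply: ratr_int_C; have -> : ratr (a ^+ 2 + D%:R * b ^+ 2) = c * c^*%C.
    have -> : ratr (a ^+ 2 + D%:R * b ^+ 2) = (complex.Re c ^+ 2 + complex.Im c ^+ 2)%:C :> R[i].
      rewrite ratrC; congr (_ %:C); rewrite Rec Imc.
      have -> : ratr (a ^+ 2 + D%:R * b ^+ 2) = ratr a ^+ 2 + D%:R * ratr b ^+ 2 :> R.
        by rewrite -(ratr_nat R D) -!rmorphXn -rmorphM -rmorphD.
      by move: sqrtD2; set S := Num.sqrt _ => <-; ring.
    by apply: complex_eq; case: (c) => ? ? /=; ring.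
  exact: integral_mul.
have [l hl] : exists l : int, 2%:R * b = l%:~R.
  apply: (@square_free_rat _ (4%:R * m - k * k)).
  by rewrite rmorphB !rmorphM rmorph_nat /= -hk -hm; ring.
have [x [x1 x2]] : exists x : zpt, 2%:R * x.1 + x.2 * tD = Z_of_int k /\
    x.2 * (if (D %% 4 == 3)%N then 1 else 2%:R) = Z_of_int l.
  apply: (@half_integer_coords _ _ (Z_of_int m)).
  apply: (can_inj int_of_ZK); apply: (@intr_inj rat).
  have hD : (int_of_Z (Z.of_nat D))%:~R = D%:R :> rat by rewrite (Z_of_intK D%:Z).
  rewrite !(rmorphD, rmorphM, rmorph_nat) /= !Z_of_intK -hk -hl -hm hD.
  by ring.
exists x; apply: complex_eq.
  rewrite Rec /=.
  have e : z 2%:R * z x.1 + z x.2 * z tD = 2%:R * ratr a.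
    by rewrite -!rmorphM -rmorphD x1 [LHS]zr_int -(ratr_int R) -hk ratr2.
  rewrite rmorph_nat in e; apply: (mulfI (_ : 2%:R != 0)); first by rewrite pnatr_eq0.
  by rewrite -e; field.
rewrite Imc sqrt_D mulrA /=; congr (_ * _).
have e : z x.2 * (if (D %% 4 == 3)%N then 1 else 2%:R) = 2%:R * ratr b.
  have -> : 2%:R * ratr b = z (Z_of_int l) by rewrite zr_int -(ratr_int R) -hl ratr2.
  by rewrite -x2 rmorphM; case: ifP; rewrite ?rmorph1 ?rmorph_nat.
apply: (mulfI (_ : 2%:R != 0)); first by rewrite pnatr_eq0.
by rewrite mulrA -e; case: ifP => _; ring.
Qed.

(** [disc] selects an integer coming from some integral basis, so besides the value on the basis 1,
    w its independence of the basis is needed. *)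
Lemma disc_eq : disc R D = - int_of_Z (disc4 tD nD).
Proof.
have d0 := disc4D_gt0.
have diffE (x y : R * R) : iota x * (iota y)^*%C - iota y * (iota x)^*%C =
    (x.2 * y.1 - x.1 * y.2)%:C * (0 +i* (2%:R * im_omega R tD nD)).
  by apply: complex_eq => /=; ring.
have sq : (0 +i* (2%:R * im_omega R tD nD) : R[i]) ^+ 2 = (- z (disc4 tD nD))%:C.
  rewrite expr2; apply: complex_eq => /=; last by ring.
  have -> : 0 * 0 - 2%:R * im_omega R tD nD * (2%:R * im_omega R tD nD)
     = - (4%:R * (im_omega R tD nD * im_omega R tD nD)) by ring.
  by rewrite im_omega_sqr // /disc4 rmorphB !rmorphM rmorph_nat; field.
have zC (k : Z) : (int_of_Z k)%:~R = (z k)%:C :> R[i] by rewrite /zr /= rmorph_int.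
have zCN (k : Z) : (- int_of_Z k)%:~R = (- z k)%:C :> R[i].
  by rewrite mulrNz zC; apply: complex_eq; rewrite /= ?oppr0.
have mulzE (c : R[i]) (k : int) : c *~ k = iota (zq R (Z_of_int k, 0)) * c.
  by rewrite -mulrzl /zq rmorph0 iota_real -zC Z_of_intK.
have val (w1 w2 : R[i]) (d : int) : integral_basis D w1 w2 ->
    d%:~R = (w1 * w2^*%C - w2 * w1^*%C) ^+ 2 -> d = - int_of_Z (disc4 tD nD).
  move=> [indep gen] dE.
  have O1 : OK D w1 by rewrite gen; exists 1, 0; rewrite mulr1z mulr0z addr0.
  have O2 : OK D w2 by rewrite gen; exists 0, 1; rewrite mulr1z mulr0z add0r.
  have [x1 e1] := OK_coords O1; have [x2 e2] := OK_coords O2.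
  have [m1 [n1 f1]] : exists m n : int, iotaZ (1, 0) = w1 *~ m + w2 *~ n.
    by have := OK_iotaZ (1, 0); rewrite gen.
  have [m2 [n2 f2]] : exists m n : int, iotaZ (0, 1) = w1 *~ m + w2 *~ n.
    by have := OK_iotaZ (0, 1); rewrite gen.
  have coords m n' (y : zpt) : iotaZ y = w1 *~ m + w2 *~ n' ->
      y.1 = Z_of_int m * x1.1 + Z_of_int n' * x2.1 /\ y.2 = Z_of_int m * x1.2 + Z_of_int n' * x2.2.
    rewrite e1 e2 !mulzE -!iotaM // -iotaD => /(iota_inj d0) h.
    have h1 := congr1 fst h; have h2 := congr1 snd h.
    split; apply: (@zr_inj R); rewrite rmorphD !rmorphM; [move: h1|move: h2];
      rewrite /zq /qadd /qmul /= rmorph0 => ->; ring.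
  have [a1 a2] := coords _ _ _ f1; have [b1 b2] := coords _ _ _ f2.
  rewrite /= in a1 a2 b1 b2.
  (* Up to sign the determinant of the change of basis. Expressing 1 and w back in the basis [w1],
     [w2] inverts it, so its square is 1. *)
  pose k := x1.2 * x2.1 - x1.1 * x2.2.
  have kk : k * (Z_of_int m2 * Z_of_int n1 - Z_of_int m1 * Z_of_int n2) = 1.
    transitivity ((Z_of_int m1 * x1.1 + Z_of_int n1 * x2.1) * (Z_of_int m2 * x1.2 + Z_of_int n2 * x2.2)
     - (Z_of_int m1 * x1.2 + Z_of_int n1 * x2.2) * (Z_of_int m2 * x1.1 + Z_of_int n2 * x2.1)).
      by rewrite /k; ring.
    by rewrite -a1 -a2 -b1 -b2 mulr1 mul0r subr0.
  have k2 : k * k = 1.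
    have : k = 1 \/ k = -1 by apply: Z.eq_mul_1; exact: kk.
    by case=> ->.
  apply: (@intr_inj R[i]); rewrite dE e1 e2 diffE exprMn sq zCN.
  have -> : ((zq R x1).2 * (zq R x2).1 - (zq R x1).1 * (zq R x2).2)%:C ^+ 2 = 1 :> R[i].
    rewrite -rmorphXn -[1 in RHS](rmorph1 (real_complex R)); congr real_complex_def.
    by rewrite /zq /= -!rmorphM -rmorphB -/k expr2 -rmorphM k2 rmorph1.
  by rewrite mul1r.
have basis : integral_basis D (iotaZ (1, 0)) (iotaZ (0, 1)).
  have lin (m n' : int) : iotaZ (1, 0) *~ m + iotaZ (0, 1) *~ n' = iotaZ (Z_of_int m, Z_of_int n').
    rewrite !mulzE -!iotaM // -iotaD; congr iota_C.
    by rewrite /zq !(rmorph0, rmorph1); qring.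
  split=> [m n'|].
    have i0 : (0 : R[i]) = iota (zq R (0, 0)) by rewrite /zq rmorph0 iota_real.
    rewrite lin i0 => /(iota_inj d0); rewrite /zq => -[/zr_inj h1 /zr_inj h2].
    by split; apply: (can_inj Z_of_intK); rewrite ?h1 ?h2.
  apply/seteqP; split=> [c /OK_coords[x ->]|c [m [n' ->]]].
    by exists (int_of_Z x.1), (int_of_Z x.2); rewrite lin !int_of_ZK -surjective_pairing.
  by rewrite lin; exact: OK_iotaZ.
rewrite /disc; set A := [set d | _].
have Ad : A (- int_of_Z (disc4 tD nD)).
  exists (iotaZ (1, 0)), (iotaZ (0, 1)); split=> //.
  rewrite diffE exprMn sq zCN /zq /= !(rmorph0, rmorph1).
  have -> : (0 * 0 - 1 * 1 : R)%:C ^+ 2 = 1 :> R[i].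
    by rewrite expr2; apply: complex_eq => /=; ring.
  by rewrite mul1r.
have := xgetPex 0 (ex_intro A _ Ad); case=> w1 [w2 [wb wd]].
exact: val wb wd.
Qed.
End RingOfIntegers.

(** * The Hermite constant of a field *)

Section FieldTheorem.
Variables (R : realType) (D : nat).
Hypothesis D_gt0 : (0 < D)%N.
Hypothesis D_sf : square_free D.
Local Notation z := (zr R).
Local Notation t := (tD D).
Local Notation n := (nD D).
Local Notation tR := (z t).
Local Notation nR := (z n).
Local Notation iota := (@iota_C R t n).
Local Notation iotaZ x := (iota (zq R x)).
Local Notation vecZ w := (vec t n (zv R w)).
Implicit Types (w : zpt * zpt) (H : herm R).

Let disc_gt0 : 0 < disc4 t n := disc4D_gt0 D_gt0.

Lemma vecZ_OK w : OKvec D (vecZ w).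
Proof.
by move=> i; rewrite mxE; case: ifP => _; exact: OK_iotaZ.
Qed.

Lemma OKvecP (v : 'cV[R[i]]_2) : OKvec D v -> exists w, v = vecZ w.
Proof.
move=> h; have [x ex] := OK_coords D_gt0 D_sf (h ord0).
have [y ey] := OK_coords D_gt0 D_sf (h (lift ord0 ord0)).
exists (x, y); apply/matrixP => i j; rewrite (ord1 j) !mxE.
by elim/ord2P: i.
Qed.

Lemma vecZ_eq0 w : (vecZ w == 0) = (w == ((0, 0), (0, 0))).
Proof.
rewrite vec_eq0 //; case: w => [[a b] [c d]].
by rewrite /zv /zq !xpair_eqE !zr_eq0.
Qed.

Lemma ideal_genP w : ideal_gen D (vecZ w) = [set iotaZ x | x in in_ideal_gen t n w].
Proof.
apply/seteqP; split=> [c [a [b [Oa Ob ->]]]|_ [x [p [q ->]] <-]].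
  have [p ->] := OK_coords D_gt0 D_sf Oa; have [q ->] := OK_coords D_gt0 D_sf Ob.
  exists (qadd (qmul t n p w.1) (qmul t n q w.2)); first by exists p, q.
  rewrite !mxE /= -!iotaM // -iotaD; congr iota_C.
  by rewrite zq_add !zq_mul.
exists (iotaZ p), (iotaZ q); split; try exact: OK_iotaZ.
rewrite !mxE /= -!iotaM // -iotaD; congr iota_C.
by rewrite zq_add !zq_mul.
Qed.

(** The ideal is spanned over the integers by $ra$ and $rb + rw$, so its cosets are represented by
    $i + jw$ with $0 \le i < ra$ and $0 \le j < r$. A single number $i + ra\,j < r^2 a$ codes such a
    pair. *)
Lemma ideal_norm_eq w : w != ((0, 0), (0, 0)) ->
  ideal_norm D (ideal_gen D (vecZ w)) = Z.to_nat (cnorm t n w).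
Proof.
move=> w0; have [r [a [b [r0 a0 ab hI]]]] := ideal_hermite_normal_form disc_gt0 w0.
rewrite (cnorm_hermite_normal_form disc_gt0 r0 a0 ab hI).
pose ra := r * a; have ra0 : 0 < ra by rewrite mulr_gt0.
pose I := ideal_gen D (vecZ w).
have IZ (x : zpt) : I (iotaZ x) <-> exists s u : Z, x = (ra * s + r * b * u, r * u).
  rewrite /I ideal_genP; split.
    case=> y /hI[_ [s [u ->]] ->] /(iota_inj disc_gt0); rewrite /zq => -[/zr_inj h1 /zr_inj h2].
    exists s, u; rewrite (surjective_pairing x) -h1 -h2 /qscale /ra /=; congr pair; ring.
  move=> [s [u ->]]; exists (ra * s + r * b * u, r * u) => //; apply/hI.
  by exists (a * s + b * u, u); [exists s, u|rewrite /qscale /ra /=; congr pair; ring].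
have IB (x y : R[i]) : I x -> I y -> I (x - y).
  rewrite /I ideal_genP => -[x' [p [q ->]] <-] [y' [p' [q' ->]] <-].
  rewrite -iotaB -zq_sub; eexists; last reflexivity.
  by exists (qsub p p'), (qsub q q'); qring.
have I0 : I 0.
  by have := (IZ (0, 0)).2; rewrite /zq rmorph0 iota_real; apply; exists 0, 0; congr pair; ring.
pose C (x : R[i]) : set R[i] := [set y | OK D y /\ I (y - x)].
have CP (x y : R[i]) : OK D x -> C x = C y <-> I (x - y).
  move=> Ox; split=> [e|xy].
    have : C x x by split=> //; rewrite subrr.
    by rewrite e => -[].
  apply/seteqP; split=> u [Ou hu]; split=> //.
    have -> : u - y = (u - x) - (0 - (x - y)) by ring.
    by apply: (IB _ _) => //; exact: IB.
  have -> : u - x = (u - y) - (x - y) by ring.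
  exact: IB.
pose rep (k : nat) : zpt := (Z.modulo (Z.of_nat k) ra, Z.div (Z.of_nat k) ra).
set N := Z.to_nat (r * r * a).
have cosets : [set C x | x in OK D] = [set C (iotaZ (rep k)) | k in `I_N].
  apply/seteqP; split=> [_ [x Ox <-]|_ [k kN <-]]; last first.
    by exists (iotaZ (rep k)) => //; exact: OK_iotaZ.
  have [[p q] xE] := OK_coords D_gt0 D_sf Ox.
  pose u := Z.div q r; pose j := Z.modulo q r.
  pose s := Z.div (p - r * b * u) ra; pose i := Z.modulo (p - r * b * u) ra.
  have qE : q = r * u + j by have := Z.div_mod q r ltac:(lia).
  have pE : p - r * b * u = ra * s + i by have := Z.div_mod (p - r * b * u) ra ltac:(lia).
  have j0 := Z.mod_pos_bound q r ltac:(lia); rewrite -/j in j0.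
  have i0 := Z.mod_pos_bound (p - r * b * u) ra ltac:(lia); rewrite -/i in i0.
  have repE : rep (Z.to_nat (i + j * ra)) = (i, j).
    rewrite /rep Z2Nat.id; last by nia.
    congr pair; first by rewrite Z.mod_add; [exact: Z.mod_small|lia].
    by rewrite Z.div_add; [rewrite Z.div_small|lia].
  exists (Z.to_nat (i + j * ra)).
    by rewrite /= /N; apply/ssrnat.ltP/Z2Nat.inj_lt; rewrite /ra; nia.
  apply/esym/CP => //; rewrite repE xE -iotaB -zq_sub.
  by apply/IZ; exists s, u; rewrite /qsub /=; congr pair; lia.
have inj : {in `I_N &, injective (fun k => C (iotaZ (rep k)))}.
  move=> k k'; rewrite !inE /= => kN kN' /(CP _ _ (OK_iotaZ R D_gt0 _)).
  rewrite -iotaB -zq_sub => /IZ[s [u]]; rewrite /qsub /rep /= => -[h1 h2].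
  have e := Z.div_mod (Z.of_nat k) ra ltac:(lia).
  have e' := Z.div_mod (Z.of_nat k') ra ltac:(lia).
  have m := Z.mod_pos_bound (Z.of_nat k) ra ltac:(lia).
  have m' := Z.mod_pos_bound (Z.of_nat k') ra ltac:(lia).
  have div_bound (l : nat) : (l < N)%N -> Z.le 0 (Z.div (Z.of_nat l) ra) /\ Z.lt (Z.div (Z.of_nat l) ra) r.
    move=> lN; split; first by apply: Z.div_pos; lia.
    apply: Z.div_lt_upper_bound; first by lia.
    have : (0 <= r * r * a) by nia.
    by move: lN; rewrite /N /ra; lia.
  have d := div_bound _ kN; have d' := div_bound _ kN'.
  have u0 : u = 0 by nia.
  have s0 : s = 0 by rewrite u0 in h1; nia.
  by rewrite s0 u0 in h1 h2; nia.
rewrite /ideal_norm; apply: xget_unique => /= [|l].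
  by rewrite -/(C _) cosets; exact: inj_card_eq.
rewrite -/(C _) cosets => h; apply/card_eq_II.
by rewrite -(card_eql h); apply: inj_card_eq.
Qed.

Local Notation pvals S := [set hval S v / (ideal_norm D (ideal_gen D v))%:R
          | v in [set v : 'cV[R[i]]_2 | OKvec D v /\ v != 0]].

Lemma cnorm_zr w : (Z.to_nat (cnorm t n w))%:R = z (cnorm t n w).
Proof. by rewrite -zr_nat Z2Nat.id //; have := cnorm_ge0 disc_gt0 w; lia. Qed.

Lemma cnorm_zr_gt0 w : w != ((0, 0), (0, 0)) -> 0 < z (cnorm t n w).
Proof. by move=> w0; rewrite zr_gt0 cnorm_gt0. Qed.

Lemma pvalsP H x : pvals (herm_mx t n H) x <->
  exists2 w, w != ((0, 0), (0, 0)) & x = hev tR nR H (zv R w) / z (cnorm t n w).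
Proof.
split=> [[v [Ov v0] <-]|[w w0 ->]].
  have [w ew] := OKvecP Ov; exists w; first by rewrite -vecZ_eq0 -ew.
  by rewrite ew hval_vec // ideal_norm_eq ?cnorm_zr // -vecZ_eq0 -ew.
exists (vecZ w); first by split; [exact: vecZ_OK|rewrite vecZ_eq0].
by rewrite hval_vec // ideal_norm_eq // cnorm_zr.
Qed.

Lemma proj_min_eq H w : w != ((0, 0), (0, 0)) ->
  (forall w', w' != ((0, 0), (0, 0)) -> hev tR nR H (zv R w) / z (cnorm t n w) <=
     hev tR nR H (zv R w') / z (cnorm t n w')) ->
  proj_min D (herm_mx t n H) = hev tR nR H (zv R w) / z (cnorm t n w).
Proof.
move=> w0 wmin; rewrite /proj_min /minimum; apply: xget_unique.
  split; first by apply/pvalsP; exists w.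
  by move=> x /pvalsP[w' w'0 ->]; exact: wmin.
move=> x [xA xl]; apply/eqP; rewrite eq_le; apply/andP; split.
  by apply: xl; apply/pvalsP; exists w.
by case/pvalsP: xA => w' w'0 ->; exact: wmin.
Qed.

(** The first alternative is the default value of [minimum]; keeping it as a case spares a proof
    that every positive definite form attains its minimum. *)
Lemma proj_min_cases H : proj_min D (herm_mx t n H) = 0 \/
  exists2 w, w != ((0, 0), (0, 0)) &
   proj_min D (herm_mx t n H) = hev tR nR H (zv R w) / z (cnorm t n w) /\
   forall w', w' != ((0, 0), (0, 0)) -> proj_min D (herm_mx t n H) <=
     hev tR nR H (zv R w') / z (cnorm t n w').
Proof.
rewrite /proj_min /minimum; case: xgetP => [x _ [xA xl]|_]; last by left.
right; case/pvalsP: (xA) => w w0 xE; exists w => //; split=> // w' w'0.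
by apply: xl; apply/pvalsP; exists w'.
Qed.

Definition hscale (c : R) H : herm R := (c * H.1.1, qscale c H.1.2, c * H.2).

Lemma hev_hscale c H (w : (R * R) * (R * R)) : hev tR nR (hscale c H) w = c * hev tR nR H w.
Proof. by move: H w => [[h1 [h2 h3]] h4] [[w1 w2] [u1 u2]]; rewrite /hscale; qexp; ring. Qed.

Lemma hdt_hscale c H : hdt tR nR (hscale c H) = c ^+ 2 * hdt tR nR H.
Proof. by move: H => [[h1 [h2 h3]] h4]; rewrite /hscale; qexp; ring. Qed.

Lemma hpull_hscale c H g : hpull tR nR (hscale c H) g = hscale c (hpull tR nR H g).
Proof.
move: H g => [[h1 [h2 h3]] h4] [[[p1 p2] [q1 q2]] [[r1 r2] [s1 s2]]].
by rewrite /hscale /hpull; congr pair; [congr pair; [qexp; ring|qring]|qexp; ring].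
Qed.

Lemma hscaleK c H : c != 0 -> hscale c (hscale c^-1 H) = H.
Proof.
move=> c0; case: H => [[h1 [h2 h3]] h4]; rewrite /hscale /qscale /=.
by rewrite !mulVKf.
Qed.

Lemma iota_mxM (g h : mat2 R) :
  iota_mx t n g *m iota_mx t n h = iota_mx t n (mmul tR nR g h).
Proof.
have e : (lift ord0 (ord0 : 'I_1) == ord0) = false by [].
case: g h => [[[p1 p2] [q1 q2]] [[r1 r2] [s1 s2]]] [[[a1 a2] [b1 b2]] [[c1 c2] [d1 d2]]].
apply/matrixP => i j; rewrite /iota_mx /mx22 !mxE !big_ord_recl !big_ord0 !mxE addr0.
elim/ord2P: i; elim/ord2P: j; rewrite ?e ?eqxx ?e; cbv match beta;
  rewrite -!iotaM // -iotaD; congr iota_C; qring.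
Qed.

Lemma iota_mx1 : iota_mx t n ((((1, 0), (0, 0)), ((0, 0), (1, 0))) : mat2 R) = 1%:M.
Proof.
have e : (lift ord0 (ord0 : 'I_1) == ord0) = false by [].
apply/matrixP => i j; rewrite /iota_mx /mx22 !mxE /fst /snd !iota_real.
by elim/ord2P: i; elim/ord2P: j; rewrite ?e ?eqxx ?e ?(eq_sym ord0) ?e.
Qed.

(** The action uses the inverse matrix, so pulling back by [g] is acting by its inverse, the
    adjugate. *)
Lemma hact_pull H (g : mat2 Z) : mdet t n g = (1, 0) ->
  SL2OK D (iota_mx t n (zm R (madj g))) /\
  hact (iota_mx t n (zm R (madj g))) (herm_mx t n H) = herm_mx t n (hpull tR nR H (zm R g)).
Proof.
move=> g1; split.
  split=> [i j|]; last first.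
    by rewrite det_iota_mx // -zq_mdet mdet_adj g1 zq10 iota_real rmorph1.
  by rewrite mxE; do 2![case: ifP => _]; exact: OK_iotaZ.
have inv : iota_mx t n (zm R (madj g)) *m iota_mx t n (zm R g) = 1%:M.
  rewrite iota_mxM -zm_mmul.
  have -> : mmul t n (madj g) g = ((mdet t n g, (0, 0)), ((0, 0), mdet t n g)).
    by case: g {g1} => [[[p1 p2] [q1 q2]] [[r1 r2] [s1 s2]]];
       rewrite /mmul; congr pair; congr pair; qring.
  by rewrite g1 /zm /zv /zq /= !(rmorph0, rmorph1) iota_mx1.
rewrite /hact; have -> : invmx (iota_mx t n (zm R (madj g))) = iota_mx t n (zm R g).
  have [u _] := mulmx1_unit inv.
  by rewrite -[RHS](mulKmx u) inv mulmx1.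
exact: iota_mx_pull.
Qed.

Lemma mem_map_In (T : Type) (U : eqType) (f : T -> U) (s : seq T) x :
  x \in [seq f y | y <- s] <-> exists2 y, List.In y s & x = f y.
Proof.
elim: s => [|y s IH] /=; first by split=> // -[].
rewrite inE; split=> [/predU1P[->|/IH[u us ->]]|[u [<- ->|us xu]]].
- by exists y; [left|].
- by exists u; [right|].
- by rewrite eqxx.
- by apply/predU1P; right; apply/IH; exists u.
Qed.

(** * The bound, its attainment and the extreme forms of one field *)

Section Field.
Variables (dn dd : Z) (fs : seq form) (cs : seq cusp) (gam : R).
Hypothesis ok : field_ok t n dn dd fs cs.
Hypothesis fs_gt0 : (0 < size fs)%N.
Hypothesis gam_gt0 : 0 < gam.
Hypothesis gamE : gam ^+ 2 * z dn = z dd.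

Definition scaled_form (F : form) : 'M[R[i]]_2 := herm_mx t n (hscale gam (formR R F)).

Let dn_gt0 : 0 < z dn.
Proof. by rewrite zr_gt0; case: (field_okP ok) => _ _ _ []. Qed.
Let dd_gt0 : 0 < z dd.
Proof. by rewrite zr_gt0; case: (field_okP ok) => _ _ _ []. Qed.

Lemma scaled_hdt F : List.In F fs -> hdt tR nR (hscale gam (formR R F)) = 1.
Proof.
move=> inF; rewrite hdt_hscale; apply: (mulfI (lt0r_neq0 dd_gt0)).
by rewrite mulrCA (formR_hdt R ok inF) gamE mulr1.
Qed.

Lemma scaled_posdef F : List.In F fs -> posdef (scaled_form F).
Proof.
move=> inF; apply: herm_mx_posdef => //; last by rewrite scaled_hdt.
by rewrite mulr_gt0 // (formR_gt0 R ok).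
Qed.

Lemma scaled_fun F : List.In F fs -> proj_hermite_fun D (scaled_form F) = gam.
Proof.
move=> inF; rewrite /proj_hermite_fun hdet_herm_mx // scaled_hdt // sqrtr1 divr1.
have [_ _ _ w0 _] := form_okP ok inF.
have N0 := cnorm_zr_gt0 w0.
have e : hev tR nR (hscale gam (formR R F)) (zv R (fmin F)) / z (cnorm t n (fmin F)) = gam.
  by rewrite hev_hscale (formR_min R ok inF) mulfK // gt_eqF.
rewrite (proj_min_eq w0) e // => w' w'0; rewrite hev_hscale -mulrA ler_pMr //.
by rewrite ler_pdivlMr ?mul1r ?cnorm_zr_gt0 //; exact: (formR_ge R ok).
Qed.

Lemma normalized_cases H : 0 < hdt tR nR H -> proj_min D (herm_mx t n H) != 0 ->
  let m := proj_min D (herm_mx t n H) in let H' := hscale m^-1 H in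
  (forall w, w != ((0, 0), (0, 0)) -> 0 < hev tR nR H (zv R w)) ->
  [/\ 0 < m, above_norm t n H' &
   exists2 w, w != ((0, 0), (0, 0)) & hev tR nR H' (zv R w) = z (cnorm t n w)].
Proof.
move=> dH m0 m H' pos; rewrite -/m in m0.
have [pm0|[w w0 [mE ml]]] := proj_min_cases H; first by rewrite /m pm0 eqxx in m0.
rewrite -/m in mE ml.
have m_gt0 : 0 < m by rewrite mE divr_gt0 ?pos ?cnorm_zr_gt0.
split=> // [w' w'0|].
  rewrite hev_hscale mulrC ler_pdivlMr // mulrC -ler_pdivlMr ?cnorm_zr_gt0 //.
  exact: ml.
exists w => //; rewrite hev_hscale; apply: (mulfI m0); rewrite mulVKf //.
by rewrite mE divfK // gt_eqF // cnorm_zr_gt0.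
Qed.

Lemma fun_le T : posdef T -> proj_hermite_fun D T <= gam.
Proof.
move=> pT; have [H eH] := herm_mx_surj disc_gt0 pT.1; rewrite eH in pT *.
have dH := posdef_herm_mx disc_gt0 pT.
have pos w : w != ((0, 0), (0, 0)) -> 0 < hev tR nR H (zv R w).
  by move=> w0; rewrite -hval_vec //; apply: pT.2; rewrite vecZ_eq0.
rewrite /proj_hermite_fun hdet_herm_mx //; set m := proj_min D _.
have [m0|m0] := eqVneq m 0; first by rewrite m0 mul0r ltW.
have [m_gt0 gH att] := normalized_cases dH m0 pos.
rewrite -/m in m_gt0 gH att.
have s0 : 0 < Num.sqrt (hdt tR nR H) by rewrite sqrtr_gt0.
have gs0 : 0 <= gam * Num.sqrt (hdt tR nR H) by rewrite mulr_ge0 ?(ltW gam_gt0) ?(ltW s0).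
rewrite ler_pdivrMr // -(@ler_pXn2r _ 2) ?nnegrE ?(ltW m_gt0) //.
rewrite exprMn sqr_sqrtr ?(ltW dH) //.
(* The form divided by its minimum is covered by [det_ge_or_listed], which excludes a determinant
   strictly below [dn / dd]. *)
have key : z dn <= z dd * hdt tR nR (hscale m^-1 H).
  rewrite leNgt; apply/negP => lt.
  by have [e _] := det_ge_or_listed ok gH att (ltW lt); rewrite e ltxx in lt.
rewrite hdt_hscale exprVn in key.
have m2 : 0 < m ^+ 2 by rewrite exprn_gt0.
move: key; rewrite mulrCA mulrC ler_pdivlMr // -gamE => key.
by rewrite -(ler_pM2l dn_gt0); lra.
Qed.

Lemma scaled_extreme F : List.In F fs -> abs_proj_extreme D (scaled_form F) /\ hdet (scaled_form F) = 1.
Proof.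
move=> inF; split; last by rewrite hdet_herm_mx // scaled_hdt.
split; first exact: scaled_posdef.
by move=> T pT; rewrite scaled_fun //; exact: fun_le.
Qed.

Let F0 := head form0 fs.
Let F0in : List.In F0 fs.
Proof. by rewrite /F0; case: fs fs_gt0 => //= F ? _; left. Qed.

Lemma proj_hermite_eq : proj_hermite R D = gam.
Proof.
rewrite /proj_hermite /maximum; apply: xget_unique.
  split; first by exists (scaled_form F0); [exact: scaled_posdef|exact: scaled_fun].
  by move=> _ [T pT <-]; exact: fun_le.
move=> x [[T pT <-] ub]; apply/eqP; rewrite eq_le fun_le //=.
by apply: ub; exists (scaled_form F0); [exact: scaled_posdef|exact: scaled_fun].
Qed.

(** An extreme form of determinant 1 has minimum [gam], so its quotient by [gam] has determinant
    exactly [dn / dd]: the equality case of [det_ge_or_listed]. *)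
Lemma extreme_complete S : abs_proj_extreme D S -> hdet S = 1 ->
  exists F g, [/\ F \in [seq scaled_form F | F <- fs], SL2OK D g & S = hact g F].
Proof.
move=> [pS ext] dS; have [H eH] := herm_mx_surj disc_gt0 pS.1; rewrite eH in pS ext dS *.
rewrite hdet_herm_mx // in dS.
have pos w : w != ((0, 0), (0, 0)) -> 0 < hev tR nR H (zv R w).
  by move=> w0; rewrite -hval_vec //; apply: pS.2; rewrite vecZ_eq0.
have pm : proj_min D (herm_mx t n H) = gam.
  have fE : proj_hermite_fun D (herm_mx t n H) = gam.
    apply/eqP; rewrite eq_le fun_le //= -(scaled_fun F0in); apply: ext.
    exact: scaled_posdef.
  by move: fE; rewrite /proj_hermite_fun hdet_herm_mx // dS sqrtr1 divr1.
have dH : 0 < hdt tR nR H by rewrite dS.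
have pm0 : proj_min D (herm_mx t n H) != 0 by rewrite pm gt_eqF.
have [_ gH att] := normalized_cases dH pm0 pos; rewrite pm in gH att.
have hd : z dd * hdt tR nR (hscale gam^-1 H) <= z dn.
  by rewrite hdt_hscale dS mulr1 exprVn -gamE mulrAC mulfV ?mul1r // expf_neq0 // gt_eqF.
have [_ [F [g [inF g1 hE]]]] := det_ge_or_listed ok gH att hd.
exists (scaled_form F), (iota_mx t n (zm R (madj g))).
have [slg hg] := hact_pull (hscale gam (formR R F)) g1.
split=> //; first by apply/mem_map_In; exists F.
by rewrite hg hpull_hscale -hE hscaleK // gt_eqF.
Qed.
End Field.
End FieldTheorem.

(** * Certificates and the table *)

Section Certificates.
Local Open Scope Z_scope.

(** Each [Form] is a table entry divided by [gam], in the order of the table. The two integers given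
    to [field_ok] after trace and norm are numerator and denominator of [1 / gam^2]. *)
Definition forms3 : seq form := [::
  Form 3 (3, (-1, 2), 3) ((1, 0), (0, 0));
  Form 3 (3, (1, -2), 3) ((1, 0), (0, 0))].

Definition cusps3 : seq cusp := [::
  Cusp 1 0 (1, 0) (0, 1)
    [:: ((1, -2), (2, -2)); ((0, -1), (1, -2)); ((1, -1), (1, -1)); ((0, 0), (0, -1))]
    [:: ((1, 1, 3), (0%N, (((-1, -1), (1, -1)), ((1, 0), (-1, 1)))));
        ((2, 2, 3), (1%N, (((1, 0), (2, -2)), ((-1, 0), (-1, 2)))))]].

Lemma field_ok3 : field_ok (tD 3) (nD 3) 2 3 forms3 cusps3.
Proof. by vm_compute. Qed.

Definition forms4 : seq form := [::
  Form 2 (2, (1, 1), 2) ((1, 0), (0, 0));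
  Form 2 (2, (-1, -1), 2) ((1, 0), (0, 0))].

(** The two forms differ by the translation by [1 + w], so one tight point serves both. *)
Definition cusps4 : seq cusp := [::
  Cusp 1 0 (1, 0) (0, 1)
    [:: ((0, -1), (1, -1)); ((1, -1), (1, 0)); ((0, 0), (0, -1)); ((1, 0), (0, 0))]
    [:: ((1, 1, 2), (0%N, (((-1, 0), (0, -1)), ((1, -1), (0, 1)))))]].

Lemma field_ok4 : field_ok (tD 1) (nD 1) 1 2 forms4 cusps4.
Proof. by vm_compute. Qed.

Definition forms7 : seq form := [::
  Form 7 (7, (-2, 4), 7) ((1, 0), (0, 0));
  Form 7 (7, (2, -4), 7) ((1, 0), (0, 0))].

Definition cusps7 : seq cusp := [::
  Cusp 1 0 (1, 0) (0, 1)
    [:: ((-1, -1), (1, -2)); ((0, -1), (1, -1)); ((-1, 0), (-1, -1)); ((0, 0), (-1, 0))]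
    [:: ((2, 3, 7), (0%N, (((-1, -1), (2, -1)), ((1, 0), (-1, 1)))));
        ((5, 4, 7), (1%N, (((-1, 1), (2, -1)), ((0, -1), (-1, 1)))))]].

Lemma field_ok7 : field_ok (tD 7) (nD 7) 3 7 forms7 cusps7.
Proof. by vm_compute. Qed.

Definition forms8 : seq form := [::
  Form 2 (2, (1, 1), 2) ((1, 0), (0, 0));
  Form 2 (2, (-1, -1), 2) ((1, 0), (0, 0))].

Definition cusps8 : seq cusp := [::
  Cusp 1 0 (1, 0) (0, 1)
    [:: ((-1, -1), (1, -1)); ((0, -1), (1, 0)); ((-1, 0), (-1, -1)); ((0, 0), (-1, 0))]
    [:: ((1, 1, 2), (0%N, (((-1, -1), (1, 0)), ((2, 0), (-1, 1)))))]].

Lemma field_ok8 : field_ok (tD 2) (nD 2) 1 4 forms8 cusps8.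
Proof. by vm_compute. Qed.

Definition forms11 : seq form := [::
  Form 11 (11, (-3, 6), 11) ((1, 0), (0, 0));
  Form 11 (11, (3, -6), 11) ((1, 0), (0, 0))].

Definition cusps11 : seq cusp := [::
  Cusp 1 0 (1, 0) (0, 1)
    [:: ((-1, -1), (2, -2)); ((0, -1), (2, -1)); ((-1, 0), (-1, -1)); ((0, 0), (-1, 0))]
    [:: ((3, 5, 11), (0%N, (((-2, -1), (2, -1)), ((2, 0), (-1, 1)))));
        ((8, 6, 11), (1%N, (((2, 2), (5, -2)), ((-3, 0), (-1, 2)))))]].

Lemma field_ok11 : field_ok (tD 11) (nD 11) 2 11 forms11 cusps11.
Proof. by vm_compute. Qed.

Definition forms15 : seq form := [::
  Form 3 (3, (-1, 2), 6) ((1, 0), (0, 0));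
  Form 3 (3, (1, -2), 6) ((1, 0), (0, 0))].

Definition cusps15 : seq cusp := [::
  Cusp 1 0 (1, 0) (0, 1)
    [:: ((-1, -1), (3, -2)); ((0, -1), (3, -1)); ((-1, 0), (-1, -1)); ((0, 0), (-1, 0));
        ((2, -1), (4, 0)); ((-2, -1), (2, -3)); ((0, -1), (2, -1))]
    [:: ((1, 1, 3), (0%N, (((-1, 0), (-1, 0)), ((1, 0), (0, 0)))));
        ((2, 2, 3), (1%N, (((4, 1), (3, -1)), ((-3, 1), (0, 1)))))];
  Cusp 2 0 (4, 0) (-1, 1)
    [:: ((0, -1), (2, -1)); ((2, -1), (2, 0)); ((1, -2), (4, -1)); ((1, 0), (0, 0));
        ((-3, -1), (1, -2)); ((1, -1), (1, 0)); ((-4, 0), (-1, -2)); ((0, 0), (-1, 0))]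
    [:: ((4, 1, 3), (0%N, (((-1, -2), (4, -1)), ((4, 0), (-1, 2)))));
        ((1, 1, 6), (1%N, (((-1, 0), (0, 0)), ((1, -1), (-1, 0)))))]].

Lemma field_ok15 : field_ok (tD 15) (nD 15) 1 3 forms15 cusps15.
Proof. by vm_compute. Qed.

Definition forms19 : seq form := [::
  Form 19 (19, (-6, 12), 38) ((1, 0), (0, 0));
  Form 19 (19, (6, -12), 38) ((1, 0), (0, 0))].

Definition cusps19 : seq cusp := [::
  Cusp 1 0 (1, 0) (0, 1)
    [:: ((-1, -1), (4, -2)); ((0, -1), (4, -1)); ((-1, 0), (-1, -1)); ((0, 0), (-1, 0));
        ((-2, -1), (3, -3)); ((-1, -1), (3, -2)); ((0, -1), (3, -1))]
    [:: ((6, 7, 19), (0%N, (((1, -3), (4, 0)), ((3, 1), (-2, 1)))));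
        ((13, 12, 19), (1%N, (((-2, 5), (9, 0)), ((-5, -1), (-3, 2)))))]].

Lemma field_ok19 : field_ok (tD 19) (nD 19) 2 19 forms19 cusps19.
Proof. by vm_compute. Qed.

Definition forms20 : seq form := [::
  Form 5 (5, (5, 3), 15) ((1, 0), (0, 0));
  Form 5 (5, (-5, -3), 15) ((1, 0), (0, 0))].

(** A tight point on an edge of the parallelogram appears again on the opposite edge, with the same
    form and another matrix. *)
Definition cusps20 : seq cusp := [::
  Cusp 1 0 (1, 0) (0, 1)
    [:: ((-1, -1), (4, -1)); ((0, -1), (4, 0)); ((-1, 0), (-1, -1)); ((0, 0), (-1, 0));
        ((-1, -1), (3, -1))]
    [:: ((0, 2, 5), (0%N, (((2, -1), (0, 1)), ((2, 1), (-2, 0)))));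
        ((5, 2, 5), (0%N, (((-3, -4), (5, 1)), ((5, 0), (-2, 1)))));
        ((0, 3, 5), (1%N, (((-7, 2), (0, 2)), ((-3, -2), (-3, 0)))));
        ((5, 3, 5), (1%N, (((-2, 5), (5, 2)), ((-6, -1), (-3, 1)))))];
  Cusp 2 1 (2, 0) (0, 2)
    [:: ((-1, -1), (1, -1)); ((-2, -2), (3, -2)); ((0, -2), (4, -1)); ((-2, 0), (-2, -1));
        ((0, 0), (-1, 0))]
    [:: ((5, 9, 10), (0%N, (((-3, -4), (4, 1)), ((9, 1), (-4, 1)))));
        ((5, 1, 10), (1%N, (((5, 0), (2, -1)), ((-3, 1), (0, 1)))))]].

Lemma field_ok20 : field_ok (tD 5) (nD 5) 1 5 forms20 cusps20.
Proof. by vm_compute. Qed.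

Definition forms23 : seq form := [::
  Form 23 (23, (8, 7), 23) ((1, 0), (0, 0));
  Form 23 (23, (-8, -7), 23) ((1, 0), (0, 0))].

Definition cusps23 : seq cusp := [::
  Cusp 1 0 (1, 0) (0, 1)
    [:: ((-1, -1), (5, -2)); ((0, -1), (5, -1)); ((-1, 0), (-1, -1)); ((0, 0), (-1, 0));
        ((-1, -1), (4, -2)); ((-2, -1), (4, -3)); ((0, -1), (4, -1))]
    [:: ((15, 16, 23), (0%N, (((0, -1), (5, -1)), ((1, 0), (0, 1)))));
        ((8, 7, 23), (1%N, (((-1, -1), (-1, 0)), ((1, 0), (0, 0)))))];
  Cusp 2 (-1) (4, 0) (2, 1)
    [:: ((-4, -1), (4, -2)); ((-2, 0), (0, -1)); ((-6, -1), (5, -3)); ((-2, -1), (3, -1));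
        ((-4, 0), (1, -2)); ((0, 0), (-1, 0))]
    [:: ((76, 9, 46), (0%N, (((-5, -1), (6, -1)), ((3, -2), (1, 2)))));
        ((31, 7, 23), (1%N, (((2, 1), (5, 0)), ((-3, 1), (-1, 2)))))];
  Cusp 2 0 (4, 0) (1, 1)
    [:: ((-3, -1), (2, -2)); ((1, -1), (2, 0)); ((-6, 0), (-1, -3)); ((-2, 0), (-1, -1));
        ((-5, -1), (2, -3)); ((-1, -1), (2, -1)); ((-4, 0), (-1, -2)); ((0, 0), (-1, 0))]
    [:: ((99, 9, 46), (0%N, (((-7, -1), (6, -1)), ((5, -2), (-1, 2)))));
        ((8, 7, 23), (1%N, (((1, 1), (3, 0)), ((-3, 0), (-2, 1)))))]].

Lemma field_ok23 : field_ok (tD 23) (nD 23) 5 23 forms23 cusps23.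
Proof. by vm_compute. Qed.

Definition forms24 : seq form := [::
  Form 6 (6, (3, 2), 6) ((1, 0), (0, 0));
  Form 6 (6, (-3, -2), 6) ((1, 0), (0, 0))].

Definition cusps24 : seq cusp := [::
  Cusp 1 0 (1, 0) (0, 1)
    [:: ((-1, -1), (5, -1)); ((0, -1), (5, 0)); ((-1, 0), (-1, -1)); ((0, 0), (-1, 0));
        ((-2, -1), (4, -2)); ((0, -1), (4, 0))]
    [:: ((3, 4, 6), (0%N, (((-1, -4), (10, 2)), ((5, 0), (-3, 2)))));
        ((3, 2, 6), (1%N, (((1, 1), (4, 0)), ((-2, 0), (-1, 1)))))];
  Cusp 2 0 (2, 0) (0, 2)
    [:: ((-2, -1), (2, -1)); ((0, -1), (2, 0)); ((-2, -2), (5, -1)); ((0, -2), (5, 0));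
        ((-2, 0), (-1, -1)); ((0, 0), (-1, 0))]
    [:: ((3, 1, 6), (0%N, (((-2, -1), (3, 0)), ((3, 0), (-2, 1)))));
        ((3, 5, 6), (1%N, (((-7, 3), (3, 4)), ((-7, -3), (-10, 1)))))]].

Lemma field_ok24 : field_ok (tD 6) (nD 6) 1 12 forms24 cusps24.
Proof. by vm_compute. Qed.

Definition forms31 : seq form := [::
  Form 31 (31, (-11, 22), 124) ((1, 0), (0, 0));
  Form 31 (31, (11, -22), 124) ((1, 0), (0, 0))].

Definition cusps31 : seq cusp := [::
  Cusp 1 0 (1, 0) (0, 1)
    [:: ((-1, -1), (7, -2)); ((0, -1), (7, -1)); ((-1, 0), (-1, -1)); ((0, 0), (-1, 0));
        ((-1, -1), (6, -2)); ((-2, -1), (6, -3)); ((0, -1), (6, -1))]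
    [:: ((11, 9, 31), (0%N, (((2, -5), (7, 0)), ((5, 1), (-2, 1)))));
        ((20, 22, 31), (1%N, (((-18, 11), (15, 2)), ((-9, -3), (-5, 2)))))];
  Cusp 2 (-1) (4, 0) (0, 1)
    [:: ((-2, -1), (4, -1)); ((-2, 0), (0, -1)); ((-4, -1), (5, -2)); ((0, -1), (3, 0));
        ((-4, 0), (1, -2)); ((0, 0), (-1, 0)); ((-8, -1), (6, -4)); ((0, -1), (2, 0))]
    [:: ((11, 9, 31), (0%N, (((7, -2), (2, 1)), ((5, 2), (-3, 1)))));
        ((102, 13, 62), (1%N, (((-2, 4), (7, 0)), ((-9, 0), (-1, 2)))))];
  Cusp 2 0 (4, 0) (-1, 1)
    [:: ((-1, -1), (3, -1)); ((-2, 0), (-1, -1)); ((-3, -1), (3, -2)); ((1, -1), (3, 0));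
        ((-4, 0), (-1, -2)); ((0, 0), (-1, 0)); ((-7, -1), (2, -4)); ((1, -1), (2, 0))]
    [:: ((42, 9, 31), (0%N, (((-11, -4), (7, -2)), ((12, -2), (1, 2)))));
        ((9, 13, 62), (1%N, (((-1, 2), (3, 0)), ((-5, -1), (-2, 1)))))]].

Lemma field_ok31 : field_ok (tD 31) (nD 31) 3 31 forms31 cusps31.
Proof. by vm_compute. Qed.

Definition forms35 : seq form := [::
  Form 7 (7, (-2, 4), 21) ((1, 0), (0, 0));
  Form 7 (7, (2, -4), 21) ((1, 0), (0, 0))].

Definition cusps35 : seq cusp := [::
  Cusp 1 0 (1, 0) (0, 1)
    [:: ((-1, -1), (8, -2)); ((0, -1), (8, -1)); ((-1, 0), (-1, -1)); ((0, 0), (-1, 0));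
        ((3, -1), (9, 1)); ((6, -1), (9, 4)); ((-3, -2), (15, -5)); ((0, -1), (6, -1));
        ((-2, -1), (7, -3)); ((-1, -1), (7, -2)); ((0, -1), (7, -1))]
    [:: ((2, 3, 7), (0%N, (((-1, -4), (7, -1)), ((5, 0), (0, 1)))));
        ((5, 4, 7), (1%N, (((9, 2), (7, -2)), ((-4, 1), (1, 1)))))];
  Cusp 3 0 (9, 0) (-1, 1)
    [:: ((0, -2), (6, -1)); ((3, -2), (6, 0)); ((1, -3), (9, -1)); ((2, -1), (3, 0));
        ((1, 0), (0, 0)); ((-8, -1), (2, -3)); ((1, -1), (2, 0)); ((-3, 0), (-1, -1));
        ((0, -1), (3, -1)); ((3, -1), (3, 0)); ((6, -1), (3, 1))]
    [:: ((13, 2, 21), (0%N, (((-5, -1), (2, -1)), ((6, -1), (1, 1)))));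
        ((1, 5, 21), (1%N, (((-1, 1), (2, 0)), ((-4, -1), (-2, 1)))))]].

Lemma field_ok35 : field_ok (tD 35) (nD 35) 1 7 forms35 cusps35.
Proof. by vm_compute. Qed.

Definition forms39 : seq form := [::
  Form 13 (13, (-2, 4), 13) ((1, 0), (0, 0));
  Form 13 (13, (2, -4), 13) ((1, 0), (0, 0))].

Definition cusps39 : seq cusp := [::
  Cusp 1 0 (1, 0) (0, 1)
    [:: ((-1, -1), (9, -2)); ((0, -1), (9, -1)); ((-1, 0), (-1, -1)); ((0, 0), (-1, 0));
        ((-2, -1), (8, -3)); ((0, -1), (8, -1)); ((-2, -2), (17, -4)); ((-1, -1), (7, -2))]
    [:: ((2, 9, 13), (0%N, (((17, -3), (10, 5)), ((1, 2), (-7, 1)))));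
        ((11, 4, 13), (1%N, (((-7, 3), (10, 1)), ((-2, -1), (-3, 1)))))];
  Cusp 2 (-1) (4, 0) (2, 1)
    [:: ((-4, -1), (6, -2)); ((0, -1), (4, 0)); ((-6, 0), (2, -3)); ((-2, 0), (0, -1));
        ((-6, -1), (7, -3)); ((-2, -1), (5, -1)); ((-4, 0), (1, -2)); ((0, 0), (-1, 0));
        ((1, -2), (9, 0))]
    [:: ((56, 5, 26), (0%N, (((-7, -4), (16, -3)), ((9, -2), (5, 3)))));
        ((11, 4, 13), (1%N, (((-1, 2), (8, 0)), ((-5, 0), (-1, 2)))))];
  Cusp 2 0 (4, 0) (1, 1)
    [:: ((-3, -1), (4, -2)); ((-2, 0), (-1, -1)); ((-5, -1), (4, -3));
        ((-1, -1), (4, -1)); ((-4, 0), (-1, -2)); ((0, 0), (-1, 0)); ((7, -2), (11, 2));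
        ((3, 0), (1, 1))]
    [:: ((43, 5, 26), (0%N, (((-7, -3), (9, -2)), ((8, -1), (1, 2)))));
        ((11, 4, 13), (1%N, (((2, 3), (9, -1)), ((-7, 0), (-1, 2)))))];
  Cusp 3 1 (3, 0) (0, 3)
    [:: ((-4, -1), (1, -2)); ((-1, -1), (2, -1)); ((8, -2), (9, 1)); ((10, 0), (4, 3));
        ((8, 1), (0, 3)); ((-2, -2), (5, -2)); ((-3, 0), (-2, -1)); ((0, 0), (-1, 0))]
    [:: ((19, 1, 39), (0%N, (((-3, -1), (4, -1)), ((3, 0), (-1, 1)))));
        ((7, 25, 39), (1%N, (((-11, 3), (8, 3)), ((-1, -4), (-13, 1)))))]].

Lemma field_ok39 : field_ok (tD 39) (nD 39) 1 13 forms39 cusps39.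
Proof. by vm_compute. Qed.

Definition forms40 : seq form := [::
  Form 30 (30, (-15, -11), 50) ((1, 0), (0, 0));
  Form 30 (30, (-15, 11), 50) ((1, 0), (0, 0));
  Form 30 (30, (5, 9), 30) ((1, 0), (0, 0));
  Form 30 (30, (-5, -9), 30) ((1, 0), (0, 0));
  Form 30 (30, (5, -9), 30) ((1, 0), (0, 0));
  Form 30 (30, (-5, 9), 30) ((1, 0), (0, 0))].

Definition cusps40 : seq cusp := [::
  Cusp 1 0 (1, 0) (0, 1)
    [:: ((-1, -1), (9, -1)); ((0, -1), (9, 0)); ((-1, 0), (-1, -1)); ((0, 0), (-1, 0));
        ((-2, -1), (8, -2)); ((0, -1), (8, 0)); ((6, -2), (18, 5)); ((2, -1), (8, 1));
        ((4, 0), (2, 3)); ((8, 1), (-8, 7))]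
    [:: ((5, 21, 30), (0%N, (((-17, 7), (9, 6)), ((-8, -2), (-7, 1)))));
        ((25, 21, 30), (0%N, (((-26, 3), (1, 7)), ((-3, -3), (-8, 0)))));
        ((15, 11, 30), (0%N, (((9, 3), (8, -1)), ((-4, 1), (1, 1)))));
        ((25, 9, 30), (1%N, (((6, -3), (9, 1)), ((3, 1), (-2, 1)))));
        ((5, 9, 30), (1%N, (((7, 1), (1, 2)), ((-2, 1), (-3, 0)))));
        ((15, 19, 30), (1%N, (((-1, -5), (8, -1)), ((6, 0), (1, 1)))))];
  Cusp 2 0 (2, 0) (0, 2)
    [:: ((-2, -1), (4, -1)); ((0, -1), (4, 0)); ((-2, -2), (9, -1)); ((0, -2), (9, 0));
        ((-2, 0), (-1, -1)); ((0, 0), (-1, 0)); ((7, -2), (9, 3)); ((1, -1), (4, 0));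
        ((3, 0), (1, 1)); ((9, 1), (-4, 4))]
    [:: ((5, 6, 30), (0%N, (((1, 1), (3, 0)), ((-4, 0), (-1, 1)))));
        ((25, 6, 30), (0%N, (((1, 1), (4, 0)), ((-3, 0), (-1, 1)))));
        ((15, 26, 30), (0%N, (((9, 4), (9, 0)), ((-9, 2), (0, 2)))));
        ((25, 24, 30), (1%N, (((17, -6), (18, 2)), ((13, 4), (-5, 4)))));
        ((5, 24, 30), (1%N, (((13, -1), (9, 3)), ((2, 3), (-7, 2)))));
        ((15, 4, 30), (1%N, (((-1, 0), (-1, 0)), ((1, 0), (0, 0)))))]].

Lemma field_ok40 : field_ok (tD 10) (nD 10) 13 180 forms40 cusps40.
Proof. by vm_compute. Qed.

Definition forms43 : seq form := [::
  Form 43 (43, (-16, 32), 258) ((1, 0), (0, 0));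
  Form 43 (43, (16, -32), 258) ((1, 0), (0, 0))].

Definition cusps43 : seq cusp := [::
  Cusp 1 0 (1, 0) (0, 1)
    [:: ((-1, -1), (10, -2)); ((0, -1), (10, -1)); ((-1, 0), (-1, -1)); ((0, 0), (-1, 0));
        ((-2, -1), (9, -3)); ((-1, -1), (9, -2)); ((0, -1), (9, -1));
        ((-3, -2), (19, -5)); ((-2, -2), (19, -4)); ((-1, -2), (19, -3));
        ((0, -2), (19, -2)); ((-3, -1), (8, -4)); ((-2, -1), (8, -3));
        ((-1, -1), (8, -2)); ((0, -1), (8, -1))]
    [:: ((16, 11, 43), (0%N, (((2, -7), (9, 0)), ((8, 1), (-2, 1)))));
        ((27, 32, 43), (1%N, (((-35, 25), (31, 3)), ((-23, -4), (-7, 3)))))]].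

Lemma field_ok43 : field_ok (tD 43) (nD 43) 2 43 forms43 cusps43.
Proof. by vm_compute. Qed.

(** The last two forms take the value 2 at [(1, 0)]. Their minimal vectors generate ideals of norm
    2, which are not principal in this field. *)
Definition forms47 : seq form := [::
  Form 47 (47, (-18, 36), 329) ((1, 0), (0, 0));
  Form 47 (47, (18, -36), 329) ((1, 0), (0, 0));
  Form 47 (94, (-29, 58), 423) ((0, 1), (-2, 0));
  Form 47 (94, (29, -58), 423) ((0, 1), (2, 0))].

Definition cusps47 : seq cusp := [::
  Cusp 1 0 (1, 0) (0, 1)
    [:: ((-1, -1), (11, -2)); ((0, -1), (11, -1)); ((-1, 0), (-1, -1)); ((0, 0), (-1, 0));
        ((-2, -1), (10, -3)); ((0, -1), (10, -1)); ((-1, -2), (21, -3));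
        ((-2, -1), (9, -3)); ((-3, -2), (21, -5)); ((0, -1), (9, -1))]
    [:: ((18, 11, 47), (0%N, (((-1, 0), (-1, 0)), ((1, 0), (0, 0)))));
        ((29, 36, 47), (1%N, (((12, 9), (11, -1)), ((-11, 1), (0, 1)))))];
  Cusp 2 (-1) (4, 0) (0, 1)
    [:: ((-2, -1), (6, -1)); ((-2, 0), (0, -1)); ((-4, -1), (7, -2)); ((0, -1), (5, 0));
        ((-4, 0), (1, -2)); ((0, 0), (-1, 0)); ((5, -2), (10, 2)); ((3, 0), (-1, 1))]
    [:: ((65, 11, 47), (0%N, (((4, -8), (11, 0)), ((17, 0), (-1, 2)))));
        ((58, 25, 94), (1%N, (((-11, 3), (4, 1)), ((-7, -2), (-3, 1)))))];
  Cusp 2 0 (4, 0) (-1, 1)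
    [:: ((-1, -1), (5, -1)); ((-2, 0), (-1, -1)); ((-3, -1), (5, -2)); ((1, -1), (5, 0));
        ((-4, 0), (-1, -2)); ((0, 0), (-1, 0)); ((3, -2), (12, 0)); ((3, 0), (0, 1))]
    [:: ((18, 11, 47), (0%N, (((1, -4), (5, 0)), ((9, 1), (-2, 1)))));
        ((105, 25, 94), (1%N, (((5, 8), (11, -1)), ((-18, 0), (-1, 2)))))];
  Cusp 3 (-1) (9, 0) (-3, 1)
    [:: ((-9, -1), (6, -3)); ((0, -1), (3, 0)); ((-3, 0), (0, -1)); ((4, -2), (7, 1));
        ((1, 1), (-4, 0)); ((-3, -1), (4, -1)); ((-9, 0), (2, -3)); ((0, 0), (-1, 0));
        ((-9, -2), (9, -3)); ((-15, 0), (3, -5))]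
    [:: ((65, 11, 47), (0%N, (((3, -6), (7, 0)), ((20, 0), (-1, 2)))));
        ((369, 14, 141), (1%N, (((13, 10), (13, -2)), ((-32, 5), (5, 3)))))];
  Cusp 3 0 (9, 0) (2, 1)
    [:: ((-8, -1), (3, -3)); ((1, -1), (3, 0)); ((-6, 0), (-1, -2)); ((2, -4), (16, -1));
        ((2, -1), (4, 0)); ((-5, -1), (3, -2)); ((-9, 0), (-1, -3)); ((0, 0), (-1, 0));
        ((-7, -2), (6, -3)); ((-3, 0), (-2, -1))]
    [:: ((65, 11, 47), (0%N, (((5, -6), (8, 0)), ((16, 2), (-3, 2)))));
        ((40, 14, 141), (1%N, (((-1, 0), (0, 0)), ((1, -1), (-1, 0)))))]].

Lemma field_ok47 : field_ok (tD 47) (nD 47) 5 47 forms47 cusps47.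
Proof. by vm_compute. Qed.

Definition forms51 : seq form := [::
  Form 51 (51, (-7, 14), 51) ((1, 0), (0, 0));
  Form 51 (51, (7, -14), 51) ((1, 0), (0, 0));
  Form 51 (51, (-10, 20), 102) ((1, 0), (0, 0));
  Form 51 (51, (10, -20), 102) ((1, 0), (0, 0))].

Definition cusps51 : seq cusp := [::
  Cusp 1 0 (1, 0) (0, 1)
    [:: ((-1, -1), (12, -2)); ((0, -1), (12, -1)); ((-1, 0), (-1, -1)); ((0, 0), (-1, 0));
        ((-2, -2), (23, -4)); ((1, -2), (23, -1)); ((-4, -1), (10, -5));
        ((-1, -1), (10, -2)); ((-2, -1), (11, -3)); ((-1, -1), (11, -2));
        ((0, -1), (11, -1))]
    [:: ((7, 37, 51), (0%N, (((22, -11), (36, 5)), ((10, 2), (-9, 3)))));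
        ((44, 14, 51), (1%N, (((4, 6), (23, -2)), ((-7, 0), (-1, 2)))));
        ((10, 31, 51), (2%N, (((33, -11), (24, 5)), ((9, 3), (-8, 2)))));
        ((41, 20, 51), (3%N, (((-8, 9), (24, 1)), ((-9, -1), (-4, 2)))))];
  Cusp 3 1 (3, 0) (0, 3)
    [:: ((-2, -2), (7, -2)); ((1, -2), (8, -1)); ((-3, -3), (11, -3));
        ((0, -3), (12, -2)); ((-4, -1), (2, -2)); ((-1, -1), (3, -1));
        ((-3, 0), (-2, -1)); ((0, 0), (-1, 0)); ((-4, -1), (1, -2)); ((-1, -1), (2, -1))]
    [:: ((8, 1, 17), (0%N, (((-4, -1), (4, -1)), ((4, 0), (-1, 1)))));
        ((44, 14, 51), (1%N, (((2, 4), (14, -1)), ((-11, -1), (-5, 3)))));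
        ((9, 16, 17), (2%N, (((29, -12), (29, 4)), ((19, 9), (-24, 5)))));
        ((41, 20, 51), (3%N, (((-5, 6), (15, 0)), ((-13, -3), (-8, 3)))))]].

Lemma field_ok51 : field_ok (tD 51) (nD 51) 2 51 forms51 cusps51.
Proof. by vm_compute. Qed.

Definition forms52 : seq form := [::
  Form 26 (26, (0, 7), 26) ((1, 0), (0, 0));
  Form 26 (26, (0, -7), 26) ((1, 0), (0, 0));
  Form 26 (26, (-13, -6), 26) ((1, 0), (0, 0));
  Form 26 (26, (-13, 6), 26) ((1, 0), (0, 0))].

Definition cusps52 : seq cusp := [::
  Cusp 1 0 (1, 0) (0, 1)
    [:: ((-1, -1), (12, -1)); ((0, -1), (12, 0)); ((-1, 0), (-1, -1)); ((0, 0), (-1, 0));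
        ((-1, -1), (11, -1)); ((3, -1), (12, 2)); ((9, -1), (12, 8)); ((4, 0), (1, 3));
        ((10, 0), (1, 9)); ((-3, -2), (23, -3)); ((0, -2), (23, 0)); ((-3, -1), (10, -3));
        ((0, -1), (10, 0))]
    [:: ((0, 19, 26), (0%N, (((35, 0), (0, 9)), ((0, 3), (-10, 0)))));
        ((26, 19, 26), (0%N, (((35, -4), (13, 9)), ((4, 3), (-10, 1)))));
        ((0, 7, 26), (1%N, (((-10, 0), (0, 3)), ((0, -1), (-4, 0)))));
        ((26, 7, 26), (1%N, (((-10, 3), (13, 3)), ((-3, -1), (-4, 1)))));
        ((13, 6, 26), (2%N, (((2, 3), (11, 1)), ((-4, 0), (-2, 1)))));
        ((13, 20, 26), (3%N, (((35, -2), (24, 8)), ((2, 3), (-9, 2)))))];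
  Cusp 2 1 (2, 0) (0, 2)
    [:: ((-1, -1), (5, -1)); ((-2, -2), (11, -2)); ((0, -2), (12, -1));
        ((-2, 0), (-2, -1)); ((0, 0), (-1, 0)); ((2, -1), (7, 0)); ((10, -1), (11, 4));
        ((3, 0), (2, 1)); ((11, 0), (6, 5)); ((-3, -5), (28, -4)); ((-3, -1), (2, -2))]
    [:: ((0, 19, 26), (0%N, (((7, -5), (16, 3)), ((9, 2), (-9, 2)))));
        ((26, 19, 26), (0%N, (((-1, -6), (21, 1)), ((12, 1), (-6, 3)))));
        ((0, 7, 26), (1%N, (((-3, 2), (7, 1)), ((-4, -1), (-4, 1)))));
        ((26, 7, 26), (1%N, (((5, 3), (12, -1)), ((-7, 0), (-1, 2)))));
        ((13, 6, 26), (2%N, (((2, 1), (6, 0)), ((-3, 0), (-2, 1)))));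
        ((13, 20, 26), (3%N, (((16, -3), (22, 2)), ((3, 3), (-8, 3)))))]].

Lemma field_ok52 : field_ok (tD 13) (nD 13) 3 52 forms52 cusps52.
Proof. by vm_compute. Qed.

Definition forms55 : seq form := [::
  Form 44 (44, (-7, 14), 66) ((1, 0), (0, 0));
  Form 44 (44, (7, -14), 66) ((1, 0), (0, 0));
  Form 44 (55, (29, 19), 121) ((1, 1), (-2, 0));
  Form 44 (55, (-29, -19), 121) ((1, 1), (2, 0));
  Form 44 (55, (7, 19), 99) ((0, 1), (-2, 0));
  Form 44 (55, (-7, -19), 99) ((0, 1), (2, 0))].

Definition cusps55 : seq cusp := [::
  Cusp 1 0 (1, 0) (0, 1)
    [:: ((-1, -1), (13, -2)); ((0, -1), (13, -1)); ((-1, 0), (-1, -1)); ((0, 0), (-1, 0));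
        ((-1, -1), (12, -2)); ((-2, -1), (12, -3)); ((0, -1), (12, -1));
        ((10, -2), (27, 7)); ((3, -1), (13, 1)); ((-3, -3), (38, -6));
        ((-1, -1), (10, -2)); ((8, 0), (3, 7)); ((9, 1), (-11, 9)); ((5, -1), (15, 3));
        ((10, 0), (1, 9)); ((4, -1), (14, 2)); ((10, -1), (14, 8))]
    [:: ((7, 30, 44), (0%N, (((13, -1), (0, 1)), ((0, 1), (-1, 0)))));
        ((37, 14, 44), (1%N, (((-1, -1), (0, 1)), ((1, 0), (-1, 0)))))];
  Cusp 2 (-1) (4, 0) (2, 1)
    [:: ((-4, -1), (8, -2)); ((-2, 0), (0, -1)); ((-6, -1), (9, -3)); ((-2, -1), (7, -1));
        ((-4, 0), (1, -2)); ((0, 0), (-1, 0)); ((1, -3), (20, 0)); ((3, -1), (5, 1));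
        ((-6, -1), (8, -3)); ((5, -2), (12, 2)); ((5, -1), (5, 2)); ((15, -1), (3, 7));
        ((13, 1), (-10, 6))]
    [:: ((102, 27, 88), (0%N, (((7, -2), (5, 2)), ((4, 1), (-5, 1)))));
        ((162, 17, 88), (1%N, (((-9, 4), (12, 2)), ((-8, -1), (-5, 2)))))];
  Cusp 2 0 (4, 0) (1, 1)
    [:: ((-3, -1), (6, -2)); ((-2, 0), (-1, -1)); ((-5, -1), (6, -3));
        ((-1, -1), (6, -1)); ((-4, 0), (-1, -2)); ((0, 0), (-1, 0)); ((-5, -1), (5, -3));
        ((-9, -1), (5, -5)); ((-1, -1), (5, -1)); ((3, -2), (14, 0)); ((4, -1), (7, 1));
        ((8, -4), (29, 1)); ((11, -1), (8, 4))]
    [:: ((47, 27, 88), (0%N, (((5, -2), (7, 1)), ((3, 1), (-4, 1)))));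
        ((173, 17, 88), (1%N, (((-5, 4), (14, 0)), ((-7, -1), (-3, 2)))))];
  Cusp 4 1 (16, 0) (-2, 1)
    [:: ((-1, -1), (3, -1)); ((3, -1), (4, 0)); ((-1, -3), (10, -2));
        ((-10, -1), (0, -3)); ((-12, 0), (-4, -3)); ((-3, -4), (13, -3));
        ((1, -2), (7, -1)); ((1, 0), (0, 0)); ((-14, -1), (-1, -4)); ((2, -1), (3, 0));
        ((-8, 0), (-3, -2)); ((11, -3), (14, 1)); ((9, -2), (10, 1)); ((27, -3), (19, 5));
        ((15, -1), (9, 3)); ((12, -7), (28, -1)); ((6, -4), (16, -1))]
    [:: ((358, 21, 176), (0%N, (((7, -4), (10, 1)), ((9, 3), (-9, 2)))));
        ((610, 23, 176), (1%N, (((-9, 6), (14, 1)), ((-15, -4), (-11, 3)))))]].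

Lemma field_ok55 : field_ok (tD 55) (nD 55) 19 176 forms55 cusps55.
Proof. by vm_compute. Qed.

Definition forms56 : seq form := [::
  Form 14 (14, (-7, -3), 14) ((1, 0), (0, 0));
  Form 14 (14, (-77, -53), 3234) ((1, 0), (0, 0))].

Definition cusps56 : seq cusp := [::
  Cusp 1 0 (1, 0) (0, 1)
    [:: ((-1, -1), (13, -1)); ((0, -1), (13, 0)); ((-1, 0), (-1, -1)); ((0, 0), (-1, 0));
        ((-2, -1), (12, -2)); ((0, -1), (12, 0)); ((-1, -2), (25, -1));
        ((-2, -1), (11, -2)); ((-2, -2), (25, -2)); ((-1, -1), (11, -1))]
    [:: ((7, 3, 14), (0%N, (((-1, -1), (-1, 0)), ((1, 0), (0, 0)))));
        ((7, 11, 14), (1%N, (((78, 51), (13, 0)), ((-55, 6), (0, 1)))))];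
  Cusp 2 0 (2, 0) (0, 2)
    [:: ((-2, -1), (6, -1)); ((0, -1), (6, 0)); ((-2, -2), (13, -1)); ((0, -2), (13, 0));
        ((-2, 0), (-1, -1)); ((0, 0), (-1, 0)); ((11, -2), (13, 5)); ((1, -1), (6, 0));
        ((3, 0), (1, 1)); ((13, 1), (-6, 6))]
    [:: ((7, 10, 14), (0%N, (((-6, 5), (13, 4)), ((-11, -1), (-9, 2)))));
        ((7, 4, 14), (1%N, (((-21, 28), (6, 1)), ((-69, -6), (-3, 1)))))];
  Cusp 3 (-1) (9, 0) (-2, 1)
    [:: ((-4, -1), (5, -1)); ((-6, 0), (1, -2)); ((-7, -1), (6, -2)); ((-1, -1), (4, 0));
        ((-9, 0), (2, -3)); ((-3, 0), (0, -1)); ((0, 0), (-1, 0)); ((-2, -3), (14, 0));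
        ((0, -1), (4, 0)); ((4, 0), (-2, 1)); ((1, -2), (7, 1)); ((-1, -1), (3, 0));
        ((-3, 0), (-1, -1))]
    [:: ((7, 3, 14), (0%N, (((-1, 1), (3, 1)), ((-4, 0), (-3, 1)))));
        ((-7, 5, 42), (1%N, (((-6, -4), (-1, 0)), ((-5, -4), (-1, 0)))))];
  Cusp 3 1 (9, 0) (2, 1)
    [:: ((-5, -1), (2, -2)); ((-3, 0), (-2, -1)); ((-8, -1), (1, -3));
        ((-2, -1), (3, -1)); ((-9, 0), (-4, -3)); ((-6, 0), (-3, -2)); ((0, 0), (-1, 0));
        ((10, -3), (18, 2)); ((6, -2), (12, 1)); ((4, 0), (2, 1)); ((-19, -2), (1, -7));
        ((-17, -1), (-3, -6)); ((-15, 0), (-7, -5))]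
    [:: ((35, 3, 14), (0%N, (((13, 2), (14, -1)), ((-9, 2), (-1, 3)))));
        ((133, 5, 42), (1%N, (((173, 39), (13, -2)), ((-149, 23), (2, 3)))))]].

Lemma field_ok56 : field_ok (tD 14) (nD 14) 3 28 forms56 cusps56.
Proof. by vm_compute. Qed.

Definition forms59 : seq form := [::
  Form 59 (59, (-23, 46), 531) ((1, 0), (0, 0));
  Form 59 (59, (23, -46), 531) ((1, 0), (0, 0));
  Form 59 (118, (-36, -46), 295) ((0, 1), (3, 0))].

Definition cusps59 : seq cusp := [::
  Cusp 1 0 (1, 0) (0, 1)
    [:: ((-1, -1), (14, -2)); ((0, -1), (14, -1)); ((-1, 0), (-1, -1)); ((0, 0), (-1, 0));
        ((-1, -2), (27, -3)); ((-2, -1), (12, -3)); ((-3, -2), (27, -5));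
        ((0, -1), (12, -1)); ((-2, -1), (13, -3)); ((-1, -1), (13, -2));
        ((0, -1), (13, -1))]
    [:: ((23, 13, 59), (0%N, (((17, -11), (13, 1)), ((11, 2), (-3, 1)))));
        ((36, 46, 59), (1%N, (((-93, 36), (43, 7)), ((-31, -7), (-11, 3)))))];
  Cusp 3 (-1) (9, 0) (3, 1)
    [:: ((-6, -1), (6, -2)); ((-12, 0), (3, -4)); ((-3, 0), (0, -1));
        ((-12, -1), (8, -4)); ((-9, -1), (7, -3)); ((-3, -1), (5, -1));
        ((-9, 0), (2, -3)); ((-6, 0), (1, -2)); ((0, 0), (-1, 0)); ((-21, -2), (15, -7));
        ((-18, -1), (9, -6)); ((-15, 0), (3, -5))]
    [:: ((200, 13, 59), (0%N, (((-21, -31), (41, -3)), ((97, -9), (7, 8)))));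
        ((462, 20, 177), (1%N, (((24, 23), (31, -3)), ((-73, 8), (7, 6)))))];
  Cusp 3 0 (9, 0) (-4, 1)
    [:: ((-2, -1), (4, -1)); ((-6, 0), (-1, -2)); ((3, 0), (-1, 1)); ((-5, -1), (4, -2));
        ((1, -1), (4, 0)); ((4, -1), (4, 1)); ((-9, 0), (-1, -3)); ((-3, 0), (-1, -1));
        ((0, 0), (-1, 0)); ((5, -2), (8, 1)); ((1, -1), (3, 0)); ((-3, 0), (-2, -1))]
    [:: ((-36, 13, 59), (0%N, (((22, 0), (-1, 2)), ((-3, 6), (-8, 0)))));
        ((49, 20, 177), (1%N, (((-2, 3), (4, 0)), ((-10, -2), (-3, 1)))))]].

Lemma field_ok59 : field_ok (tD 59) (nD 59) 2 59 forms59 cusps59.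
Proof. by vm_compute. Qed.

Definition forms67 : seq form := [::
  Form 67 (67, (-20, 40), 402) ((1, 0), (0, 0));
  Form 67 (67, (20, -40), 402) ((1, 0), (0, 0))].

Definition cusps67 : seq cusp := [::
  Cusp 1 0 (1, 0) (0, 1)
    [:: ((-1, -1), (16, -2)); ((0, -1), (16, -1)); ((-1, 0), (-1, -1)); ((0, 0), (-1, 0));
        ((-2, -1), (15, -3)); ((-1, -1), (15, -2)); ((0, -1), (15, -1));
        ((-3, -2), (31, -5)); ((-2, -2), (31, -4)); ((-1, -2), (31, -3));
        ((0, -2), (31, -2)); ((-3, -1), (14, -4)); ((-2, -1), (14, -3));
        ((-1, -1), (14, -2)); ((0, -1), (14, -1)); ((-4, -3), (47, -7));
        ((-3, -3), (47, -6)); ((-2, -3), (47, -5)); ((-1, -3), (47, -4));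
        ((0, -3), (47, -3)); ((-4, -1), (13, -5)); ((-3, -1), (13, -4));
        ((-2, -1), (13, -3)); ((-1, -1), (13, -2)); ((0, -1), (13, -1)); ((5, 0), (3, 4));
        ((9, 0), (3, 8)); ((11, 1), (-14, 11)); ((15, 1), (-14, 15))]
    [:: ((20, 27, 67), (0%N, (((40, -19), (31, 3)), ((18, 3), (-6, 2)))));
        ((47, 40, 67), (1%N, (((-57, 29), (48, 4)), ((-27, -4), (-8, 3)))))]].

Lemma field_ok67 : field_ok (tD 67) (nD 67) 2 67 forms67 cusps67.
Proof. by vm_compute. Qed.

Definition forms68 : seq form := [::
  Form 34 (34, (-17, -7), 34) ((1, 0), (0, 0));
  Form 34 (306, (-153, -95), 578) ((1, 1), (3, 0))].

Definition cusps68 : seq cusp := [::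
  Cusp 1 0 (1, 0) (0, 1)
    [:: ((-1, -1), (16, -1)); ((0, -1), (16, 0)); ((-1, 0), (-1, -1)); ((0, 0), (-1, 0));
        ((-1, -1), (15, -1)); ((-1, -2), (31, -1)); ((-2, -1), (14, -2));
        ((-2, -2), (31, -2)); ((-1, -1), (14, -1))]
    [:: ((17, 7, 34), (0%N, (((2, 3), (14, 1)), ((-4, 0), (-2, 1)))));
        ((17, 27, 34), (1%N, (((-251, 36), (34, 51)), ((-38, -16), (-55, 2)))))];
  Cusp 2 1 (2, 0) (0, 2)
    [:: ((-1, -1), (7, -1)); ((-2, -2), (15, -2)); ((0, -2), (16, -1));
        ((-2, 0), (-2, -1)); ((0, 0), (-1, 0)); ((3, 0), (2, 1)); ((15, 0), (8, 7));
        ((2, -1), (9, 0)); ((14, -1), (15, 6))]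
    [:: ((0, 12, 17), (0%N, (((-33, 8), (12, 11)), ((-12, -5), (-24, 0)))));
        ((17, 12, 17), (0%N, (((-21, 11), (29, 10)), ((-19, -4), (-24, 2)))));
        ((0, 5, 17), (1%N, (((-39, 10), (18, 9)), ((-17, -7), (-24, 1)))));
        ((17, 5, 17), (1%N, (((7, 20), (58, 4)), ((-41, -3), (-19, 6)))))];
  Cusp 3 (-1) (9, 0) (1, 1)
    [:: ((-7, -1), (7, -2)); ((-6, 0), (1, -2)); ((-4, -1), (6, -1)); ((-9, 0), (2, -3));
        ((0, 0), (-1, 0)); ((7, -3), (15, 3)); ((3, -1), (5, 1)); ((4, 0), (-1, 1));
        ((-5, -2), (11, -1)); ((-4, -1), (5, -1)); ((-3, 0), (-1, -1))]
    [:: ((51, 7, 34), (0%N, (((8, 5), (21, 1)), ((-15, 2), (-1, 4)))));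
        ((289, 13, 102), (1%N, (((49, 38), (119, 2)), ((-107, 13), (8, 21)))))];
  Cusp 3 1 (9, 0) (-1, 1)
    [:: ((-2, -1), (4, -1)); ((-3, 0), (-2, -1)); ((-5, -1), (3, -2));
        ((-9, 0), (-4, -3)); ((0, 0), (-1, 0)); ((1, -3), (17, -1)); ((0, -2), (11, -1));
        ((4, 0), (1, 1)); ((-13, -2), (5, -5)); ((-14, -1), (-1, -5));
        ((-15, 0), (-7, -5))]
    [:: ((51, 7, 34), (0%N, (((17, 3), (21, -2)), ((-13, 2), (0, 4)))));
        ((17, 13, 102), (1%N, (((-12, 4), (8, 3)), ((-8, -5), (-16, 0)))))]].

Lemma field_ok68 : field_ok (tD 17) (nD 17) 1 34 forms68 cusps68.
Proof. by vm_compute. Qed.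
End Certificates.

(** * Matching the certificates with the table *)

Section Table.
Variable R : realType.

(** Denominators are cleared, so only equalities between products of square roots remain. The factor
    2 comes from $w = (t + \sqrt{d_K})/2$. *)
Lemma scaled_formE (D : nat) (D_gt0 : (0 < D)%N) (F : form) (gam a x y c : R) : 0 < fden F ->
  a * zr R (fden F) = gam * zr R (fherm F).1.1 ->
  x * zr R (2%:R * fden F) = gam * zr R (2%:R * (fherm F).1.2.1 + (fherm F).1.2.2 * tD D) ->
  y * zr R (2%:R * fden F) = gam * Num.sqrt (zr R (disc4 (tD D) (nD D))) * zr R (fherm F).1.2.2 ->
  c * zr R (fden F) = gam * zr R (fherm F).2 ->
  scaled_form D gam F = hform a (x +i* y) c.
Proof.
move=> m0; have m0R : zr R (fden F) != 0 by rewrite gt_eqF // zr_gt0.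
have m2 : zr R (2%:R * fden F) = 2%:R * zr R (fden F) by rewrite rmorphM rmorph_nat.
have t2 : zr R (2%:R * (fherm F).1.2.1 + (fherm F).1.2.2 * tD D) =
   2%:R * zr R (fherm F).1.2.1 + zr R (fherm F).1.2.2 * zr R (tD D).
  by rewrite rmorphD !rmorphM rmorph_nat.
have m20 : 2%:R * zr R (fden F) != 0 by rewrite mulf_neq0 ?pnatr_eq0.
rewrite m2 t2 => ea ex ey ec; rewrite /scaled_form /herm_mx; congr hform.
- apply: (mulIf m0R); rewrite ea /hscale /formR /=.
  by move: (zr R (fden F)) m0R (zr R (fherm F).1.1) => m m0' p; field.
- apply: complex_eq; apply: (mulIf m20).
    rewrite [RHS]ex /hscale /formR /zq /qscale /=.
    move: (zr R (fden F)) m0R (zr R (tD D)) (zr R (fherm F).1.2.1) (zr R (fherm F).1.2.2).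
    by move=> m m0' T u v; field.
  rewrite [RHS]ey /hscale /formR /zq /qscale /= /im_omega.
  move: (zr R (fden F)) m0R (Num.sqrt _) (zr R (fherm F).1.2.2).
  by move=> m m0' T v; field.
- apply: (mulIf m0R); rewrite ec /hscale /formR /=.
  by move: (zr R (fden F)) m0R (zr R (fherm F).2) => m m0' p; field.
Qed.

Lemma eq_sqr_ge0 (x y : R) : 0 <= x -> 0 <= y -> x ^+ 2 = y ^+ 2 -> x = y.
Proof. by move=> x0 y0 /eqP; rewrite eqrXn2 // => /eqP. Qed.

Definition row_valid (D : nat) (row : nat * R * seq 'M[R[i]]_2) :=
  [/\ row \in extreme_table R, - disc R D = row.1.1%:Z, proj_hermite R D = row.1.2,
      (forall F, F \in row.2 -> abs_proj_extreme D F /\ hdet F = 1)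
    & forall S, abs_proj_extreme D S -> hdet S = 1 ->
        exists F g, [/\ F \in row.2, SL2OK D g & S = hact g F]].

Lemma table_row (D k i : nat) (dn dd : Z) (fs : seq form) (cs : seq cusp) (gam : R)
  (forms : seq 'M[R[i]]_2) :
  (0 < D)%N -> square_free D -> field_ok (tD D) (nD D) dn dd fs cs -> (0 < size fs)%N ->
  (i < size (extreme_table R))%N -> nth (0%N, 0, [::]) (extreme_table R) i = (k, gam, forms) ->
  disc4 (tD D) (nD D) = Z.of_nat k -> 0 < gam -> gam ^+ 2 * zr R dn = zr R dd ->
  [seq scaled_form D gam F | F <- fs] = forms -> row_valid D (k, gam, forms).
Proof.
move=> D0 Dsf ok fs0 isz row dk g0 gE fE; rewrite /row_valid /=; split.
- by rewrite -row mem_nth.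
- by rewrite disc_eq // opprK dk (Z_of_intK k%:Z).
- exact: (proj_hermite_eq D0 Dsf ok fs0 g0 gE).
- move=> M; rewrite -fE => /mem_map_In[F inF ->].
  exact: (scaled_extreme D0 Dsf ok g0 gE inF).
- move=> S eS dS; rewrite -fE.
  exact: (extreme_complete D0 Dsf ok fs0 g0 gE eS dS).
Qed.
End Table.

Ltac eval_zr := repeat match goal with |- context [@zr ?S ?c] =>
  let v := eval vm_compute in c in
  match v with
  | Z0 => have -> : zr S c = 0 by []
  | Zpos ?p => let k := eval vm_compute in (Pos.to_nat p) in
      have -> : zr S c = k%:R by exact: (zr_nat S k)
  | Zneg ?p => let k := eval vm_compute in (Pos.to_nat p) in
      have -> : zr S c = - k%:R by rewrite -(zr_nat S k) -rmorphN
  end end.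

Ltac nonneg := repeat first [exact: sqrtr_ge0 | exact: ler0n | exact: ler01 | apply: mulr_ge0 | rewrite invr_ge0].

(** Once a common sign is removed both sides are nonnegative, and it suffices to compare their
    squares, which are rational. *)
Ltac sqrt_field :=
  rewrite ?(mulNr, mulrN, opprK, oppr0, mulr0, mul0r); try congr (- _);
  solve [done | apply: eq_sqr_ge0; [solve [nonneg] | solve [nonneg] |
    rewrite ?(exprMn, exprVn); rewrite ?sqr_sqrtr; solve [by field; rewrite ?mulf_neq0 ?sqrtr_eq0 | nonneg]]].

Ltac table_forms :=
  rewrite /=; repeat congr (_ :: _); apply: scaled_formE => //=; eval_zr; sqrt_field.

Ltac table_norm :=
  eval_zr; rewrite ?(exprMn, exprVn); rewrite ?sqr_sqrtr; solve [by field; rewrite ?mulf_neq0 ?sqrtr_eq0 | nonneg].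

Lemma square_free_check (D : nat) : (0 < D)%N ->
  all (fun m => ~~ (m ^ 2 %| D)%N) (iota 2 D) -> square_free D.
Proof.
move=> D0 /allP h m mD; have mle : (m ^ 2 <= D)%N by exact: dvdn_leq.
case: m mD mle => [|[|m]] //; first by rewrite dvd0n => /eqP D00; rewrite D00 in D0.
move=> mD mle; suff /h/negP[] : m.+2 \in iota 2 D by [].
by rewrite mem_iota; nia.
Qed.

Section Rows.
Variable R : realType.
Local Notation row i := (nth (0%N, (0 : R), [::]) (extreme_table R) i%N).

Ltac check_row i okd :=
  rewrite /nth /extreme_table;
  apply: (table_row (i := i) _ _ okd _ _ erefl) => //;
  first [by apply: square_free_check
    | by rewrite ?(mulr_gt0, sqrtr_gt0, invr_gt0) ?ltr0n
    | table_norm | table_forms].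

Lemma row3 : row_valid 3 (row 0).
Proof. check_row 0%N field_ok3. Qed.

Lemma row4 : row_valid 1 (row 1).
Proof. check_row 1%N field_ok4. Qed.

Lemma row7 : row_valid 7 (row 2).
Proof. check_row 2%N field_ok7. Qed.

Lemma row8 : row_valid 2 (row 3).
Proof. check_row 3%N field_ok8. Qed.

Lemma row11 : row_valid 11 (row 4).
Proof. check_row 4%N field_ok11. Qed.

Lemma row15 : row_valid 15 (row 5).
Proof. check_row 5%N field_ok15. Qed.

Lemma row19 : row_valid 19 (row 6).
Proof. check_row 6%N field_ok19. Qed.

Lemma row20 : row_valid 5 (row 7).
Proof. check_row 7%N field_ok20. Qed.

Lemma row23 : row_valid 23 (row 8).
Proof. check_row 8%N field_ok23. Qed.

Lemma row24 : row_valid 6 (row 9).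
Proof. check_row 9%N field_ok24. Qed.

Lemma row31 : row_valid 31 (row 10).
Proof. check_row 10%N field_ok31. Qed.

Lemma row35 : row_valid 35 (row 11).
Proof. check_row 11%N field_ok35. Qed.

Lemma row39 : row_valid 39 (row 12).
Proof. check_row 12%N field_ok39. Qed.

Lemma row40 : row_valid 10 (row 13).
Proof. check_row 13%N field_ok40. Qed.

Lemma row43 : row_valid 43 (row 14).
Proof. check_row 14%N field_ok43. Qed.

Lemma row47 : row_valid 47 (row 15).
Proof. check_row 15%N field_ok47. Qed.

Lemma row51 : row_valid 51 (row 16).
Proof. check_row 16%N field_ok51. Qed.

Lemma row52 : row_valid 13 (row 17).
Proof. check_row 17%N field_ok52. Qed.

Lemma row55 : row_valid 55 (row 18).
Proof. check_row 18%N field_ok55. Qed.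

Lemma row56 : row_valid 14 (row 19).
Proof. check_row 19%N field_ok56. Qed.

Lemma row59 : row_valid 59 (row 20).
Proof. check_row 20%N field_ok59. Qed.

Lemma row67 : row_valid 67 (row 21).
Proof. check_row 21%N field_ok67. Qed.

Lemma row68 : row_valid 17 (row 22).
Proof. check_row 22%N field_ok68. Qed.

End Rows.

(** * The fields with discriminant below 70 in absolute value *)

Definition small_fields : seq nat :=
  [:: 3; 1; 7; 2; 11; 15; 19; 5; 23; 6; 31; 35; 39; 10; 43; 47; 51; 13; 55; 14; 59; 67; 17]%N.

Lemma small_fieldsP (R : realType) (D : nat) : (0 < D)%N -> square_free D ->
  (`|disc R D| < 70)%R -> D \in small_fields.
Proof.
move=> D0 Dsf; rewrite disc_eq // normrN disc4D //.
have -> : int_of_Z (if (D %% 4 == 3)%N then Z.of_nat D else 4%:R * Z.of_nat D)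
    = (if (D %% 4 == 3)%N then D else 4 * D)%N%:Z.
  by case: ifP => _; rewrite ?rmorphM /= (Z_of_intK D%:Z).
rewrite ger0_norm // ltz_nat => small.
have D70 : D \in iota 0 70 by rewrite mem_iota; move: small; case: ifP; lia.
(* A prime whose square divides a positive number below 70 is at most 7. *)
have : all (fun k => [|| k == 0, has (fun m => m ^ 2 %| k) [:: 2; 3; 5; 7],
    ~~ ((if k %% 4 == 3 then k else 4 * k) < 70) | k \in small_fields])%N (iota 0 70) by [].
move/allP=> /(_ _ D70); rewrite small (gtn_eqF D0) /= => /orP[|//].
by rewrite orbF => /or4P[] /Dsf.
Qed.

Lemma small_field_row (R : realType) (D : nat) : D \in small_fields ->
  exists row : nat * R * seq 'M[R[i]]_2, row_valid D row.
Proof.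
rewrite !inE; do 22?[case/predU1P=> [->|]]; last move/eqP->.
- by eexists; exact: row3.
- by eexists; exact: row4.
- by eexists; exact: row7.
- by eexists; exact: row8.
- by eexists; exact: row11.
- by eexists; exact: row15.
- by eexists; exact: row19.
- by eexists; exact: row20.
- by eexists; exact: row23.
- by eexists; exact: row24.
- by eexists; exact: row31.
- by eexists; exact: row35.
- by eexists; exact: row39.
- by eexists; exact: row40.
- by eexists; exact: row43.
- by eexists; exact: row47.
- by eexists; exact: row51.
- by eexists; exact: row52.
- by eexists; exact: row55.
- by eexists; exact: row56.
- by eexists; exact: row59.
- by eexists; exact: row67.
- by eexists; exact: row68.
Qed.

Theorem theorem1p1 (R : realType) (D : nat)
  (hD0 : (0 < D)%N) (hDsf : square_free D) (hdisc : `|disc R D| < 70) :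
  exists (n : nat) (gam : R) (forms : seq 'M[R[i]]_2),
    [/\ (n, gam, forms) \in extreme_table R,
        - disc R D = n%:Z,
        proj_hermite R D = gam,
        (forall F, F \in forms -> abs_proj_extreme D F /\ hdet F = 1)
      & forall S, abs_proj_extreme D S -> hdet S = 1 ->
          exists F g, [/\ F \in forms, SL2OK D g & S = hact g F]].
Proof.
have [row [h1 h2 h3 h4 h5]] := small_field_row R (small_fieldsP hD0 hDsf hdisc).
by exists row.1.1, row.1.2, row.2; split=> //; rewrite -!surjective_pairing.
Qed.
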